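(* Let $M=M_A^3=G_A\backslash\widetilde{M}^3$ be the Sol-manifold associated with a matrix $A\in\operatorname{SL}(2,\mathbb{Z})$ as defined in the context, with the Riemannian metric $g$ induced by the left-invariant metric on $\widetilde{M}^3$ for which the left-invariant fields $U,V,W$ are orthonormal. Let $\alpha\in\mathbb{R}$, $\alpha\neq 0$, and let $\mathcal{F}$ be the one-dimensional foliation of $M$ by the orbits of the vector field induced by $U+\alpha V$. For $\varepsilon>0$ let $\sigma(\Delta_\varepsilon)=g^N+\Delta_{\mathcal{F}_N}$ be the principal symbol (a leafwise operator on the conormal bundle $N^*\mathcal{F}$, independent of $\varepsilon$) of the Laplace–Beltrami operator $\Delta_\varepsilon$ on functions for the metric $g_\varepsilon=g_F+\varepsilon^{-2}g_H$, and let $\operatorname{tr}_{\mathcal{F}_N}$ be the trace determined by the transverse Liouville measure. Then, for $t>0$, $$ \operatorname{tr}_{\mathcal{F}_N} e^{-t\sigma(\Delta_\varepsilon)}=\frac{1}{2}\int_{-\infty}^{+\infty}\frac{\frac{2\alpha}{1+\alpha^2}\,\eta}{\sinh\!\left(\frac{2\alpha}{1+\alpha^2}\,t\eta\right)}\,e^{-t\eta^2}\,d\eta . $$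
   Context: **Sol-manifold.** Let $A\in\operatorname{SL}(2,\mathbb{Z})$ with $|\operatorname{tr}A|>2$, and suppose its eigenvalues are $\lambda,\lambda^{-1}$ with $\lambda>1$. Let $(e_u,e_v)$ be a corresponding positively oriented basis of eigenvectors of $A$ in $\mathbb{R}^2$, and let $C=\begin{pmatrix}c_1^1&c_2^1\\c_1^2&c_2^2\end{pmatrix}$ be the inverse of the matrix with columns $e_u,e_v$, so that $A=C^{-1}\begin{pmatrix}\lambda&0\\0&\lambda^{-1}\end{pmatrix}C$. $\widetilde{M}^3$ is the Lie group of matrices $\gamma(u,v,w)=\begin{pmatrix}e^w&0&u\\0&e^{-w}&v\\0&0&1\end{pmatrix}$, $u,v,w\in\mathbb{R}$, and $G_A$ is the discrete subgroup of all $\gamma(u,v,w)$ with $(u,v)=k(c_1^1,c_1^2)+l(c_2^1,c_2^2)$ and $w=m\ln\lambda$, $k,l,m\in\mathbb{Z}$. Then $M_A^3=G_A\backslash\widetilde{M}^3$ is a compact manifold. The left-invariant vector fields $U=e^w\frac{\partial}{\partial u}$, $V=e^{-w}\frac{\partial}{\partial v}$, $W=\frac{\partial}{\partial w}$ descend to $M$; in these coordinates $g=e^{-2w}du^2+e^{2w}dv^2+dw^2$. **Metrics $g_\varepsilon$.** Put $F=T\mathcal{F}$ and let $H=F^\perp$ be its $g$-orthogonal complement, so $TM=F\oplus H$ and $g=g_F+g_H$; then $g_\varepsilon=g_F+\varepsilon^{-2}g_H$. **Holonomy groupoid and linear holonomy.** $G$ is the holonomy groupoid of $\mathcal{F}$: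 classes of piecewise smooth leafwise paths $\gamma:[0,1]\to M$, two paths being equivalent if they have the same endpoints and the same holonomy; $s(\gamma)=\gamma(0)$, $r(\gamma)=\gamma(1)$. For $x\in M$, $G^x=\{\gamma\in G: r(\gamma)=x\}$, and $s:G^x\to L_x$ is the holonomy covering of the leaf $L_x$ through $x$; $\lambda^x$ is the lift to $G^x$ of the Riemannian volume measure of $L_x$ for the metric induced by $g$. Points of $M$ are identified with constant paths. Let $\pi:N^*\mathcal{F}\to M$ be the conormal bundle of $\mathcal{F}$ (covectors vanishing on $F$). A leafwise path $\gamma$ from $x$ to $y$ induces the linear holonomy map $dh_\gamma^*:N_y^*\mathcal{F}\to N_x^*\mathcal{F}$. **Linearized foliation $\mathcal{F}_N$.** It is the foliation of $N^*\mathcal{F}$ whose leaf through $\nu$ is $\{dh_\gamma^*(\nu):\gamma \text{ a leafwise path with } \gamma(1)=\pi(\nu)\}$. Each leaf of $\mathcal{F}_N$ covers a leaf of $\mathcal{F}$ via $\pi$, and carries the lifted Riemannian metric. The groupoid $G_{\mathcal{F}_N}=\{(\gamma,\nu)\in G\times N^*\mathcal{F}: r(\gamma)=\pi(\nu)\}$ has $r_N(\gamma,\nu)=\nu$, $s_N(\gamma,\nu)=dh_\gamma^*(\nu)$ and product $(\gamma_1,\nu_1)(\gamma_2,dh_{\gamma_1}^*\nu_1)=(\gamma_1\gamma_2,\nu_1)$. Its fiber $G^\nu_{\mathcal{F}_N}=r_N^{-1}(\nu)$ is identified with $G^{\pi(\nu)}$, carrying the measure $\lambda^{\pi(\nu)}$.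 **Principal symbol.** $\Delta_{\mathcal{F}_N}$ is the lift to the leaves of $\mathcal{F}_N$ (along the coverings $\pi$) of the tangential Laplacian $\Delta_F$ on functions, i.e. of the non-negative leafwise Laplacian $\Delta_F=-\frac{1}{1+\alpha^2}(U+\alpha V)^2$; $g^N\in C^\infty(N^*\mathcal{F})$ is the function $\nu\mapsto |\nu|^2$, the squared norm for the fiberwise metric on $N^*\mathcal{F}$ induced by $g$, also viewed as a multiplication operator. Put $\sigma(\Delta_\varepsilon)=g^N+\Delta_{\mathcal{F}_N}$. For $\nu\in N^*\mathcal{F}$, let $\sigma(\Delta_\varepsilon)_\nu$ be the lift, via $s_N$, of the restriction of $\sigma(\Delta_\varepsilon)$ to the leaf of $\nu$ to $G^\nu_{\mathcal{F}_N}$; it is essentially self-adjoint in $L^2(G^\nu_{\mathcal{F}_N},\lambda^{\pi(\nu)})$. **The trace.** The operators $e^{-t\sigma(\Delta_\varepsilon)_\nu}$ are given by a single function $k_t$ on $G_{\mathcal{F}_N}$ through $$\big(e^{-t\sigma(\Delta_\varepsilon)_\nu}\zeta\big)(\gamma,\nu)=\int_{G^{x}}k_t\big((\gamma,\nu)^{-1}(\gamma_1,\nu)\big)\,\zeta(\gamma_1,\nu)\,d\lambda^{x}(\gamma_1),\quad x=\pi(\nu).$$ Denote by $k_t(\nu)$ the restriction of $k_t$ to units (the value at $(\pi(\nu),\nu)$, i.e. the diagonal value of the heat kernel at the unit). Then $$\operatorname{tr}_{\mathcal{F}_N}e^{-t\sigma(\Delta_\varepsilon)}=\int_{N^*\mathcal{F}}k_t(\nu)\,d\nu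 ,$$ where $d\nu$ is the measure on $N^*\mathcal{F}$ obtained by combining the leafwise Riemannian volume of $\mathcal{F}_N$ with the transverse Liouville measure $dy\,d\eta$: here $(x,y)$ are foliated coordinates on $M$ in which the leaves of $\mathcal{F}$ are $y=\mathrm{const}$, and $(x,y,\eta)$ are the induced coordinates on $N^*\mathcal{F}$ (a conormal covector being $\sum_j\eta_j\,dy_j$), in which the leaves of $\mathcal{F}_N$ are $y=\mathrm{const}$, $\eta=\mathrm{const}$.
   Formalization: The formula is proved with the extra factor vol_g(M) on the right-hand side: with the trace as defined, the printed formula holds only when M has volume 1, since rescaling the eigenbasis (e_u, e_v) changes vol_g(M) = ln(λ)·det C and hence the trace, but not the printed right-hand side. *)

(* Defs.v *)
From HB Require Import structures.
From mathcomp Require Import all_boot all_order all_algebra.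
From mathcomp Require Import all_classical all_reals all_analysis.
From mathcomp Require Import ring lra.
Set Implicit Arguments.
Unset Strict Implicit.
Unset Printing Implicit Defensive.
Import Order.TTheory GRing.Theory Num.Theory.
Import numFieldNormedType.Exports.
Local Open Scope classical_set_scope.
Local Open Scope ring_scope.

(** * Semigroups generated by (closures of) operators on L^2

    Elements of L^2(mu) are square-integrable real functions, taken up to
    equality almost everywhere; a possibly unbounded operator is given by its
    graph, a set of pairs of functions. *)

Section HeatSemigroup.
Context {d : measure_display} {T : measurableType d} {R : realType}.
Context (mu : {measure set T -> \bar R}).

Definition L2 : set (T -> R) := [set f | f \in Lfun mu 2%:E].

Definition L2norm (f : T -> R) : \bar R := Lnorm mu 2%:E (EFin \o f).

Record is_C0_semigroup (E : R -> (T -> R) -> (T -> R)) : Prop := {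
  semigroup_L2 : forall t f, 0 <= t -> L2 f -> L2 (E t f) ;
  semigroup_linear : forall t (a : R) f g, 0 <= t -> L2 f -> L2 g ->
    {ae mu, forall x, E t (a \*: f \+ g) x = a * E t f x + E t g x} ;
  semigroup_bounded : forall t, 0 <= t -> exists M : R, forall f, L2 f ->
    (L2norm (E t f) <= M%:E * L2norm f)%E ;
  semigroup0 : forall f, L2 f -> {ae mu, forall x, E 0 f x = f x} ;
  semigroupD : forall s t f, 0 <= s -> 0 <= t -> L2 f ->
    {ae mu, forall x, E (s + t) f x = E s (E t f) x} ;
  semigroup_continuous : forall f, L2 f ->
    L2norm (E t f \- f) @[t --> 0^'+] --> 0%E }.

(* the graph of the infinitesimal generator *)
Definition generator (E : R -> (T -> R) -> (T -> R)) :
    set ((T -> R) * (T -> R)) :=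
  [set fg | [/\ L2 fg.1, L2 fg.2 &
    L2norm (t^-1 \*: (E t fg.1 \- fg.1) \- fg.2) @[t --> 0^'+] --> 0%E]].

Definition graph_closure (H : set ((T -> R) * (T -> R))) :
    set ((T -> R) * (T -> R)) :=
  [set fg | [/\ L2 fg.1, L2 fg.2 & forall e : R, 0 < e ->
    exists2 ph, H ph & (L2norm (fg.1 \- ph.1)%R < e%:E)%E /\
                       (L2norm (fg.2 \- ph.2)%R < e%:E)%E]].

(* [E t = e^{-t H}]: the semigroup whose generator is exactly [- closure H].
   For a non-negative essentially self-adjoint [H] this is the exponential given
   by the functional calculus of its self-adjoint closure. *)
Definition heat_semigroup (H : set ((T -> R) * (T -> R)))
    (E : R -> (T -> R) -> (T -> R)) : Prop :=
  is_C0_semigroup E /\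
  forall f g, generator E (f, g) <-> graph_closure H (f, \- g).

End HeatSemigroup.

Section Sol.
Context {R : realType}.

Local Notation mu := (@lebesgue_measure R).

(** * The Lie group Sol, the lattice, the metric *)

(* A point of the group is given by its coordinates (u, v, w); the
   corresponding matrix is [sol]. *)
Definition vec3 (u v w : R) : 'rV[R]_3 := \row_j [:: u; v; w]`_j.
Definition ucoord (p : 'rV[R]_3) : R := p 0 0.
Definition vcoord (p : 'rV[R]_3) : R := p 0 1.
Definition wcoord (p : 'rV[R]_3) : R := p 0 2.

Definition sol (p : 'rV[R]_3) : 'M[R]_3 := \matrix_(i, j)
  (nth [::] [:: [:: expR (wcoord p); 0; ucoord p];
                [:: 0; expR (- wcoord p); vcoord p];
                [:: 0; 0; 1]] i)`_j.

Definition solmul (p q : 'rV[R]_3) : 'rV[R]_3 :=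
  vec3 (ucoord p + expR (wcoord p) * ucoord q)
       (vcoord p + expR (- wcoord p) * vcoord q)
       (wcoord p + wcoord q).

Lemma vec3P (p q : 'rV[R]_3) :
  ucoord p = ucoord q -> vcoord p = vcoord q -> wcoord p = wcoord q -> p = q.
Proof.
move=> pu pv pw; apply/rowP => -[[|[|[|//]]] i].
- by rewrite (_ : Ordinal i = 0); [exact: pu|exact/val_inj].
- by rewrite (_ : Ordinal i = 1); [exact: pv|exact/val_inj].
- by rewrite (_ : Ordinal i = 2); [exact: pw|exact/val_inj].
Qed.

Lemma ucoord_vec3 (u v w : R) : ucoord (vec3 u v w) = u.
Proof. by rewrite /ucoord mxE. Qed.

Lemma vcoord_vec3 (u v w : R) : vcoord (vec3 u v w) = v.
Proof. by rewrite /vcoord mxE. Qed.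

Lemma wcoord_vec3 (u v w : R) : wcoord (vec3 u v w) = w.
Proof. by rewrite /wcoord mxE. Qed.

Definition vec3E := (ucoord_vec3, vcoord_vec3, wcoord_vec3).

Lemma sum_I3 (F : 'I_3 -> R) : \sum_(i < 3) F i = F 0 + F 1 + F 2.
Proof.
rewrite !big_ord_recl big_ord0 addr0 addrA.
by congr (F _ + F _ + F _); exact/val_inj.
Qed.

Lemma solM (p q : 'rV[R]_3) : sol (solmul p q) = sol p *m sol q.
Proof.
apply/matrixP => -[[|[|[|//]]] i] [[|[|[|//]]] j];
  rewrite !mxE !big_ord_recl big_ord0 !mxE /= ?vec3E ?opprD ?expRD; ring.
Qed.

Definition Cmat (eu ev : 'cV[R]_2) : 'M[R]_2 := invmx (row_mx eu ev).

(* the lattice G_A *)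
Definition GA (C : 'M[R]_2) (lambda : R) : set 'rV[R]_3 :=
  [set p | exists k l m : int,
     p = vec3 (k%:~R * C 0 0 + l%:~R * C 0 1)
              (k%:~R * C 1 0 + l%:~R * C 1 1)
              (m%:~R * ln lambda)].

(* [p] and [q] define the same point of M = G_A \ Sol *)
Definition same_point (Gam : set 'rV[R]_3) (p q : 'rV[R]_3) : Prop :=
  exists2 c, Gam c & q = solmul c p.

(* Functions on M and on bundles over M are represented by invariant functions
   on the cover, and their integrals by integrals over a measurable fundamental
   domain. *)
Definition pt (z : R * R * R) : 'rV[R]_3 := vec3 z.1.1 z.1.2 z.2.

Definition fundamental_domain (Gam D : set 'rV[R]_3) : Prop :=
  measurable (pt @^-1` D) /\
  forall p, exists! q, D q /\ same_point Gam p q.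

(* the vector fields U, V, W, in the frame d/du, d/dv, d/dw *)
Definition Ufield (p : 'rV[R]_3) : 'rV[R]_3 := vec3 (expR (wcoord p)) 0 0.
Definition Vfield (p : 'rV[R]_3) : 'rV[R]_3 := vec3 0 (expR (- wcoord p)) 0.
Definition Wfield (p : 'rV[R]_3) : 'rV[R]_3 := vec3 0 0 1.

(* Gram matrix of g = e^{-2w} du^2 + e^{2w} dv^2 + dw^2 *)
Definition metric (p : 'rV[R]_3) : 'M[R]_3 :=
  diag_mx (vec3 (expR (- (2 * wcoord p))) (expR (2 * wcoord p)) 1).

Definition riem (p x y : 'rV[R]_3) : R := (x *m metric p *m y^T) 0 0.

Lemma riemE (p x y : 'rV[R]_3) : riem p x y =
  expR (- (2 * wcoord p)) * ucoord x * ucoord y +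
  expR (2 * wcoord p) * vcoord x * vcoord y + wcoord x * wcoord y.
Proof.
rewrite /riem mul_mx_diag !mxE sum_I3 !mxE /= mulr1.
by rewrite [x 0 0 * _]mulrC [x 0 1 * _]mulrC.
Qed.

Lemma riem_frame (p : 'rV[R]_3) :
  [/\ [/\ riem p (Ufield p) (Ufield p) = 1, riem p (Vfield p) (Vfield p) = 1 &
          riem p (Wfield p) (Wfield p) = 1],
      riem p (Ufield p) (Vfield p) = 0, riem p (Ufield p) (Wfield p) = 0 &
      riem p (Vfield p) (Wfield p) = 0].
Proof.
rewrite !riemE !vec3E; split; [split| | |]; try ring.
- rewrite !mulr0 !addr0 -!expRD -[RHS]expR0; congr expR; lra.
- rewrite !mulr0 !addr0 add0r -!expRD -[RHS]expR0; congr expR; lra.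
Qed.

Definition volume (D : set 'rV[R]_3) : \bar R :=
  (\int[(mu \x mu) \x mu]_(z in pt @^-1` D)
      (Num.sqrt (\det (metric (pt z))))%:E)%E.

(** * Covectors

    A covector [xi] at a point is a column; its value on the tangent vector [h]
    is [h *m xi]. With the convention ['d f p h = h *m 'J f p] of the library,
    ['J f p *m xi] is the pull-back of [xi] by [f]. *)

Definition covector : Type := 'rV[R]_3 * 'cV[R]_3.

Definition conorm2 (nu : covector) : R :=
  (nu.2^T *m invmx (metric nu.1) *m nu.2) 0 0.

(** * The foliation *)

Definition Xfield (alpha : R) (p : 'rV[R]_3) : 'rV[R]_3 :=
  Ufield p + alpha *: Vfield p.

Definition conormal (alpha : R) : set covector :=
  [set nu | Xfield alpha nu.1 *m nu.2 = 0].

(* the flow of the unit field [(1 + alpha ^ 2)^(-1/2) (U + alpha V)]; its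
   orbits are the leaves and its time is leafwise arc length *)
Definition flow (alpha s : R) (p : 'rV[R]_3) : 'rV[R]_3 :=
  p + (s / Num.sqrt (1 + alpha ^+ 2)) *: Xfield alpha p.

Lemma wcoord_flow alpha s (p : 'rV[R]_3) : wcoord (flow alpha s p) = wcoord p.
Proof. by rewrite /wcoord !mxE /= mulr0 addr0 mulr0 addr0. Qed.

Lemma ucoord_flow alpha s (p : 'rV[R]_3) : ucoord (flow alpha s p) =
  ucoord p + s / Num.sqrt (1 + alpha ^+ 2) * expR (wcoord p).
Proof. by rewrite /ucoord !mxE /= mulr0 addr0. Qed.

Lemma vcoord_flow alpha s (p : 'rV[R]_3) : vcoord (flow alpha s p) =
  vcoord p + s / Num.sqrt (1 + alpha ^+ 2) * (alpha * expR (- wcoord p)).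
Proof. by rewrite /vcoord !mxE /= add0r. Qed.

Lemma Xfield_flow alpha s (p : 'rV[R]_3) :
  Xfield alpha (flow alpha s p) = Xfield alpha p.
Proof. by rewrite /Xfield /Ufield /Vfield wcoord_flow. Qed.

Lemma flowD alpha s s' (p : 'rV[R]_3) :
  flow alpha (s + s') p = flow alpha s (flow alpha s' p).
Proof.
rewrite [RHS]/flow Xfield_flow /flow mulrDl scalerDl -addrA.
by congr (p + _); rewrite addrC.
Qed.

Lemma flow_solmul alpha s (c p : 'rV[R]_3) :
  solmul c (flow alpha s p) = flow alpha s (solmul c p).
Proof.
apply: vec3P; rewrite ?(ucoord_flow, vcoord_flow, wcoord_flow, vec3E) //.
- by rewrite expRD; ring.
- by rewrite opprD expRD; ring.
Qed.

Lemma sqr1_gt0 (alpha : R) : 0 < 1 + alpha ^+ 2.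
Proof. by rewrite ltr_wpDr ?sqr_ge0. Qed.

Lemma riem_flow alpha s (p : 'rV[R]_3) :
  'D_1 (fun s => flow alpha s p) s =
    (Num.sqrt (1 + alpha ^+ 2))^-1 *: Xfield alpha (flow alpha s p) /\
  riem (flow alpha s p) ('D_1 (fun s => flow alpha s p) s)
                        ('D_1 (fun s => flow alpha s p) s) = 1.
Proof.
suff vE : 'D_1 (fun s => flow alpha s p) s =
    (Num.sqrt (1 + alpha ^+ 2))^-1 *: Xfield alpha (flow alpha s p).
  split=> //; rewrite vE riemE.
  have -> : ucoord ((Num.sqrt (1 + alpha ^+ 2))^-1 *:
               Xfield alpha (flow alpha s p))
      = (Num.sqrt (1 + alpha ^+ 2))^-1 * expR (wcoord p).
    by rewrite /ucoord !mxE /= mulr0 addr0 wcoord_flow.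
  have -> : vcoord ((Num.sqrt (1 + alpha ^+ 2))^-1 *:
               Xfield alpha (flow alpha s p))
      = (Num.sqrt (1 + alpha ^+ 2))^-1 * (alpha * expR (- wcoord p)).
    by rewrite /vcoord !mxE /= add0r wcoord_flow.
  have -> : wcoord ((Num.sqrt (1 + alpha ^+ 2))^-1 *:
               Xfield alpha (flow alpha s p))
      = 0.
    by rewrite /wcoord !mxE /= mulr0 addr0 mulr0.
  rewrite wcoord_flow mulr0 addr0.
  have e1 : expR (- (2 * wcoord p)) = (expR (wcoord p))^-1 ^+ 2.
    by rewrite -expRN -expRM_natl; congr expR; ring.
  have e2 : expR (2 * wcoord p) = expR (wcoord p) ^+ 2.
    by rewrite -expRM_natl.
  have s2 : Num.sqrt (1 + alpha ^+ 2) ^+ 2 = 1 + alpha ^+ 2.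
    by rewrite sqr_sqrtr // ltW // sqr1_gt0.
  have s0 : Num.sqrt (1 + alpha ^+ 2) != 0.
    by rewrite gt_eqF // sqrtr_gt0 sqr1_gt0.
  rewrite e1 e2 expRN.
  have x0 : expR (wcoord p) != 0 by rewrite gt_eqF // expR_gt0.
  transitivity ((1 + alpha ^+ 2) / Num.sqrt (1 + alpha ^+ 2) ^+ 2).
    by field; rewrite s0 x0.
  by rewrite s2 divff // gt_eqF // sqr1_gt0.
rewrite Xfield_flow /flow.
rewrite /derive; apply: cvg_lim => //.
apply: cvg_near_cst; near=> h.
have h0 : h != 0 by near: h; exact: nbhs_dnbhs_neq.
rewrite opprD addrACA subrr add0r -scalerBl scalerA; congr (_ *: _).
by rewrite /= scaler1 -mulrBl addrK mulrA mulVf // mul1r.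
Unshelve. all: by end_near. Qed.

(* A leafwise path of M with range p is [r |-> flow (theta r) p] for some
   [theta] vanishing at the range, and its holonomy is the germ at p of the map
   induced by [flow s], [s] being the value of [theta] at the source, on local
   leaf spaces. Two paths with range p and displacements s1, s2 define the same
   element of the holonomy groupoid when they have the same source in M and
   the same germ, i.e. when for q near p the end points of the displaced paths
   are on the same plaque near the source. *)
Definition same_holonomy (Gam : set 'rV[R]_3) (alpha : R) (p : 'rV[R]_3)
    (s1 s2 : R) : Prop :=
  exists c, Gam c /\ exists delta : 'rV[R]_3 -> R,
    [/\ {for p, continuous delta}, delta p = 0 &
        \forall q \near p,
          solmul c (flow alpha s1 q) = flow alpha (s2 + delta q) q].

Lemma same_holonomyP (C : 'M[R]_2) lambda alpha (p : 'rV[R]_3) s1 s2 :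
  alpha != 0 ->
  same_holonomy (GA C lambda) alpha p s1 s2 <-> s1 = s2.
Proof.
move=> alpha0; split; last first.
  move=> ->; exists 0; split.
    exists 0, 0, 0; rewrite !mul0r addr0.
    by apply: vec3P; rewrite vec3E /ucoord /vcoord /wcoord mxE.
  exists (cst 0); split=> //; first exact: cst_continuous.
  apply: (@filterE _ (nbhs p)) => q; rewrite addr0; apply: vec3P; rewrite vec3E;
    by rewrite /ucoord /vcoord /wcoord [(0 : 'rV_3) 0 _]mxE
      ?[(0 : 'rV_3) 0 2]mxE ?oppr0 ?expR0 ?mul1r add0r.
move=> [c [_ [delta [_ dp near_p]]]].
set k := (Num.sqrt (1 + alpha ^+ 2))^-1.
have k0 : k != 0 by rewrite invr_eq0 gt_eqF // sqrtr_gt0 sqr1_gt0.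
have E q : solmul c (flow alpha s1 q) = flow alpha (s2 + delta q) q ->
    [/\ wcoord c = 0,
        ucoord c = (s2 + delta q - s1) * k * expR (wcoord q) &
        vcoord c = (s2 + delta q - s1) * k * (alpha * expR (- wcoord q))].
  move=> eq_q.
  have := congr1 wcoord eq_q; have := congr1 ucoord eq_q.
  have := congr1 vcoord eq_q.
  rewrite !vec3E !(ucoord_flow, vcoord_flow, wcoord_flow) -/k => hv hu hw.
  have w0 : wcoord c = 0 by apply: (addIr (wcoord q)); rewrite hw add0r.
  move: hu hv; rewrite w0 oppr0 expR0 !mul1r => hu hv; split => //.
  - apply: (addIr (ucoord q + s1 * k * expR (wcoord q))); rewrite hu; ring.
  - apply: (addIr (vcoord q + s1 * k * (alpha * expR (- wcoord q)))).
    rewrite hv; ring.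
(* a point near p with another value of w *)
have [h [h0 near_h]] : exists h, h != 0 /\
    solmul c (flow alpha s1 (p + h *: vec3 0 0 1)) =
    flow alpha (s2 + delta (p + h *: vec3 0 0 1)) (p + h *: vec3 0 0 1).
  have cvgp : (p + h *: vec3 0 0 1) @[h --> (0 : R)^'] --> p.
    have -> : nbhs p = nbhs (p + 0 *: vec3 0 0 1) by rewrite scale0r addr0.
    apply: cvgD; first exact: cvg_cst.
    by apply: cvgZr_tmp; exact: (@cvg_within _ (nbhs (0 : R))).
  have near_h := cvgp _ near_p.
  have near0 : \forall h \near (0:R)^', h != 0 by exact: nbhs_dnbhs_neq.
  have [h [? ?]] :=
    filter_ex (@filterI _ _ (dnbhs_filter (0 : R)) _ _ near0 near_h).
  by exists h.
have [_ u1 v1] := E _ (nbhs_singleton near_p).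
have [_ u2 v2] := E _ near_h.
move: u1 v1 u2 v2.
have -> : wcoord (p + h *: vec3 0 0 1) = wcoord p + h.
  by rewrite /wcoord !mxE /= mulr1.
rewrite dp addr0 opprD !expRD.
set d := _ * k; set d' := _ * k => u1 v1 u2 v2.
have xp0 : expR (wcoord p) != 0 by rewrite gt_eqF // expR_gt0.
have xn0 : expR (- wcoord p) != 0 by rewrite gt_eqF // expR_gt0.
have dE : d = d' * expR h.
  by apply: (mulIf xp0); rewrite -u1 u2; ring.
have dE' : d = d' * expR (- h).
  have ax0 : alpha * expR (- wcoord p) != 0 by rewrite mulf_neq0.
  by apply: (mulIf ax0); rewrite -v1 v2; ring.
have d'0 : d' = 0.
  apply/eqP; apply: contraT => d'0; exfalso.
  move: dE'; rewrite dE => /(mulfI d'0) /expR_inj hh.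
  by move/eqP: h0; apply; lra.
move: dE; rewrite d'0 mul0r /d => /eqP.
by rewrite mulf_eq0 (negbTE k0) orbF subr_eq0 => /eqP.
Unshelve. all: by end_near. Qed.

(** * The linearized foliation and its groupoid

    By [same_holonomyP], elements of the holonomy groupoid G with range p
    are parametrized by their displacement s: (p, s) has range p and source
    [flow s p]. Likewise an element of the groupoid of F_N is a pair (nu, s),
    and by [riem_flow] the measure lambda^x on the fibre is Lebesgue measure
    ds. *)

Definition arrow : Type := covector * R.

(* [dh_gamma^* xi] for gamma = (p, s): the holonomy of gamma, from the source
   [flow s p] to the range p, is induced by [flow (- s)] *)
Definition dhol (alpha s : R) (nu : covector) : covector :=
  (flow alpha s nu.1, 'J (flow alpha (- s)) (flow alpha s nu.1) *m nu.2).

Definition rN (a : arrow) : covector := a.1.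
Definition sN (alpha : R) (a : arrow) : covector := dhol alpha a.2 a.1.
Definition unitN (nu : covector) : arrow := (nu, 0).
Definition invN (alpha : R) (a : arrow) : arrow := (sN alpha a, - a.2).
(* meaningful when [sN a = rN b] *)
Definition mulN (a b : arrow) : arrow := (rN a, a.2 + b.2).

(* the action of left translation by c on covectors is nu |-> nu', where nu
   is the pull-back of nu'; a function on the groupoid over M is an invariant
   function on the cover *)
Definition invariant_on_arrows (Gam : set 'rV[R]_3) (alpha : R)
    (k : arrow -> R) : Prop :=
  forall c p xi s, Gam c -> conormal alpha (solmul c p, xi) ->
    k ((p, 'J (solmul c) p *m xi), s) = k ((solmul c p, xi), s).

(** * The principal symbol *)

(* Delta_F *)
Definition leaf_laplacian (alpha : R) (f : 'rV[R]_3 -> R) (p : 'rV[R]_3) : R :=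
  - ((1 + alpha ^+ 2)^-1 *
     'D_(Xfield alpha p) (fun q => 'D_(Xfield alpha q) f q) p).

Lemma derive_flow alpha (f : 'rV[R]_3 -> R) p s :
  derivable f (flow alpha s p) (Xfield alpha (flow alpha s p)) ->
  is_derive s 1 (fun s => f (flow alpha s p))
    ((Num.sqrt (1 + alpha ^+ 2))^-1 *
     'D_(Xfield alpha (flow alpha s p)) f (flow alpha s p)).
Proof.
set k := (Num.sqrt (1 + alpha ^+ 2))^-1; set q := flow alpha s p.
set x := Xfield alpha q => /= df.
have k0 : k != 0 by rewrite invr_eq0 gt_eqF // sqrtr_gt0 sqr1_gt0.
pose g (h : R) : R := f (h *: x + q).
have dg : is_derive (k * (s - s)) 1 g ('D_x f q).
  rewrite subrr mulr0; apply: DeriveDef; first exact: (derivable1P f q x).1.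
  rewrite /derive; set g1 := fun h => h^-1 *: _; set g2 := fun h => h^-1 *: _.
  suff -> : g1 = g2 by [].
  by rewrite funeqE /g1 /g2 /g => h /=; rewrite addr0 scale0r add0r [_%:A]mulr1.
have -> : (fun s' => f (flow alpha s' p)) = g \o (fun s' => k * (s' - s)).
  apply/funext => s' /=; rewrite /g /x Xfield_flow /q /flow addrCA -scalerDl.
  by congr (f (_ + _ *: _)); rewrite /k; ring.
apply: is_derive_eq.
by rewrite /GRing.scale /=; ring.
Qed.

Lemma leaf_laplacian_flow alpha (f : 'rV[R]_3 -> R) p s :
  (forall q, derivable f q (Xfield alpha q)) ->
  (forall q, derivable (fun q => 'D_(Xfield alpha q) f q) q (Xfield alpha q)) ->
  - derive1n 2 (fun s => f (flow alpha s p)) s =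
  leaf_laplacian alpha f (flow alpha s p).
Proof.
move=> df ddf; rewrite /leaf_laplacian; congr (- _) => /=.
set k := (Num.sqrt (1 + alpha ^+ 2))^-1.
have -> : derive1 (fun s => f (flow alpha s p)) =
    (fun s => k * 'D_(Xfield alpha (flow alpha s p)) f (flow alpha s p)).
  apply/funext => s'; rewrite derive1E.
  by have := derive_flow (df (flow alpha s' p)) => d1; rewrite derive_val.
rewrite derive1E.
have d2 := derive_flow (ddf (flow alpha s p)).
rewrite derive_val /GRing.scale /= mulrA; congr (_ * _).
by rewrite /k -invfM -expr2 sqr_sqrtr // ltW // sqr1_gt0.
Qed.

(* [sigma(Delta_eps)_nu = g^N + Delta_{F_N}], acting on functions of the
   displacement s; the symbol does not involve [eps]. The lift to the leaf of
   [Delta_F = - (1 + alpha ^ 2)^-1 (U + alpha V)^2] is [- d^2/ds^2], see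
   [leaf_laplacian_flow]. *)
Definition symbol (eps alpha : R) (nu : covector) (zeta : R -> R) : R -> R :=
  fun s => conorm2 (sN alpha (nu, s)) * zeta s - derive1n 2 zeta s.

Definition smooth_compact : set (R -> R) :=
  [set f | (forall n x, derivable (derive1n n f) x 1) /\
           exists a : R, forall x, a < `|x| -> f x = 0].

Definition symbol_graph (eps alpha : R) (nu : covector) :
    set ((R -> R) * (R -> R)) :=
  [set (zeta, symbol eps alpha nu zeta) | zeta in smooth_compact].

(* [E nu r = e^{- r sigma(Delta_eps)_nu}] *)
Definition symbol_semigroup (eps alpha : R)
    (E : covector -> R -> (R -> R) -> (R -> R)) : Prop :=
  forall nu, conormal alpha nu ->
    heat_semigroup mu (symbol_graph eps alpha nu) (E nu).

(* [k] is the (continuous) kernel on the groupoid of the operators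
   [e^{- t sigma(Delta_eps)_nu}] *)
Record symbol_kernel (Gam : set 'rV[R]_3) (alpha t : R)
    (E : covector -> R -> (R -> R) -> (R -> R)) (k : arrow -> R) : Prop := {
  kernel_invariant : invariant_on_arrows Gam alpha k ;
  kernel_continuous :
    {within [set a : arrow | conormal alpha (rN a)], continuous k} ;
  kernelE : forall nu zeta, conormal alpha nu -> L2 mu zeta ->
    {ae mu, forall s, (E nu t zeta s)%:E =
      (\int[mu]_s1 (k (mulN (invN alpha (nu, s)) (nu, s1)) * zeta s1)%:E)%E} }.

(** * The trace *)

(* Foliated coordinates (x, y): y = (y1, y2) are the coordinates (v, w) on the
   transversal u = 0, extended to be constant on leaves, and x is arc length
   along the leaf measured from the transversal. *)
Definition ycoord (alpha : R) (p : 'rV[R]_3) : 'rV[R]_2 :=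
  \row_j [:: vcoord p - alpha * expR (- (2 * wcoord p)) * ucoord p;
             wcoord p]`_j.

Lemma ycoord_flow alpha s (p : 'rV[R]_3) :
  ycoord alpha (flow alpha s p) = ycoord alpha p.
Proof.
rewrite /ycoord ucoord_flow vcoord_flow wcoord_flow.
have -> : expR (- wcoord p) = expR (- (2 * wcoord p)) * expR (wcoord p).
  by rewrite -expRD; congr expR; lra.
by apply/rowP => -[[|[|//]] j]; rewrite !mxE //=; ring.
Qed.

Definition foliated (alpha : R) (z : R * R * R) : 'rV[R]_3 :=
  flow alpha z.1.1 (vec3 0 z.1.2 z.2).

(* the covector [eta_1 dy_1 + eta_2 dy_2] at p *)
Definition conormal_coord (alpha : R) (p : 'rV[R]_3) (eta : R * R) : covector :=
  (p, 'J (ycoord alpha) p *m \col_j [:: eta.1; eta.2]`_j).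

(* the integral over N^*F, with respect to dx dy deta, of the restriction of
   [k] to the units; [D] is a fundamental domain *)
Definition traceFN (alpha : R) (D : set 'rV[R]_3) (k : arrow -> R) : \bar R :=
  (\int[(mu \x mu) \x mu]_(z in foliated alpha @^-1` D)
     \int[mu \x mu]_eta
        (k (unitN (conormal_coord alpha (foliated alpha z) eta)))%:E)%E.

Definition sinh (x : R) : R := (expR x - expR (- x)) / 2.

End Sol.

(* Main.v *)
Require Import Defs.
From HB Require Import structures.
From mathcomp Require Import all_boot all_order all_algebra.
From mathcomp Require Import all_classical all_reals all_analysis.
From mathcomp Require Import measurable_realfun.
From mathcomp Require Import ring lra.
Import Order.TTheory GRing.Theory Num.Theory.
Import numFieldNormedType.Exports.
Local Open Scope classical_set_scope.
Local Open Scope ring_scope.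
Set Implicit Arguments.
Unset Strict Implicit.
Unset Printing Implicit Defensive.

(** On the leaf of a covector [nu], parametrized by arc length [s], the lifted
    symbol is the harmonic oscillator [- d^2/ds^2 + a^2 + (b + beta s)^2], where
    [beta = omega a]: the linear holonomy adds a drift proportional to [a].
    Its heat flow issued from the unit [s = 0] is Mehler's Gaussian [m r],
    r > 0. The path [m] solves the evolution equation in the closure of the
    symbol on [C_c^oo], so by uniqueness [E t (m r) = m (t + r)]. As [r] tends
    to 0 the functions [m r] form an approximate identity at 0 and the kernel
    is continuous, so the kernel at the unit is [m t 0].
    The integral of [m t 0] over [b] is Gaussian and equals
    [(1/2) (omega a / sinh (omega t a)) exp (- t a^2)]. Finally, with
    [N = sqrt (1 + alpha^2)], one has [da db = N e^{-w} deta] in the fibres and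
    [dx dy = N e^{-w} du dv dw] on the base, so [dx dy deta = dvol da db]. *)

(** The Dirac mass at the unit is not in L^2, and the kernel is known only through its action on
    L^2, almost everywhere. The Gaussians [mehler r] with r > 0 stand in for the Dirac mass, and the
    sequence r = [harmonic n] leaves one null set for all n; continuity of the kernel over conormal
    covectors then reaches the unit itself. Uniqueness has to be drawn from a semigroup known to be
    right continuous, with a bound for each time separately. A bound uniform on compact subsets of
    ]0, +oo[ is enough, because the comparison is run with a positive delay. In each conormal fibre
    the line a = 0, where Mehler's formula would divide by beta = 0, is negligible. *)

Section RealLemmas.
Context {R : realType}.

(** For a slope e > 0 take the supremum of the points where d lies below the line of slope e: the
    condition on the left puts it in the set, and the condition on the right moves it further unless
    it is [t]. Only one-sided information enters: no upward jump from the left, and an upper right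
    derivative at most 0. *)
Lemma right_derivative_le0 (d : R -> R) (t : R) : 0 <= t ->
  (forall r, 0 <= r < t -> forall e, 0 < e -> exists2 del, 0 < del &
     forall h, 0 < h < del -> d (r + h) <= d r + e * h) ->
  (forall r, 0 < r <= t -> forall e, 0 < e -> exists2 del, 0 < del &
     forall h, 0 < h < del -> d r <= d (r - h) + e) ->
  d t <= d 0.
Proof.
move=> t0 dr dl; apply/ler_addgt0Pr => e0 e0_gt0.
have [e e_gt0 ete0] : exists2 e, 0 < e & e * t <= e0.
  exists (e0 / (t + 1)); first by rewrite divr_gt0 // ltr_wpDl.
  by rewrite -mulrA ger_pMr // mulrC ler_pdivrMr ?ltr_wpDl // mul1r lerDl.
apply: le_trans (lerD (lexx (d 0)) ete0) => {e0 e0_gt0 ete0}.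
pose S := [set r | 0 <= r <= t /\ d r <= d 0 + e * r].
have S0 : S 0 by split; rewrite ?lexx ?t0 // mulr0 addr0.
have Sub : has_ubound S by exists t => r [/andP[]].
have Ssup : has_sup S by split; [exists 0|].
set s := sup S.
have s0 : 0 <= s by exact: ub_le_sup.
have st : s <= t by apply: ge_sup; [exists 0|move=> r [/andP[]]].
have Ss : S s.
  split; first by rewrite s0.
  have [<-|s_neq0] := eqVneq 0 s; first by rewrite mulr0 addr0.
  have s_gt0 : 0 < s by rewrite lt_neqAle s_neq0.
  apply/ler_addgt0Pr => e' e'_gt0.
  have := dl s _ e' e'_gt0; rewrite s_gt0 st => -[]// del del0 Hdel.
  have [r Sr rs] := sup_adherent del0 Ssup.
  have := ub_le_sup Sub Sr; rewrite -/s le_eqVlt => /predU1P[<-|r_lt].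
    by case: Sr => _ /le_trans; apply; rewrite lerDl ltW.
  have := Hdel (s - r); rewrite subr_gt0 r_lt ltrBlDr -ltrBlDl rs subKr.
  move=> /(_ isT) /le_trans; apply; rewrite lerD2r.
  case: Sr => _ /le_trans; apply; rewrite lerD2l ler_pM2l //; exact: ltW.
case: Ss => _; move: st; rewrite le_eqVlt => /predU1P[->//|s_lt dS].
have := dr s; rewrite s0 s_lt => /(_ isT e e_gt0)[del del0 Hdel].
pose h := Num.min (del / 2) (t - s).
have h0 : 0 < h by rewrite lt_min divr_gt0 // subr_gt0.
have hdel : h < del by rewrite gt_min ltr_pdivrMr // ltr_pMr // ltr1n.
have := Hdel h; rewrite h0 hdel => /(_ isT) dh.
have : S (s + h).
  split; first by rewrite addr_ge0 // ?(ltW h0) //= -lerBrDl ge_min lexx orbT.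
  by apply: le_trans dh _; rewrite mulrDr addrA lerD2r.
by move=> /(ub_le_sup Sub); rewrite -/s gerDl leNgt h0.
Qed.

(** This is Baire's argument for sets that are open only to the right: each [U n] meets every
    subinterval, hence contains a closed one, and the supremum of the left ends of the nested
    intervals is a common point. Right neighbourhoods are what right continuous orbits provide. *)
Lemma nested_right_neighbourhoods (U : nat -> set R) (a b : R) : a < b ->
  (forall n c d, a <= c -> c < d -> d <= b ->
     exists2 r, c <= r < d & U n r) ->
  (forall n r, a <= r -> U n r ->
     exists2 del, 0 < del & forall s, r <= s < r + del -> U n s) ->
  exists r, a <= r /\ forall n, U n r.
Proof.
move=> ab dense nbr.
pose I := {p : R * R | [/\ a <= p.1, p.1 < p.2 & p.2 <= b]}.
have step (n : nat) (p : I) : exists q : I,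
    [/\ (sval p).1 <= (sval q).1, (sval q).2 <= (sval p).2 &
        forall s, (sval q).1 <= s <= (sval q).2 -> U n s].
  case: p => -[c d] /= [ac cd db].
  have [r /andP[cr rd] Ur] := dense n c d ac cd db.
  have [del del0 Us] := nbr n r (le_trans ac cr) Ur.
  (* Half of [del] keeps the closed interval inside the half-open neighbourhood. *)
  pose d' := Num.min d (r + del / 2).
  have rd' : r < d' by rewrite lt_min rd ltrDl divr_gt0.
  have d'd : d' <= d by rewrite ge_min lexx.
  exists (exist _ (r, d') (And3 (le_trans ac cr) rd' (le_trans d'd db))).
  split => //= s /andP[rs sd']; apply: Us; rewrite rs.
  apply: (le_lt_trans sd'); rewrite gt_min ltrD2l ltr_pdivrMr //.
  by rewrite ltr_pMr // ltr1n orbT.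
have [f stepf] := boolp.choice (fun np : nat * I => step np.1 np.2).
pose p0 : I := exist _ (a, b) (And3 (lexx a) ab (lexx b)).
pose p := fix p n := if n is m.+1 then f (m, p m) else p0.
pose c n := (sval (p n)).1; pose d n := (sval (p n)).2.
have cS n : c n <= c n.+1 by rewrite /c /=; case: (stepf (n, p n)).
have dS n : d n.+1 <= d n by rewrite /d /=; case: (stepf (n, p n)).
have US n s : c n.+1 <= s <= d n.+1 -> U n s.
  by rewrite /c /d /=; case: (stepf (n, p n)) => _ _; apply.
have cm m n : (m <= n)%N -> c m <= c n.
  exact: (homo_leq (@lexx _ R) (@le_trans _ R)).
have dm m n : (m <= n)%N -> d n <= d m.
  exact: (homo_leq (r := fun x y : R => y <= x) (@lexx _ R)
           (fun _ _ _ h1 h2 => le_trans h2 h1)).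
have cd m n : c m <= d n.
  have [mn|/ltnW nm] := leqP m n.
    by rewrite (le_trans (cm _ _ mn)) //; case: (svalP (p n)) => _ /ltW.
  by rewrite (le_trans _ (dm _ _ nm)) //; case: (svalP (p m)) => _ /ltW.
have cub : has_ubound (range c) by exists (d 0%N) => _ [m _ <-]; exact: cd.
exists (sup (range c)); split.
  by apply: (ub_le_sup cub); exists 0%N.
move=> n; apply: US; apply/andP; split.
  by apply: (ub_le_sup cub); exists n.+1.
by apply: ge_sup => [|_ [m _ <-]]; [exists (c 0%N); exists 0%N|exact: cd].
Qed.

End RealLemmas.

(** * Strongly continuous semigroups on L^2 *)

Section L2Lemmas.
Context {d : measure_display} {T : measurableType d} {R : realType}.
Context {mu : {measure set T -> \bar R}}.
Implicit Types f g h : T -> R.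

Local Notation L2 := (L2 mu).
Local Notation L2norm := (L2norm mu).

(** [fine] sends +oo to 0, so this is the norm only for functions in [L2]; hence the [L2] hypotheses
    below. *)
Definition nrm f : R := fine (L2norm f).

Lemma one_le2 : (1 <= 2%:E :> \bar R)%E.
Proof. by rewrite lee_fin ler1n. Qed.

Lemma L2_measurable f : L2 f -> measurable_fun [set: T] f.
Proof. by rewrite /Defs.L2/= inE => /andP[]; rewrite inE. Qed.

Lemma L2_lty f : L2 f -> (L2norm f < +oo)%E.
Proof. by rewrite /Defs.L2/= inE => /andP[_]; rewrite inE. Qed.

Lemma L2I f : measurable_fun [set: T] f -> (L2norm f < +oo)%E -> L2 f.
Proof. by move=> mf lf; rewrite /Defs.L2/= inE; apply/andP; split; rewrite inE. Qed.

Lemma L2D f g : L2 f -> L2 g -> L2 (f \+ g).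
Proof.
move=> Lf Lg; have := @Lfun_addr_closed _ _ _ mu _ one_le2.
by move=> -[_ /(_ f g)]; apply.
Qed.

Lemma L2N f : L2 f -> L2 (\- f).
Proof. by move=> Lf; exact: (@Lfun_oppr_closed _ _ _ mu _ f Lf). Qed.

Lemma L2B f g : L2 f -> L2 g -> L2 (f \- g).
Proof. by move=> Lf /L2N Lg; exact: L2D. Qed.

Lemma L2Z (a : R) f : L2 f -> L2 (a \*: f).
Proof.
move=> Lf; have := @Lfun_scale _ _ _ mu f a 2 (ler1n _ 2) Lf.
by rewrite (_ : a \o* f = a \*: f) //; apply/funext => x /=; rewrite mulrC.
Qed.

Lemma L2normE f : L2 f -> L2norm f = (nrm f)%:E.
Proof.
by move=> /L2_lty Lf; rewrite /nrm fineK // ge0_fin_numE // /Defs.L2norm Lnorm_ge0.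
Qed.

Lemma nrm_ge0 f : 0 <= nrm f.
Proof. by rewrite fine_ge0 // /Defs.L2norm Lnorm_ge0. Qed.

Lemma nrmD f g : L2 f -> L2 g -> nrm (f \+ g) <= nrm f + nrm g.
Proof.
move=> Lf Lg; rewrite -lee_fin EFinD -!L2normE //; last exact: L2D.
by apply: eminkowski => //; [exact: L2_measurable..|exact: one_le2].
Qed.

Lemma nrmN f : nrm (\- f) = nrm f.
Proof.
rewrite /nrm /Defs.L2norm; congr fine.
exact: (oppe_Lnorm mu (EFin \o f)).
Qed.

Lemma nrmZ (a : R) f : L2 f -> nrm (a \*: f) = `|a| * nrm f.
Proof.
move=> Lf; have mf : f \in Lfun mu 2%:E by [].
have := @LnormZ _ _ _ mu _ one_le2 (Lfun_Sub one_le2 mf) a.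
move=> h; apply: EFin_inj; rewrite EFinM -!L2normE //; exact: L2Z.
Qed.

Lemma L2norm_le f g : measurable_fun [set: T] f -> measurable_fun [set: T] g ->
  (forall x, `|f x| <= `|g x|) -> (L2norm f <= L2norm g)%E.
Proof.
move=> mf mg fg; rewrite /Defs.L2norm unlock.
have m2 (h : T -> R) : measurable_fun setT h ->
    measurable_fun [set: T] (fun x => (`|(h x)%:E| `^ 2)%E).
  move=> mh; apply: (measurableT_comp (measurable_poweR _)).
  by apply: measurableT_comp => //; exact/measurable_EFinP.
apply: gt0_ler_poweR.
- by rewrite invr_ge0.
- by rewrite in_itv/= leey andbT; apply: integral_ge0 => x _; rewrite lee_fin powR_ge0.
- by rewrite in_itv/= leey andbT; apply: integral_ge0 => x _; rewrite lee_fin powR_ge0.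
apply: ge0_le_integral => //; [by move=> x _; exact: poweR_ge0|exact: m2|exact: m2|].
by move=> x _; apply: gt0_ler_poweR => //; rewrite ?in_itv/= ?leey ?andbT lee_fin.
Qed.

Lemma L2_le f g : measurable_fun [set: T] f -> L2 g ->
  (forall x, `|f x| <= `|g x|) -> L2 f.
Proof.
move=> mf Lg fg; apply: L2I => //; apply: le_lt_trans (L2_lty Lg).
by apply: L2norm_le => //; exact: L2_measurable.
Qed.

Lemma nrm_le f g : measurable_fun [set: T] f -> L2 g ->
  (forall x, `|f x| <= `|g x|) -> nrm f <= nrm g.
Proof.
move=> mf Lg fg; rewrite -lee_fin -!L2normE //; last exact: L2_le fg.
by apply: L2norm_le => //; exact: L2_measurable.
Qed.

Lemma nrm_leZ (a : R) f g : 0 <= a -> measurable_fun [set: T] f -> L2 g ->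
  (forall x, `|f x| <= a * g x) -> nrm f <= a * nrm g.
Proof.
move=> a0 mf Lg fg; rewrite -[a in leRHS]ger0_norm // -nrmZ //.
apply: nrm_le => //; first exact: L2Z.
by move=> x; rewrite (le_trans (fg x)) //= ler_norm.
Qed.

Lemma nrm_eq0 f : L2 f -> nrm f = 0 -> {ae mu, forall x, f x = 0}.
Proof.
move=> Lf f0; have : L2norm f = 0%E by rewrite L2normE // f0.
have mf : measurable_fun [set: T] (EFin \o f).
  by apply/measurable_EFinP; exact: L2_measurable.
move=> /(Lnorm_eq0_eq0 mf) => /(_ (lt_le_trans lte01 one_le2)).
by apply: filterS => x /(_ I) [].
Qed.

Lemma ae_eq_nrm f g : measurable_fun [set: T] f -> measurable_fun [set: T] g ->
  {ae mu, forall x, f x = g x} -> nrm f = nrm g.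
Proof.
move=> mf mg fg; rewrite /nrm /Defs.L2norm unlock.
apply: (congr1 (fun z : \bar R => fine (z `^ 2^-1)%E)).
have m2 (h : T -> R) : measurable_fun setT h ->
    measurable_fun [set: T] (fun x => (`|(h x)%:E| `^ 2)%E).
  move=> mh; apply: (measurableT_comp (measurable_poweR _)).
  by apply: measurableT_comp => //; exact/measurable_EFinP.
apply: ge0_ae_eq_integral => //; [exact: m2|exact: m2|..].
- by move=> x _; exact: poweR_ge0.
- by move=> x _; exact: poweR_ge0.
by apply: filterS fg => x /= ->.
Qed.

Lemma nrm_ae0 f : measurable_fun [set: T] f ->
  {ae mu, forall x, f x = 0} -> nrm f = 0.
Proof.
move=> mf f0; rewrite (@ae_eq_nrm f (cst 0)) //.
by rewrite /nrm /Defs.L2norm (@Lnorm0 _ _ _ mu 2%:E).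
Qed.

End L2Lemmas.

(** * Local bounds for a strongly continuous semigroup and uniqueness of its orbits *)

Section C0Semigroup.
Context {d : measure_display} {T : measurableType d} {R : realType}.
Context {mu : {measure set T -> \bar R}}.
Context {E : R -> (T -> R) -> (T -> R)}.
Context (HE : is_C0_semigroup mu E).
Implicit Types f g : T -> R.

Local Notation L2 := (L2 mu).
Local Notation L2norm := (L2norm mu).
Local Notation nrm := (nrm (mu := mu)).

Let mL2 f : L2 f -> measurable_fun [set: T] f.
Proof. exact: L2_measurable. Qed.

Definition bounded_by (M t : R) := forall f, L2 f -> nrm (E t f) <= M * nrm f.

Lemma L2E t f : 0 <= t -> L2 f -> L2 (E t f).
Proof. exact: (semigroup_L2 HE). Qed.

Lemma nrm_dist_triangle f g (h : T -> R) : L2 f -> L2 g -> L2 h ->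
  nrm (f \- h) <= nrm (f \- g) + nrm (g \- h).
Proof.
move=> Lf Lg Lh.
have -> : f \- h = (f \- g) \+ (g \- h).
  by apply/funext => x /=; rewrite addrA subrK.
by apply: nrmD; exact: L2B.
Qed.

Lemma nrm_distC f g : nrm (f \- g) = nrm (g \- f).
Proof.
rewrite -nrmN; congr nrm.
by apply/funext => x /=; rewrite opprB.
Qed.

Lemma nrm_dist_ge0 f g : L2 f -> L2 g -> nrm f - nrm g <= nrm (f \- g).
Proof.
move=> Lf Lg; rewrite lerBlDr; apply: le_trans (nrmD (L2B Lf Lg) Lg).
rewrite le_eqVlt; apply/orP; left; apply/eqP; congr nrm.
by apply/funext => x /=; rewrite subrK.
Qed.

Lemma ae_eq_nrmB f g : L2 f -> L2 g ->
  {ae mu, forall x, f x = g x} -> nrm (f \- g) = 0.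
Proof.
move=> Lf Lg fg; apply: nrm_ae0; first exact: mL2 (L2B Lf Lg).
by apply: filterS fg => x /= ->; rewrite subrr.
Qed.

(** Members of L^2 are plain functions and the semigroup laws hold almost everywhere, so each law is
    turned into an equality between norms before it is used. *)
Lemma semigroupB t f g : 0 <= t -> L2 f -> L2 g ->
  nrm (E t f \- E t g) = nrm (E t (f \- g)).
Proof.
move=> t0 Lf Lg.
have -> : nrm (E t (f \- g)) = nrm (E t ((-1) \*: g \+ f)).
  congr nrm; congr (E t _); apply/funext => x /=.
  by rewrite scaleN1r addrC.
apply: ae_eq_nrm.
- by apply/mL2/L2B; exact: L2E.
- by apply/mL2/L2E/L2D => //; exact: L2Z.
apply: filterS (semigroup_linear HE (-1) t0 Lg Lf) => x /= ->.
by rewrite mulN1r addrC.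
Qed.

Lemma nrm_semigroupB M t f g : 0 <= t -> bounded_by M t -> L2 f -> L2 g ->
  nrm (E t f \- E t g) <= M * nrm (f \- g).
Proof. by move=> t0 tM Lf Lg; rewrite semigroupB//; exact/tM/L2B. Qed.

Lemma nrm_semigroupD s t f g : 0 <= s -> 0 <= t -> L2 f -> L2 g ->
  nrm (E (s + t) f \- g) = nrm (E s (E t f) \- g).
Proof.
move=> s0 t0 Lf Lg; apply: ae_eq_nrm.
- by apply/mL2/L2B => //; apply: L2E => //; exact: addr_ge0.
- by apply/mL2/L2B => //; do 2?apply: L2E.
by apply: filterS (semigroupD HE s0 t0 Lf) => x /= ->.
Qed.

Lemma bounded_byP (t : R) : 0 <= t -> exists2 M, 0 <= M & bounded_by M t.
Proof.
move=> t0; have [M HM] := semigroup_bounded HE t0.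
exists `|M| => // f Lf; rewrite -lee_fin EFinM -!L2normE //; last exact: L2E.
rewrite (le_trans (HM _ Lf)) // lee_wpmul2r ?lee_fin ?ler_norm //.
exact: Lnorm_ge0.
Qed.

Lemma semigroup_right_continuous0 f : L2 f -> forall e : R, 0 < e ->
  exists2 del, 0 < del & forall h, 0 < h < del -> nrm (E h f \- f) < e.
Proof.
move=> Lf e e0; have /fine_cvgP[_] := semigroup_continuous HE Lf.
move=> /cvgrPdist_lt /(_ e e0).
case=> del /= del0 H; exists del => // h /andP[h0 hdel].
have := H h; rewrite /= sub0r normrN gtr0_norm // => /(_ hdel h0).
by rewrite /= sub0r normrN => /(le_lt_trans (ler_norm _)).
Qed.

(** [E (t + h) f - E t f] is [E t] applied to [E h f - f], and the single operator [E t] has a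
    bound. The same computation to the left would need a bound on [E (t - h)] uniform in h. *)
Lemma semigroup_right_continuous t f : 0 <= t -> L2 f -> forall e : R, 0 < e ->
  exists2 del, 0 < del & forall h, 0 < h < del ->
    nrm (E (t + h) f \- E t f) < e.
Proof.
move=> t0 Lf e e0; have [M M0 HM] := bounded_byP t0.
have M1 : 0 < M + 1 by rewrite ltr_wpDl.
have [del del0 H] := semigroup_right_continuous0 Lf (divr_gt0 e0 M1).
exists del => // h /[dup] hh /H h_lt.
have h0 : 0 <= h by case/andP: hh => /ltW.
rewrite nrm_semigroupD //; last exact: L2E.
apply: (@le_lt_trans _ _ ((M + 1) * nrm (E h f \- f))).
  rewrite (le_trans (nrm_semigroupB _ HM _ _)) //; first exact: L2E.
  by rewrite ler_wpM2r ?nrm_ge0 // lerDl.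
by rewrite mulrC -ltr_pdivlMr.
Qed.

(* Only right continuity and boundedness of each [E t] are available here;
   a nested-interval argument replaces the uniform boundedness principle and
   avoids the completeness of L^2. *)
Lemma semigroup_bounded_somewhere (a b : R) : 0 <= a -> a < b -> exists c e M,
  [/\ a <= c, c < e, e <= b & forall s, c <= s < e -> bounded_by M s].
Proof.
move=> a0 ab; apply: contrapT => unbounded.
(* Times at which the operator norm exceeds n. If no subinterval carried a bound these sets would be
   dense; right continuity makes them open to the right, and a common point contradicts the
   boundedness of a single [E r]. *)
pose U n := [set r | exists2 f, L2 f & n%:R * nrm f < nrm (E r f)].
have [n c e ac ce eb|n r ar [f Lf Ur]|r [ar Ur]] :=
  @nested_right_neighbourhoods _ U a b ab.
- apply: contrapT => noU; apply: unbounded; exists c, e, n%:R; split => //.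
  move=> s cse f Lf; rewrite leNgt; apply/negP => Us.
  by apply: noU; exists s => //; exists f.
- have r0 := le_trans a0 ar.
  have gap : 0 < nrm (E r f) - n%:R * nrm f by rewrite subr_gt0.
  have [del del0 H] := semigroup_right_continuous r0 Lf gap.
  exists del => // s /andP[rs sr]; exists f => //.
  move: rs; rewrite le_eqVlt => /predU1P[<-//|rs].
  have := H (s - r); rewrite subr_gt0 rs ltrBlDl sr => /(_ isT).
  rewrite addrC subrK nrm_distC => Hs.
  have s0 : 0 <= s by apply: le_trans r0 (ltW rs).
  have := nrm_dist_ge0 (L2E r0 Lf) (L2E s0 Lf).
  lra.
- have [M M0 HM] := bounded_byP (le_trans a0 ar).
  have [f Lf] := Ur (Num.trunc M).+1.
  apply/negP; rewrite -leNgt (le_trans (HM _ Lf)) // ler_wpM2r ?nrm_ge0 //.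
  exact/ltW/real_truncnS_gt/num_real.
Qed.

(** A bound on one interval [c, e[ inside [0, rho] propagates to the right, [E s] being [E del]
    after [E (s - del)] up to a null set. The argument gives nothing near 0, which is why the
    uniqueness argument runs with a delay. *)
Lemma semigroup_locally_bounded (rho t : R) : 0 < rho -> exists2 M, 0 <= M &
  forall s, rho <= s <= t -> bounded_by M s.
Proof.
move=> rho0.
have [c [e [M [c0 ce er HM]]]] := semigroup_bounded_somewhere (lexx 0) rho0.
(* Half the length, so that [s - del] is still at least c when s has left the interval covered so
   far. *)
pose del := (e - c) / 2.
have del0 : 0 < del by rewrite divr_gt0 ?subr_gt0.
have [Md Md0 HMd] := bounded_byP (ltW del0).
have bnd n : exists2 M, 0 <= M &
    forall s, c <= s < e + n%:R * del -> bounded_by M s.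
  elim: n => [|n [N N0 HN]].
    exists `|M| => // s; rewrite mul0r addr0 => cs f Lf.
    by rewrite (le_trans (HM s cs f Lf)) // ler_wpM2r ?nrm_ge0 ?ler_norm.
  exists (N + Md * N); first by rewrite addr_ge0 ?mulr_ge0.
  move=> s /andP[cs se] f Lf; have [s_lt|s_ge] := ltP s (e + n%:R * del).
    rewrite (le_trans (HN s _ f Lf)) ?cs // ler_wpM2r ?nrm_ge0 //.
    by rewrite lerDl mulr_ge0.
  have n0 : 0 <= n%:R * del by rewrite mulr_ge0 // ltW.
  have cs' : c <= s - del by move: s_ge n0; rewrite /del; lra.
  have s'0 : 0 <= s - del by exact: le_trans cs'.
  have s'e : s - del < e + n%:R * del by move: se; rewrite -natr1; lra.
  rewrite (_ : nrm (E s f) = nrm (E del (E (s - del) f))); last first.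
    apply: ae_eq_nrm.
    - by apply/mL2/L2E => //; exact: le_trans cs.
    - by apply/mL2; do 2?[apply: L2E => //]; exact: ltW.
    have := semigroupD HE (ltW del0) s'0 Lf.
    by apply: filterS => x; rewrite [del + _]addrC subrK.
  rewrite (le_trans (HMd _ (L2E s'0 Lf))) // mulrDl -mulrA.
  rewrite ler_wpDl ?mulr_ge0 ?nrm_ge0 // ler_wpM2l //.
  by apply: HN => //; rewrite cs'.
have [n tn] : exists n, t < e + n%:R * del.
  exists (Num.trunc (`|t| / del)).+1.
  have := real_truncnS_gt (num_real (`|t| / del)); rewrite ltr_pdivrMr // => h.
  by rewrite ltr_wpDl ?(le_trans c0 (ltW ce)) // (le_lt_trans (ler_norm t)).
have [N N0 HN] := bnd n; exists N => // s /andP[rs st]; apply: HN.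
by rewrite (le_trans _ rs) ?(le_lt_trans st) // (le_trans (ltW ce)).
Qed.

Lemma generator_derivative f g : generator mu E (f, g) -> forall e : R, 0 < e ->
  exists2 del, 0 < del & forall h, 0 < h < del ->
    nrm (E h f \- f \- h \*: g) <= e * h.
Proof.
move=> [/= Lf Lg] /fine_cvgP[_ /cvgrPdist_lt H] e e0.
have := H e e0 => -[del /= del0 {}H].
exists del => // h /andP[h0 hdel].
have := H h; rewrite /= sub0r normrN gtr0_norm // => /(_ hdel h0).
rewrite /= sub0r normrN => /(le_lt_trans (ler_norm _)).
set F := (X in L2norm X) => hF.
have LEh := L2E (ltW h0) Lf.
have -> : E h f \- f \- h \*: g = h \*: F.
  apply/funext => x; rewrite /F /= /GRing.scale /= mulrBr mulrA divff ?gt_eqF //.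
  by rewrite mul1r.
rewrite nrmZ; last by apply: L2B => //; apply: L2Z; exact: L2B.
by rewrite gtr0_norm // mulrC ler_pM2r // ltW.
Qed.

Section orbit.
Context (u g : R -> T -> R).
Context (uG : forall r, 0 < r -> generator mu E (u r, g r)).
Context (u_derive : forall r, 0 < r -> forall e : R, 0 < e ->
  exists2 del, 0 < del & forall h, `|h| < del ->
    nrm (u (r + h) \- u r \- h \*: g r) <= e * `|h|).

Let Lu r : 0 < r -> L2 (u r). Proof. by case/uG. Qed.
Let Lg r : 0 < r -> L2 (g r). Proof. by case/uG. Qed.

Lemma orbit_continuous r : 0 < r -> forall e : R, 0 < e ->
  exists2 del, 0 < del & forall h, `|h| < del -> nrm (u (r + h) \- u r) < e.
Proof.
move=> r0 e e0; have [del del0 H] := u_derive r0 ltr01.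
pose K := 1 + nrm (g r).
have K0 : 0 < K by rewrite ltr_wpDr ?nrm_ge0.
(* The bound r keeps [r + h] positive, where the orbit is in L^2. *)
exists (Num.min (Num.min del r) (e / K)).
  by rewrite !lt_min del0 r0 divr_gt0.
move=> h; rewrite !lt_min => /andP[/andP[hdel hr] heK].
have rh0 : 0 < r + h by move: hr; rewrite ltr_norml => /andP[]; lra.
have -> : u (r + h) \- u r = (u (r + h) \- u r \- h \*: g r) \+ h \*: g r.
  by apply/funext => x /=; rewrite subrK.
have LL : L2 (u (r + h) \- u r \- h \*: g r).
  by apply: L2B; [apply: L2B; exact: Lu|apply: L2Z; exact: Lg].
apply: le_lt_trans (nrmD LL (L2Z h (Lg r0))) _.
rewrite nrmZ; last exact: Lg.
apply: (@le_lt_trans _ _ (K * `|h|)).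
  by rewrite mulrDl lerD ?H // mulrC.
by rewrite mulrC -ltr_pdivlMr.
Qed.

(** Both functions agree with [u r + h g r] to first order, one by the equation of the orbit, the
    other by the definition of the generator. *)
Lemma semigroup_step_orbit r : 0 < r -> forall e : R, 0 < e ->
  exists2 del, 0 < del & forall h, 0 < h < del ->
    nrm (u (r + h) \- E h (u r)) <= e * h.
Proof.
move=> r0 e e0; have e20 : 0 < e / 2 by rewrite divr_gt0.
have [d1 d10 H1] := u_derive r0 e20.
have [d2 d20 H2] := generator_derivative (uG r0) e20.
exists (Num.min d1 d2); first by rewrite lt_min d10.
move=> h /andP[h0]; rewrite lt_min => /andP[hd1 hd2].
have rh0 : 0 < r + h by rewrite addr_gt0.
have LE := L2E (ltW h0) (Lu r0).
have -> : u (r + h) \- E h (u r) =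
  (u (r + h) \- u r \- h \*: g r) \- (E h (u r) \- u r \- h \*: g r).
  by apply/funext => x /=; ring.
have L1 : L2 (u (r + h) \- u r \- h \*: g r).
  by apply: L2B; [apply: L2B; exact: Lu|apply: L2Z; exact: Lg].
have L3 : L2 (E h (u r) \- u r \- h \*: g r).
  by apply: L2B; [apply: L2B => //; exact: Lu|apply: L2Z; exact: Lg].
apply: le_trans (nrmD L1 (L2N L3)) _; rewrite nrmN.
have := H1 h; rewrite gtr0_norm // => /(_ hd1) h1.
have := H2 h; rewrite h0 => /(_ hd2) h2.
lra.
Qed.

(* [r |-> E (rho + t - r) (u (tau + r))] is left continuous with vanishing
   right derivative, hence constant; then [rho] tends to 0. *)
Lemma semigroup_orbit_delayed tau t rho : 0 < tau -> 0 <= t -> 0 < rho ->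
  nrm (E (rho + t) (u tau) \- E rho (u (tau + t))) = 0.
Proof.
move=> tau0 t0 rho0; have [M M0 HM] := semigroup_locally_bounded (rho + t) rho0.
pose F r := E (rho + t - r) (u (tau + r)).
have tr0 r : 0 <= r -> 0 < tau + r by move=> ?; rewrite ltr_wpDr.
have LF r : 0 <= r <= t -> L2 (F r).
  by move=> /andP[r0 rt]; apply: L2E; [lra|apply: Lu; exact: tr0].
have L0 : L2 (F 0) by apply: LF; rewrite lexx t0.
have M1 : 0 < M + 1 by rewrite ltr_wpDl.
have FE : nrm (F t \- F 0) = nrm (E (rho + t) (u tau) \- E rho (u (tau + t))).
  by rewrite nrm_distC /F subr0 addr0 addrK.
rewrite -FE; apply/eqP; rewrite eq_le nrm_ge0 andbT.
have F00 : nrm (F 0 \- F 0) = 0 by rewrite ae_eq_nrmB //; exact: aeW.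
rewrite -[leRHS]F00.
(* The distance to [F 0] vanishes at 0, so it suffices that it never grows. *)
apply: (@right_derivative_le0 _ (fun r => nrm (F r \- F 0))) => //.
- move=> r /andP[r0 rt] e e0.
  have [del del0 H] := semigroup_step_orbit (tr0 _ r0) (divr_gt0 e0 M1).
  exists (Num.min del (t - r)); first by rewrite lt_min del0 subr_gt0.
  move=> h; rewrite lt_min => /andP[h0 /andP[hdel htr]].
  have rh : 0 <= r + h <= t by apply/andP; split; lra.
  have Lr : L2 (F r) by apply: LF; rewrite r0 ltW.
  rewrite [leRHS]addrC; apply: le_trans (nrm_dist_triangle (LF _ rh) Lr L0) _.
  rewrite lerD2r.
  have s0 : 0 <= rho + t - (r + h) by lra.
  have Lur := Lu (tr0 _ r0).
  have LEh := L2E (ltW h0) Lur.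
  have Lurh : L2 (u (tau + (r + h))) by apply/Lu/tr0; lra.
  (* [E (rho + t - r)] splits off [E h]. The operator [E (rho + t - (r + h))] then acts on a
     difference that is o(h), and its time is at least rho, so the bound M applies. *)
  rewrite nrm_distC {1}/F (_ : rho + t - r = rho + t - (r + h) + h); last by ring.
  rewrite nrm_semigroupD //; [|exact: ltW|exact: LF].
  apply: le_trans (nrm_semigroupB s0 (HM _ _) LEh Lurh) _; first lra.
  rewrite nrm_distC addrA.
  have := H h; rewrite h0 hdel => /(_ isT) Hh.
  apply: le_trans (_ : (M + 1) * (e / (M + 1) * h) <= _).
    apply: ler_pM => //; [exact: nrm_ge0|by rewrite lerDl].
  by rewrite mulrA mulrCA divff ?gt_eqF // mulr1.
- move=> r /andP[r0 rt] e e0; have e20 : 0 < e / 2 by rewrite divr_gt0.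
  have r_ge0 := ltW r0; have s0 : 0 <= rho + t - r by lra.
  have Lur := Lu (tr0 _ r_ge0).
  have [d1 d10 H1] := semigroup_right_continuous s0 Lur e20.
  have [d2 d20 H2] := orbit_continuous (tr0 _ r_ge0) (divr_gt0 e20 M1).
  exists (Num.min (Num.min d1 d2) r); first by rewrite !lt_min d10 d20.
  move=> h; rewrite !lt_min => /andP[h0 /andP[/andP[hd1 hd2] hr]].
  have rh : 0 <= r - h <= t by apply/andP; split; lra.
  have rr : 0 <= r <= t by rewrite r_ge0.
  rewrite [leRHS]addrC; apply: le_trans (nrm_dist_triangle (LF _ rr) (LF _ rh) L0) _.
  rewrite lerD2r.
  have s'0 : 0 <= rho + t - r + h by lra.
  (* The middle term separates two changes: the time of the semigroup at a fixed vector, by right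
     continuity, and the vector, by the uniform bound M and the continuity of the orbit. *)
  have Lmid : L2 (E (rho + t - r + h) (u (tau + r))) by exact: L2E.
  apply: le_trans (nrm_dist_triangle (LF _ rr) Lmid (LF _ rh)) _.
  rewrite [e]splitr lerD //.
    by rewrite nrm_distC ltW //; apply: H1; rewrite h0.
  rewrite {1}/F (_ : rho + t - (r - h) = rho + t - r + h); last by ring.
  have Lurh : L2 (u (tau + (r - h))) by apply/Lu/tr0; case/andP: rh.
  apply: le_trans (nrm_semigroupB s'0 (HM _ _) Lur Lurh) _.
    by apply/andP; split; lra.
  rewrite nrm_distC addrA.
  have := H2 (- h); rewrite normrN gtr0_norm // => /(_ hd2)/ltW Hh.
  apply: le_trans (_ : (M + 1) * (e / 2 / (M + 1)) <= _).
    apply: ler_pM => //; [exact: nrm_ge0|by rewrite lerDl].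
  by rewrite mulrC divfK ?gt_eqF.
Qed.

Lemma semigroup_orbit tau t : 0 < tau -> 0 <= t ->
  {ae mu, forall x, E t (u tau) x = u (t + tau) x}.
Proof.
move=> tau0 t0; have taut0 : 0 < tau + t by rewrite ltr_wpDr.
have LEt := L2E t0 (Lu tau0).
suff H0 : nrm (E t (u tau) \- u (tau + t)) = 0.
  have := nrm_eq0 (L2B LEt (Lu taut0)) H0.
  by apply: filterS => x /= /eqP; rewrite subr_eq0 [t + _]addrC => /eqP.
apply/eqP; rewrite eq_le nrm_ge0 andbT; apply/ler_addgt0Pr => e e0.
rewrite add0r; have e20 : 0 < e / 2 by rewrite divr_gt0.
have [d1 d10 H1] := semigroup_right_continuous0 LEt e20.
have [d2 d20 H2] := semigroup_right_continuous0 (Lu taut0) e20.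
pose rho := Num.min d1 d2 / 2.
have md0 : 0 < Num.min d1 d2 by rewrite lt_min d10.
have rho0 : 0 < rho by rewrite divr_gt0.
have : rho < Num.min d1 d2 by rewrite ltr_pdivrMr // ltr_pMr // ltr1n.
rewrite lt_min => /andP[rd1 rd2].
have Lrt := L2E (ltW rho0) LEt; have Lru := L2E (ltW rho0) (Lu taut0).
have E0 : nrm (E rho (E t (u tau)) \- E rho (u (tau + t))) = 0.
  by rewrite -nrm_semigroupD ?semigroup_orbit_delayed //;
    [exact: ltW|exact: Lu].
apply: le_trans (nrm_dist_triangle LEt Lrt (Lu taut0)) _.
have := nrm_dist_triangle Lrt Lru (Lu taut0); rewrite E0 add0r => h2.
have := H1 rho; rewrite rho0 rd1 nrm_distC => /(_ isT) h1.
have := H2 rho; rewrite rho0 rd2 => /(_ isT) h3.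
lra.
Qed.

End orbit.

End C0Semigroup.

(** * Smooth cut-offs and Gaussians *)

Section SmoothCutoff.
Context {R : realType}.

(** A single term of the exponential series is at most its sum. *)
Lemma exprn_expRN_le (k : nat) (y : R) : 0 <= y -> y ^+ k * expR (- y) <= k`!%:R.
Proof.
case: k => [|k] y0; first by rewrite mul1r -expR0 ler_expR oppr_le0.
rewrite expRN ler_pdivrMr ?expR_gt0 //.
rewrite -ler_pdivrMl ?ltr0n ?fact_gt0 // mulrC.
by apply: le_trans (expR_ge1Dxn k y0); rewrite lerDr.
Qed.

(** For k = 0 this is the classical smooth function that is flat at 0. The powers of [x^-1] make the
    family stable under differentiation, up to linear combinations. *)
Definition flat (k : nat) (x : R) : R :=
  if 0 < x then x^-1 ^+ k * expR (- x^-1) else 0.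

Lemma flat_ge0 k x : 0 <= flat k x.
Proof.
rewrite /flat; case: ifPn => // x0.
by rewrite mulr_ge0 ?expR_ge0 // exprn_ge0 // invr_ge0 ltW.
Qed.

Lemma flat_eq0 k x : x <= 0 -> flat k x = 0.
Proof. by move=> x0; rewrite /flat ltNge x0. Qed.

Lemma flat_le k x : flat k x <= k`!%:R.
Proof.
rewrite /flat; case: ifPn => [x0|_]; last by rewrite ler0n.
by apply: exprn_expRN_le; rewrite invr_ge0 ltW.
Qed.

Lemma flat_le_sqr k x : flat k x <= k.+2`!%:R * x ^+ 2.
Proof.
rewrite /flat; case: ifPn => [x0|_]; last by rewrite mulr_ge0 ?sqr_ge0.
have y0 : 0 <= x^-1 by rewrite invr_ge0 ltW.
rewrite -ler_pdivrMr ?exprn_gt0 // -exprVn.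
by apply: le_trans (exprn_expRN_le k.+2 y0); rewrite mulrAC -exprD addn2.
Qed.

Lemma is_derive1_eq (f : R -> R) (x df df' : R) :
  is_derive x 1 f df' -> df' = df -> is_derive x 1 f df.
Proof. by move=> ? <-. Qed.

(** Away from 0 this is the product rule. At 0 the difference quotient is [flat k z / z], which the
    quadratic bound [flat_le_sqr] sends to 0. *)
Lemma is_derive_flat k (x : R) :
  is_derive x 1 (flat k) (flat k.+2 x - k%:R * flat k.+1 x).
Proof.
have [x_lt|x_gt|->] := ltgtP x 0.
- rewrite !flat_eq0 ?(ltW x_lt) // mulr0 subrr.
  apply: (@near_eq_is_derive _ _ _ (cst 0)).
  near=> z; rewrite flat_eq0 // ltW //; near: z; exact: lt_nbhsl.
- have x0 : x != 0 by rewrite gt_eqF.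
  have dV : is_derive x 1 (fun z : R => z^-1) (- x ^- 2).
    apply: is_derive1_eq (@is_deriveV _ id x 1 1 x0 (is_derive_id x 1)) _.
    by rewrite /GRing.scale /= mulr1.
  have dX : is_derive x 1 (fun z : R => z^-1 ^+ k) (k%:R * x^-1 ^+ k.-1 * - x ^- 2).
    rewrite (_ : (fun _ => _) = (fun z : R => z^-1) ^+ k).
      by apply: is_derive1_eq (is_deriveX k dV) _.
    by apply/funext => z; rewrite fctE.
  have dE : is_derive x 1 (fun z : R => expR (- z^-1)) (expR (- x^-1) * x ^- 2).
    apply: (@is_derive1_comp _ expR (fun z : R => - z^-1)).
    by rewrite -[x ^- 2]opprK; exact: is_deriveN.
  have nf : \near x, ((fun z : R => z^-1 ^+ k) * (fun z : R => expR (- z^-1))) x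
      = flat k x.
    near=> z; rewrite /flat ifT //; near: z; exact: lt_nbhsr.
  have := near_eq_is_derive nf (is_deriveM dX dE).
  move=> h; apply: is_derive1_eq h _.
  rewrite /flat x_gt /GRing.scale /= exprVn -!exprVn.
  by case: (k) => [|m]; rewrite /= ?expr0 ?exprS; ring.
- rewrite !flat_eq0 // mulr0 subrr.
  apply/is_derive1_caratheodory; exists (fun z => flat k z / z).
  split; last by rewrite flat_eq0 ?mul0r.
    move=> z; rewrite (flat_eq0 k (lexx 0)) !subr0.
    have [->|z0] := eqVneq z 0; last by rewrite divfK.
    by rewrite (flat_eq0 k (lexx 0)) mulr0.
  suff : flat k z / z @[z --> (0 : R)] --> (0 : R).
    by rewrite /prop_for /continuous_at invr0 mulr0.
  apply/cvgrPdist_le => e e0.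
  pose K : R := k.+2`!%:R.
  have K0 : 0 < K by rewrite ltr0n fact_gt0.
  suff : \forall z \near (0 : R), `|0 - flat k z / z| <= e by [].
  near=> z; rewrite sub0r normrN.
  have [->|z0] := eqVneq z 0; first by rewrite invr0 mulr0 normr0 ltW.
  rewrite normrM normfV ger0_norm ?flat_ge0 // ler_pdivrMr ?normr_gt0 //.
  apply: le_trans (flat_le_sqr k z) _; rewrite -/K -normr_id.
  rewrite -real_normK ?num_real // expr2 mulrA normr_id ler_pM2r ?normr_gt0 //.
  rewrite mulrC -ler_pdivlMr //.
  near: z; exact: (@nbhs0_le _ R^o _ (divr_gt0 e0 K0)).
Unshelve. all: by end_near. Qed.

(* Closed under differentiation, so its members are smooth. *)
Inductive elementary : (R -> R) -> Prop :=
| elementary_cst c : elementary (fun=> c)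
| elementary_id : elementary (fun x => x)
| elementary_flat k a c : elementary (fun x => flat k (a * x + c))
| elementary_gauss p q m :
    elementary (fun x => expR (- (p * x ^+ 2) + q * x + m))
| elementaryD f g : elementary f -> elementary g ->
    elementary (fun x => f x + g x)
| elementaryM f g : elementary f -> elementary g ->
    elementary (fun x => f x * g x).

Lemma is_derive_affine (a c x : R) : is_derive x 1 (fun z => a * z + c) a.
Proof. by apply: is_derive_eq; rewrite /GRing.scale /= !mulr1 addr0. Qed.

Lemma is_derive_gauss (p q m x : R) :
  is_derive x 1 (fun z => expR (- (p * z ^+ 2) + q * z + m))
    ((- (2 * p) * x + q) * expR (- (p * x ^+ 2) + q * x + m)).
Proof.
rewrite mulrC; apply: (@is_derive1_comp _ expR).
by apply: is_derive_eq; rewrite /GRing.scale /= !mulr1 ?mulr0; ring.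
Qed.

Lemma elementary_derive f : elementary f ->
  exists2 df, elementary df & forall x : R, is_derive x 1 f (df x).
Proof.
elim=> [c||k a c|p q m|{}f g _ [df ef Hf] _ [dg eg Hg]|{}f g ef0 [df ef Hf] eg0 [dg eg Hg]].
- exists (fun=> 0) => [|x]; first exact: elementary_cst.
  exact: is_derive_cst.
- exists (fun=> 1) => [|x]; first exact: elementary_cst.
  exact: is_derive_id.
- exists (fun x => (flat k.+2 (a * x + c) + (- k%:R) * flat k.+1 (a * x + c)) * a).
    apply: elementaryM; last exact: elementary_cst.
    apply: elementaryD; first exact: elementary_flat.
    by apply: elementaryM; [exact: elementary_cst|exact: elementary_flat].
  move=> x; rewrite mulNr; apply: (@is_derive1_comp _ (flat k)).
    exact: is_derive_flat.
  exact: is_derive_affine.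
- eexists; last exact: is_derive_gauss.
  apply: elementaryM; last exact: elementary_gauss.
  apply: elementaryD; last exact: elementary_cst.
  by apply: elementaryM; [exact: elementary_cst|exact: elementary_id].
- by exists (fun x => df x + dg x) => [|x]; [exact: elementaryD|exact: is_deriveD].
- exists (fun x => f x * dg x + g x * df x).
    by apply: elementaryD; exact: elementaryM.
  by move=> x; exact: is_deriveM.
Qed.

Lemma elementary_derive1n f n : elementary f -> elementary (derive1n n f).
Proof.
move=> ef; elim: n => [//|n /elementary_derive[df edf dfE]].
rewrite derive1nS (_ : derive1 _ = df) //; apply/funext => x.
by rewrite derive1E; have := dfE x => ?; rewrite derive_val.
Qed.

Lemma elementary_smooth f : elementary f ->
  forall n (x : R), derivable (derive1n n f) x 1.
Proof.
move=> ef n x; have [df _ dfE] := elementary_derive (elementary_derive1n n ef).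
by case: (dfE x).
Qed.

(** On ]-1, 1[ this is exp (- 2 x^2 / (1 - x^2)); [expR 2] normalizes the value at 0 to 1. *)
Definition bump (x : R) : R := expR 2 * (flat 0 (1 + x) * flat 0 (1 - x)).
Definition dbump (x : R) : R :=
  expR 2 * (flat 2 (1 + x) * flat 0 (1 - x) - flat 0 (1 + x) * flat 2 (1 - x)).
Definition ddbump (x : R) : R :=
  expR 2 * ((flat 4 (1 + x) - 2 * flat 3 (1 + x)) * flat 0 (1 - x)
    - 2 * (flat 2 (1 + x) * flat 2 (1 - x))
    + flat 0 (1 + x) * (flat 4 (1 - x) - 2 * flat 3 (1 - x))).

Lemma bump0 : bump 0 = 1.
Proof.
rewrite /bump /flat addr0 subr0 ltr01 invr1 expr0 mul1r -expRD -expRD.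
by rewrite -[RHS]expR0; congr expR; lra.
Qed.

Lemma bump_eq0 x : 1 < `|x| -> bump x = 0.
Proof.
rewrite /bump ltr_normr => /orP[] h.
- by rewrite (flat_eq0 0 (x := 1 - x)) ?mulr0 //; lra.
- by rewrite (flat_eq0 0 (x := 1 + x)) ?mul0r ?mulr0 //; lra.
Qed.

Lemma is_derive_flatD k (x : R) : is_derive x 1 (fun z => flat k (1 + z))
  (flat k.+2 (1 + x) - k%:R * flat k.+1 (1 + x)).
Proof.
rewrite -[X in is_derive _ _ _ X]mulr1.
apply: (@is_derive1_comp _ (flat k)); first exact: is_derive_flat.
by apply: is_derive_eq; rewrite add0r.
Qed.

Lemma is_derive_flatB k (x : R) : is_derive x 1 (fun z => flat k (1 - z))
  (- (flat k.+2 (1 - x) - k%:R * flat k.+1 (1 - x))).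
Proof.
rewrite -[X in is_derive _ _ _ X]mulrN1.
apply: (@is_derive1_comp _ (flat k)); first exact: is_derive_flat.
by apply: is_derive_eq; rewrite add0r ?mul1r ?mulrN1 ?mulN1r.
Qed.

Lemma is_derive_bump (x : R) : is_derive x 1 bump (dbump x).
Proof.
have := is_deriveZ (expR 2) (is_deriveM (is_derive_flatD 0 x) (is_derive_flatB 0 x)).
move=> h; apply: is_derive1_eq h _; rewrite /dbump /GRing.scale /=; ring.
Qed.

Lemma is_derive_dbump (x : R) : is_derive x 1 dbump (ddbump x).
Proof.
have h1 := is_deriveM (is_derive_flatD 2 x) (is_derive_flatB 0 x).
have h2 := is_deriveM (is_derive_flatD 0 x) (is_derive_flatB 2 x).
have h := is_deriveZ (expR 2) (is_deriveB h1 h2).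
apply: is_derive1_eq h _; rewrite /ddbump /GRing.scale /=; ring.
Qed.

Lemma bump_bounds : exists2 K : R, 0 < K &
  forall x, [/\ `|dbump x| <= K, `|ddbump x| <= K & `|1 - bump x| <= K * `|x|].
Proof.
have e2 : 0 < expR 2 :> R by exact: expR_gt0.
(* [flat k] is at most k!, and only k <= 4 occur; 200 is a generous bound for the resulting sums. *)
exists (expR 2 * 200); first by rewrite mulr_gt0.
have bd x : `|dbump x| <= expR 2 * 200.
  rewrite /dbump normrM gtr0_norm // ler_pM2l //.
  have := flat_le 2 (1 + x); have := flat_le 2 (1 - x).
  have := flat_le 0 (1 + x); have := flat_le 0 (1 - x).
  have := flat_ge0 2 (1 + x); have := flat_ge0 2 (1 - x).
  have := flat_ge0 0 (1 + x); have := flat_ge0 0 (1 - x).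
  rewrite !factS fact0 ler_norml => *; nra.
move=> x; split => //.
- rewrite /ddbump normrM gtr0_norm // ler_pM2l //.
  have := flat_le 4 (1 + x); have := flat_le 4 (1 - x).
  have := flat_le 3 (1 + x); have := flat_le 3 (1 - x).
  have := flat_le 2 (1 + x); have := flat_le 2 (1 - x).
  have := flat_le 0 (1 + x); have := flat_le 0 (1 - x).
  have := flat_ge0 4 (1 + x); have := flat_ge0 4 (1 - x).
  have := flat_ge0 3 (1 + x); have := flat_ge0 3 (1 - x).
  have := flat_ge0 2 (1 + x); have := flat_ge0 2 (1 - x).
  have := flat_ge0 0 (1 + x); have := flat_ge0 0 (1 - x).
  rewrite !factS fact0 => a b a2 b2 a3 b3 a4 b4 A B A2 B2 A3 B3 A4 B4.
  have bnd (p q P Q : R) : 0 <= p -> 0 <= q -> p <= P -> q <= Q ->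
      0 <= p * q <= P * Q.
    by move=> *; rewrite mulr_ge0 //= ler_pM.
  have /andP[? ?] := bnd _ _ _ _ b4 a B4 A.
  have /andP[? ?] := bnd _ _ _ _ b3 a B3 A.
  have /andP[? ?] := bnd _ _ _ _ b2 a2 B2 A2.
  have /andP[? ?] := bnd _ _ _ _ b a4 B A4.
  have /andP[? ?] := bnd _ _ _ _ b a3 B A3.
  rewrite ler_norml; lra.
(* The mean value theorem turns the bound on [dbump] into the bound on [1 - bump]. *)
- have MV (a b : R) : a <= b -> exists2 c, c \in `[a, b] & bump b - bump a = dbump c * (b - a).
    move=> ab; apply: MVT_segment => // [z _|]; first exact: is_derive_bump.
    apply: continuous_subspaceT => z.
    by apply/differentiable_continuous/derivable1_diffP; case: (is_derive_bump z).
  rewrite -[X in X - _]bump0; have [x0|x0] := leP 0 x.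
    have [c _] := MV 0 x x0; rewrite subr0 distrC => ->.
    by rewrite normrM ler_wpM2r.
  have [c _] := MV x 0 (ltW x0); rewrite sub0r => ->.
  by rewrite normrM normrN ler_wpM2r.
Qed.

End SmoothCutoff.

(** * Gaussians in L^2 and their dependence on parameters *)

Section Gaussian.
Context {R : realType}.
Local Notation mu := (@lebesgue_measure R).
Local Notation nrm := (nrm (mu := mu)).

Definition gaussian (p q m x : R) : R := expR (- (p * x ^+ 2) + q * x + m).

Lemma gaussian_ge0 p q m x : 0 <= gaussian p q m x.
Proof. exact: expR_ge0. Qed.

Lemma elementary_continuous (f : R -> R) : elementary f -> continuous f.
Proof.
move=> /elementary_derive[df _ dfE] x.
by apply/differentiable_continuous/derivable1_diffP; case: (dfE x).
Qed.

Lemma elementary_measurable (f : R -> R) : elementary f ->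
  measurable_fun [set: R] f.
Proof. by move=> /elementary_continuous; exact: continuous_measurable_fun. Qed.

(** Completing the square gives the normal density of mean q / (2 p) and variance 1 / (2 p), whose
    integral is known. *)
Lemma gaussian_pdfE p q m x : 0 < p ->
  gaussian p q m x = Num.sqrt (pi / p) * expR (q ^+ 2 / (4 * p) + m) *
    normal_pdf (q / (2 * p)) (Num.sqrt (2 * p)^-1) x.
Proof.
move=> p0; have p2 : 0 < (2 * p)^-1 by rewrite invr_gt0 mulr_gt0.
rewrite normal_pdfE ?gt_eqF ?sqrtr_gt0 // /normal_peak /normal_fun.
rewrite sqr_sqrtr ?(ltW p2) //.
have -> : (2 * p)^-1 * pi *+ 2 = pi / p.
  by rewrite -[LHS]mulr_natr; field; rewrite gt_eqF.
have s0 : Num.sqrt (pi / p) != 0 by rewrite gt_eqF // sqrtr_gt0 divr_gt0 // pi_gt0.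
rewrite mulrACA mulfV // mul1r -expRD /gaussian; congr expR.
by rewrite -[(2 * p)^-1 *+ 2]mulr_natr; field; rewrite gt_eqF.
Qed.

Lemma integral_gaussian p q m : 0 < p ->
  (\int[mu]_x (gaussian p q m x)%:E =
   (Num.sqrt (pi / p) * expR (q ^+ 2 / (4 * p) + m))%:E)%E.
Proof.
move=> p0; under eq_integral do rewrite gaussian_pdfE // EFinM.
rewrite integralZl //; last exact: integrable_normal_pdf.
by rewrite integral_normal_pdf mule1.
Qed.

Lemma integrable_gaussian p q m : 0 < p ->
  mu.-integrable [set: R] (EFin \o gaussian p q m).
Proof.
move=> p0.
have -> : EFin \o gaussian p q m =
    (fun x => (Num.sqrt (pi / p) * expR (q ^+ 2 / (4 * p) + m))%:E *
      (normal_pdf (q / (2 * p)) (Num.sqrt (2 * p)^-1) x)%:E)%E.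
  by apply/funext => x /=; rewrite gaussian_pdfE.
apply: integrableZl => //; exact: integrable_normal_pdf.
Qed.

Lemma L2_gaussian p q m : 0 < p -> L2 mu (gaussian p q m).
Proof.
move=> p0; apply: L2I.
  by apply: elementary_measurable; exact: elementary_gauss.
rewrite /L2norm unlock poweR_lty //.
under eq_integral => x _.
  rewrite /= ger0_norm ?gaussian_ge0 // powR_mulrn ?gaussian_ge0 //.
  rewrite (_ : gaussian p q m x ^+ 2 = gaussian (2 * p) (2 * q) (2 * m) x);
    last by rewrite /gaussian -expRM_natl; congr expR; ring.
  over.
by rewrite integral_gaussian ?ltry // mulr_gt0.
Qed.

(** The exponent - p x^2 is cut in four: one quarter absorbs the polynomial, one the factor in nu,
    one the linear term q x after completing the square, and one is left. The constant is uniform in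
    nu, through which the increment h of a family will enter. *)
Lemma gaussian_dominated k p q m : 0 < p -> exists2 C, 0 < C &
  forall nu x, 0 <= nu <= p / 4 ->
    (1 + x ^+ 2) ^+ k * (gaussian p q m x * expR (nu * (1 + x ^+ 2)))
      <= C * gaussian (p / 4) 0 0 x.
Proof.
move=> p0; have p4 : 0 < p / 4 by rewrite divr_gt0.
pose C1 := k`!%:R / (p / 4) ^+ k.
have C10 : 0 < C1 by rewrite divr_gt0 ?exprn_gt0 // ltr0n fact_gt0.
exists (C1 * expR (p / 4 + q ^+ 2 / p + m + p / 4)).
  by rewrite mulr_gt0 // expR_gt0.
move=> nu x /andP[nu0 nup]; have x0 : 0 < 1 + x ^+ 2 by exact: sqr1_gt0.
have poly : (1 + x ^+ 2) ^+ k <= C1 * expR (p / 4 * (1 + x ^+ 2)).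
  have y0 : 0 <= p / 4 * (1 + x ^+ 2) by rewrite mulr_ge0 // ltW.
  have := exprn_expRN_le k y0; rewrite expRN ler_pdivrMr ?expR_gt0 //.
  by rewrite exprMn mulrC -ler_pdivlMr ?exprn_gt0 // mulrAC.
apply: (@le_trans _ _ (C1 * expR (p / 4 * (1 + x ^+ 2)) *
    (gaussian p q m x * expR (nu * (1 + x ^+ 2))))).
  apply: ler_wpM2r => //.
  by apply: mulr_ge0; [exact: gaussian_ge0|exact: expR_ge0].
rewrite -[leLHS]mulrA -[leRHS]mulrA ler_pM2l // /gaussian -!expRD ler_expR.
have nux : nu * (1 + x ^+ 2) <= p / 4 * (1 + x ^+ 2) by rewrite ler_pM2r.
have qx : q * x <= p / 4 * x ^+ 2 + q ^+ 2 / p.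
  rewrite -subr_ge0 (_ : _ - _ = (p / 2 * x - q) ^+ 2 / p); last first.
    by field; rewrite gt_eqF.
  by rewrite divr_ge0 ?sqr_ge0 // ltW.
rewrite mul0r !addr0; lra.
Qed.

(** Both signs follow from the tangent inequality [1 + z <= expR z], used at [z] and at [- z]. *)
Lemma expR_taylor2 (z : R) : `|expR z - 1 - z| <= z ^+ 2 * expR `|z|.
Proof.
have lb := expR_ge1Dx z.
rewrite ger0_norm; last by lra.
have [z0|z0] := leP 0 z.
  rewrite ger0_norm //.
  have : 1 - z <= expR (- z) by rewrite expR_ge1Dx.
  rewrite expRN -(ler_pM2r (expR_gt0 z)) mulVf ?gt_eqF ?expR_gt0 // => h1.
  have h2 : expR z - 1 <= z * expR z by lra.
  have h3 := ler_wpM2l z0 h2.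
  rewrite expr2 -mulrA; nra.
rewrite ltr0_norm //.
have e0 := expR_gt0 (- z).
have h1 : 1 - z <= expR (- z) by rewrite expR_ge1Dx.
have h2 : 1 <= expR (- z) by lra.
have h3 : z ^+ 2 <= z ^+ 2 * expR (- z) by rewrite ler_peMr ?sqr_ge0.
apply: le_trans h3.
have ez : expR z * expR (- z) = 1 by rewrite -expRD subrr expR0.
have h4 : expR z * (1 - z) <= 1 by rewrite -[leRHS]ez ler_pM2l ?expR_gt0.
have z1 : 0 < 1 - z by lra.
rewrite -(ler_pM2r z1).
have : 0 <= - z * z ^+ 2 by rewrite mulr_ge0 ?sqr_ge0 // oppr_ge0 ltW.
lra.
Qed.

Lemma elementary_gaussian p q m : elementary (gaussian p q m).
Proof. exact: elementary_gauss. Qed.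

Lemma elementaryZ (c : R) f : elementary f -> elementary (fun x => c * f x).
Proof. by move=> ef; apply: elementaryM => //; exact: elementary_cst. Qed.

Lemma elementary_sqr (f : R -> R) : elementary f -> elementary (fun x => f x ^+ 2).
Proof. by move=> ef; exact: elementaryM. Qed.

Lemma elementaryB (f g : R -> R) : elementary f -> elementary g ->
  elementary (fun x => f x - g x).
Proof.
move=> ef eg; have := elementaryD ef (elementaryZ (-1) eg).
by congr elementary; apply/funext => x; rewrite mulN1r.
Qed.

Lemma quadratic_le (A B C x : R) :
  `|A + B * x + C * x ^+ 2| <= (`|A| + `|B| + `|C|) * (1 + x ^+ 2).
Proof.
apply: le_trans (ler_normD _ _) _.
apply: le_trans (lerD (ler_normD _ _) (lexx _)) _.
have xx : x ^+ 2 = `|x| ^+ 2 by rewrite real_normK ?num_real.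
rewrite (normrM B) (normrM C) normrX xx.
have := normr_ge0 A; have := normr_ge0 B; have := normr_ge0 C.
have := normr_ge0 x; set y := `|x| => y0 C0 B0 A0.
have h1 : 0 <= `|A| * y ^+ 2 by rewrite mulr_ge0 ?sqr_ge0.
have h2 : `|B| * y <= `|B| * (1 + y ^+ 2) by rewrite ler_wpM2l //; nra.
lra.
Qed.

Section family.
Context (p q m : R -> R) (p' q' m' r : R).
Context (dp : is_derive r 1 p p') (dq : is_derive r 1 q q')
  (dm : is_derive r 1 m m') (p_gt0 : 0 < p r).

Let increment (f : R -> R) (f' : R) : is_derive r 1 f f' ->
  forall e : R, 0 < e -> exists2 del, 0 < del & forall h, `|h| < del ->
    `|f (r + h) - f r - h * f'| <= e * `|h|.
Proof.
move=> df e e0; have [df1 fE] := df.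
have : h^-1 *: (f (h *: 1 + r) - f r) @[h --> (0 : R)^'] --> f'.
  by rewrite -fE; exact: df1.
move=> /cvgrPdist_le /(_ e e0).
rewrite near_withinE => -[del /= del0 H].
exists del => // h hdel; have [->|h0] := eqVneq h 0.
  by rewrite addr0 mul0r !subr0 subrr normr0 mulr0.
have := H h; rewrite /= sub0r normrN => /(_ hdel h0).
rewrite /GRing.scale /= mulr1 [h + r]addrC => hh.
rewrite (_ : _ - _ = - (h * (f' - h^-1 * (f (r + h) - f r)))); last first.
  by field.
by rewrite normrN normrM mulrC ler_wpM2r.
Qed.

(** With z the increment of the exponent and l its derivative, the remainder is the Gaussian times
    (e^z - 1 - z) + (z - h l). The first term is quadratic in h and the second is o(h); both are
    polynomial in x up to a factor exp (nu (1 + x^2)), so one fixed Gaussian dominates them. *)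
Lemma gaussian_family_derive (e : R) : 0 < e -> exists2 del, 0 < del &
  forall h, `|h| < del ->
  nrm (gaussian (p (r + h)) (q (r + h)) (m (r + h)) \-
       gaussian (p r) (q r) (m r) \-
       h \*: (fun x => (m' + q' * x + - p' * x ^+ 2) *
          gaussian (p r) (q r) (m r) x)) <= e * `|h|.
Proof.
move=> e0.
have [C C0 HC] := gaussian_dominated 2 (q r) (m r) p_gt0.
set D := gaussian (p r / 4) 0 0 in HC.
have p4 : 0 < p r / 4 by rewrite divr_gt0.
have LD : L2 mu D by exact: L2_gaussian.
pose L := `|m'| + `|q'| + `|p'|.
(* [L] bounds the derivative of the exponent and 3 its three first-order errors, so that |z| <= N
   |h| (1 + x^2). *)
pose N := L + 3.
have L0 : 0 <= L by rewrite !addr_ge0.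
have N0 : 0 < N by rewrite /N; lra.
pose K := C * (nrm D + 1).
have K0 : 0 < K by rewrite mulr_gt0 // ltr_wpDl ?nrm_ge0.
pose eta := Num.min 1 (e / (6 * K)).
have eta0 : 0 < eta by rewrite lt_min ltr01 divr_gt0 // mulr_gt0.
have eta1 : eta <= 1 by rewrite ge_min lexx.
have etaK : 6 * eta * K <= e.
  have K6 : 0 < 6 * K by rewrite mulr_gt0.
  have : eta <= e / (6 * K) by rewrite ge_min lexx orbT.
  by rewrite ler_pdivlMr // mulrC mulrAC.
have [d1 d10 H1] := increment dp eta0.
have [d2 d20 H2] := increment dq eta0.
have [d3 d30 H3] := increment dm eta0.
(* [d4] makes N |h| at most a quarter of [p r], as the domination requires; [d5] makes (N |h|)^2 at
   most eta |h|. *)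
pose d4 := p r / 4 / N.
have d40 : 0 < d4 by rewrite divr_gt0.
pose d5 := eta / N ^+ 2.
have d50 : 0 < d5 by rewrite divr_gt0 // exprn_gt0.
exists (Num.min (Num.min d1 d2) (Num.min d3 (Num.min d4 d5))).
  by rewrite !lt_min d10 d20 d30 d40 d50.
move=> h; rewrite !lt_min => /andP[/andP[hd1 hd2] /andP[hd3 /andP[hd4 hd5]]].
set F := (X in nrm X).
have mF : measurable_fun [set: R] F.
  apply: elementary_measurable; rewrite /F.
  apply: elementaryB; first by apply: elementaryB; exact: elementary_gaussian.
  apply: elementaryZ; apply: elementaryM; last exact: elementary_gaussian.
  apply: elementaryD; last by apply/elementaryZ/elementary_sqr/elementary_id.
  apply: elementaryD; first exact: elementary_cst.
  by apply/elementaryZ/elementary_id.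
suff bnd x : `|F x| <= (4 * eta * C * `|h|) * D x.
  have a0 : 0 <= 4 * eta * C * `|h| by rewrite !mulr_ge0 // ltW.
  have FD := nrm_leZ (mu := mu) a0 mF LD bnd.
  apply: le_trans FD _.
  rewrite mulrAC ler_wpM2r //.
  have CK : C * nrm D <= K by rewrite ler_pM2l // lerDl.
  apply: le_trans etaK; rewrite -(mulrA (4 * eta)); apply: ler_pM => //.
  - by rewrite mulr_ge0 // ltW.
  - by rewrite mulr_ge0 ?nrm_ge0 // ltW.
  - by rewrite ler_pM2r // ler_nat.
pose y := 1 + x ^+ 2.
have y1 : 1 <= y by rewrite lerDl sqr_ge0.
pose dP := p (r + h) - p r; pose dQ := q (r + h) - q r.
pose dM := m (r + h) - m r.
pose z := dM + dQ * x + - dP * x ^+ 2.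
pose l := m' + q' * x + - p' * x ^+ 2.
have zl : `|z - h * l| <= 3 * eta * `|h| * y.
  rewrite (_ : z - h * l = (dM - h * m') + (dQ - h * q') * x +
    (- (dP - h * p')) * x ^+ 2); last by rewrite /z /l; ring.
  apply: le_trans (quadratic_le _ _ _ _) _.
  rewrite ler_wpM2r ?(le_trans ler01) // normrN.
  have := H1 h hd1; have := H2 h hd2; have := H3 h hd3.
  rewrite -/dP -/dQ -/dM; lra.
have lL : `|l| <= L * y.
  by apply: le_trans (quadratic_le _ _ _ _) _; rewrite normrN.
have zN : `|z| <= N * `|h| * y.
  rewrite -[z](subrK (h * l)); apply: le_trans (ler_normD _ _) _.
  rewrite normrM.
  have : `|h| * `|l| <= `|h| * (L * y) by rewrite ler_wpM2l.
  have : 3 * eta * `|h| * y <= 3 * `|h| * y.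
    rewrite ler_wpM2r ?(le_trans ler01) // ler_wpM2r // ger_pMr //.
  rewrite /N; lra.
pose nu := N * `|h|.
have nu_bnd : 0 <= nu <= p r / 4.
  rewrite /nu mulr_ge0 ?(ltW N0) //= mulrC -ler_pdivlMr //; exact: ltW.
have FE : F x = gaussian (p r) (q r) (m r) x * ((expR z - 1 - z) + (z - h * l)).
  rewrite /F /= /GRing.scale /= -/l.
  rewrite (_ : gaussian (p (r + h)) _ _ x = gaussian (p r) (q r) (m r) x * expR z).
    by ring.
  by rewrite /gaussian -expRD; congr expR; rewrite /z /dP /dQ /dM; ring.
have ez : `|expR z - 1 - z| <= (nu * y) ^+ 2 * expR (nu * y).
  apply: le_trans (expR_taylor2 z) _.
  apply: ler_pM; rewrite ?sqr_ge0 ?expR_ge0 ?ler_expR //.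
  by rewrite -[z ^+ 2]real_normK ?num_real // ler_sqr ?nnegrE // (le_trans _ zN).
have enu : 1 <= expR (nu * y).
  have /andP[nu0 _] := nu_bnd.
  by rewrite -expR0 ler_expR mulr_ge0 // (le_trans ler01).
have tot : `|(expR z - 1 - z) + (z - h * l)| <=
    4 * eta * `|h| * (y ^+ 2 * expR (nu * y)).
  apply: le_trans (ler_normD _ _) _.
  have nuh : nu ^+ 2 <= eta * `|h|.
    rewrite /nu exprMn expr2 [`|h| ^+ 2]expr2 mulrA ler_wpM2r // -expr2.
    by rewrite mulrC -ler_pdivlMr ?exprn_gt0 // ltW.
  have ye : y <= y ^+ 2 * expR (nu * y).
    rewrite -[leLHS]mulr1; apply: ler_pM => //; first exact: le_trans y1.
    by rewrite expr2 ler_peMr // (le_trans ler01).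
  have h1 : (nu * y) ^+ 2 * expR (nu * y) <= eta * `|h| * (y ^+ 2 * expR (nu * y)).
    by rewrite exprMn -(mulrA (nu ^+ 2)) ler_wpM2r // mulr_ge0 ?sqr_ge0 ?expR_ge0.
  have h2 : 3 * eta * `|h| * y <= 3 * eta * `|h| * (y ^+ 2 * expR (nu * y)).
    by rewrite ler_wpM2l // !mulr_ge0 // ltW.
  have := le_trans ez h1; have := le_trans zl h2.
  lra.
rewrite FE normrM (ger0_norm (gaussian_ge0 _ _ _ _)).
apply: le_trans (ler_wpM2l (gaussian_ge0 _ _ _ _) tot) _.
have := HC nu x nu_bnd; rewrite -/y => hC.
rewrite [leLHS](_ : _ = 4 * eta * `|h| *
  (y ^+ 2 * (gaussian (p r) (q r) (m r) x * expR (nu * y)))); last by ring.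
rewrite [leRHS](_ : _ = 4 * eta * `|h| * (C * D x)); last by ring.
by rewrite ler_wpM2l // !mulr_ge0 // ltW.
Qed.

End family.

End Gaussian.

(** * Truncated Gaussians and the closure of the symbol *)

Section Cutoff.
Context {R : realType}.
Local Notation mu := (@lebesgue_measure R).
Local Notation nrm := (nrm (mu := mu)).
Context (p q m : R) (p_gt0 : 0 < p).

Let u := gaussian p q m.
Let du (x : R) := (- (2 * p) * x + q) * u x.
Let ddu (x : R) := ((- (2 * p) * x + q) ^+ 2 - 2 * p) * u x.

Let is_derive_u (x : R) : is_derive x 1 u (du x).
Proof. exact: is_derive_gauss. Qed.

Let is_derive_du (x : R) : is_derive x 1 du (ddu x).
Proof.
apply: is_derive1_eq (is_deriveM (is_derive_affine _ _ _) (is_derive_u x)) _.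
by rewrite /ddu /du /GRing.scale /=; ring.
Qed.

Section scale.
Context (n : R) (n_gt0 : 0 < n).

Definition cutoff (x : R) : R := bump (x / n) * u x.

Let is_derive_div (x : R) : is_derive x 1 (fun z => z / n) n^-1.
Proof.
have := is_derive_affine n^-1 0 x.
by congr is_derive; apply/funext => z; rewrite addr0 mulrC.
Qed.

Let is_derive_bumpn (x : R) :
  is_derive x 1 (fun z => bump (z / n)) (dbump (x / n) * n^-1).
Proof. exact: (@is_derive1_comp _ bump _ _ _ _ (is_derive_bump _)). Qed.

Let is_derive_dbumpn (x : R) :
  is_derive x 1 (fun z => dbump (z / n) * n^-1) (ddbump (x / n) * n^-1 ^+ 2).
Proof.
have h := @is_derive1_comp _ dbump _ _ _ _ (is_derive_dbump _) (is_derive_div x).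
apply: is_derive1_eq (is_deriveM h (is_derive_cst n^-1 x 1)) _.
by rewrite /GRing.scale /=; ring.
Qed.

Lemma elementary_cutoff : elementary cutoff.
Proof.
apply: elementaryM; last exact: elementary_gaussian.
have h (s : R) : elementary (fun x => flat 0 (1 + s * (x / n))).
  have := elementary_flat 0 (s / n) 1.
  by congr elementary; apply/funext => x; congr (flat 0 _); ring.
have := elementaryZ (expR 2) (elementaryM (h 1) (h (-1))).
by congr elementary; apply/funext => x; rewrite mul1r mulN1r.
Qed.

Lemma smooth_compact_cutoff : smooth_compact cutoff.
Proof.
split; first exact/elementary_smooth/elementary_cutoff.
exists n => x nx; rewrite /cutoff bump_eq0 ?mul0r //.
by rewrite normrM normfV (gtr0_norm n_gt0) ltr_pdivlMr // mul1r.
Qed.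

Lemma derive1n_cutoff x : derive1n 2 cutoff x =
  ddbump (x / n) * n^-1 ^+ 2 * u x + 2 * (dbump (x / n) * n^-1) * du x
  + bump (x / n) * ddu x.
Proof.
have d1 : derive1 cutoff =
    fun x => dbump (x / n) * n^-1 * u x + bump (x / n) * du x.
  apply/funext => z; rewrite derive1E.
  have h := is_deriveM (is_derive_bumpn z) (is_derive_u z).
  have -> : cutoff = (fun z => bump (z / n)) * u by [].
  by rewrite derive_val /GRing.scale /=; ring.
rewrite derive1nS derive1n1 d1 derive1E.
have h1 := is_deriveM (is_derive_dbumpn x) (is_derive_u x).
have h2 := is_deriveM (is_derive_bumpn x) (is_derive_du x).
have h := is_deriveD h1 h2.
have -> : (fun x => dbump (x / n) * n^-1 * u x + bump (x / n) * du x) =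
  (fun z => dbump (z / n) * n^-1) * u + (fun z => bump (z / n)) * du by [].
by rewrite derive_val /GRing.scale /=; ring.
Qed.

End scale.

(** The Gaussian multiplied by [bump (x / n)] is a smooth function of compact support. The terms in
    which the cut-off is differentiated carry 1/n or 1/n^2; [1 - bump (x / n)] is not uniformly
    small, but it is O(|x| / n), and the growth in x is paid by the Gaussian. *)
Lemma gaussian_graph_closure (H : set ((R -> R) * (R -> R))) (V : R -> R)
    (v0 v1 v2 : R) :
  (forall x, V x = v0 + v1 * x + v2 * x ^+ 2) ->
  (forall f, smooth_compact f -> H (f, fun x => V x * f x - derive1n 2 f x)) ->
  graph_closure mu H (gaussian p q m, fun x =>
    (V x - (- (2 * p) * x + q) ^+ 2 + 2 * p) * gaussian p q m x).
Proof.
move=> VE HH.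
have [C C0 HC] := gaussian_dominated 2 q m p_gt0.
set D := gaussian (p / 4) 0 0 in HC.
have p4 : 0 < p / 4 by rewrite divr_gt0.
have LD : L2 mu D by exact: L2_gaussian.
have [K K0 HK] := @bump_bounds R.
pose w x := (V x - (- (2 * p) * x + q) ^+ 2 + 2 * p) * gaussian p q m x.
pose c1 := `|v0 - q ^+ 2 + 2 * p| + `|v1 + 4 * p * q| + `|v2 - 4 * p ^+ 2|.
pose c2 := `|q| + `|- (2 * p)| + `|0 : R|.
have c10 : 0 <= c1 by rewrite !addr_ge0.
have c20 : 0 <= c2 by rewrite !addr_ge0.
have y1 x : 1 <= 1 + x ^+ 2 :> R by rewrite lerDl sqr_ge0.
have y0 x : 0 <= 1 + x ^+ 2 :> R by exact: le_trans (y1 x).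
have yy x : 1 + x ^+ 2 <= (1 + x ^+ 2) ^+ 2 :> R.
  by rewrite [leRHS]expr2; apply: ler_peMr; [exact: (y0 x)|exact: (y1 x)].
have u0 x : 0 <= u x by exact: gaussian_ge0.
have wle x : `|w x| <= c1 * (1 + x ^+ 2) * u x.
  rewrite /w normrM (ger0_norm (u0 x)) ler_wpM2r // VE.
  have -> : v0 + v1 * x + v2 * x ^+ 2 - (- (2 * p) * x + q) ^+ 2 + 2 * p =
    (v0 - q ^+ 2 + 2 * p) + (v1 + 4 * p * q) * x + (v2 - 4 * p ^+ 2) * x ^+ 2.
    by ring.
  exact: quadratic_le.
have dule x : `|du x| <= c2 * (1 + x ^+ 2) * u x.
  rewrite /du normrM (ger0_norm (u0 x)) ler_wpM2r //.
  have -> : - (2 * p) * x + q = q + - (2 * p) * x + 0 * x ^+ 2 by ring.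
  exact: quadratic_le.
have xle x : `|x| <= 1 + x ^+ 2 :> R.
  have := normr_ge0 x; rewrite -(real_normK (num_real x)); nra.
have dom x : (1 + x ^+ 2) ^+ 2 * u x <= C * D x.
  have := HC 0 x; rewrite lexx (ltW p4) mul0r expR0 mulr1.
  by apply.
have ew : elementary w.
  apply: elementaryM; last exact: elementary_gaussian.
  have -> : (fun x => V x - (- (2 * p) * x + q) ^+ 2 + 2 * p) = fun x =>
    (v0 - q ^+ 2 + 2 * p) + (v1 + 4 * p * q) * x + (v2 - 4 * p ^+ 2) * x ^+ 2.
    by apply/funext => x; rewrite VE; ring.
  apply: elementaryD; last by apply/elementaryZ/elementary_sqr/elementary_id.
  by apply: elementaryD; [exact: elementary_cst|exact/elementaryZ/elementary_id].
have Lu : L2 mu u by exact: L2_gaussian.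
have Lw : L2 mu w.
  apply: (L2_le (mu := mu) (g := (c1 * C) \*: D)).
  - exact: elementary_measurable.
  - exact: L2Z.
  move=> x; apply: le_trans (wle x) _.
  rewrite /= ger0_norm; last by rewrite !mulr_ge0 ?gaussian_ge0 // ltW.
  rewrite -[leLHS]mulrA -[leRHS]mulrA ler_wpM2l //.
  by apply: le_trans (dom x); rewrite ler_wpM2r.
split; [exact: Lu|exact: Lw|move=> e e0].
pose B := C * (nrm D + 1).
have B0 : 0 < B by rewrite mulr_gt0 // ltr_wpDl ?nrm_ge0.
(* The summands weigh the three errors: the tail of w, the second derivative of the cut-off, and the
   cross term. [n] is then large enough for [K * c * n^-1 * B] to be below e. *)
pose c := c1 + 1 + 2 * c2.
have c_ge1 : 1 <= c by rewrite /c; lra.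
have c_gt0 : 0 < c by exact: lt_le_trans c_ge1.
pose n := 1 + K * c * B / e.
have n1 : 1 < n.
  by rewrite /n ltrDl; apply: divr_gt0 => //; apply: mulr_gt0 => //; exact: mulr_gt0.
have n0 : 0 < n by exact: lt_trans n1.
have nB : K * c * n^-1 * B < e.
  rewrite mulrAC ltr_pdivrMr // (_ : e * n = e + K * c * B) ?ltrDr //.
  by rewrite /n; field; rewrite gt_eqF.
have small (f : R -> R) : measurable_fun [set: R] f ->
    (forall x, `|f x| <= K * c * n^-1 * ((1 + x ^+ 2) ^+ 2 * u x)) ->
    (L2norm mu f < e%:E)%E.
  move=> mf fle.
  have fle' x : `|f x| <= (K * c * n^-1 * C) * D x.
    apply: le_trans (fle x) _; rewrite -[leRHS]mulrA ler_wpM2l //.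
    by rewrite !mulr_ge0 ?invr_ge0 ?(ltW K0) ?(ltW n0) // (le_trans ler01).
  have a0 : 0 <= K * c * n^-1 * C.
    by rewrite !mulr_ge0 ?invr_ge0 ?(ltW K0) ?(ltW n0) ?(ltW C0) // (le_trans ler01).
  have Lf : L2 mu f.
    apply: (L2_le (mu := mu) (g := (K * c * n^-1 * C) \*: D)) => [//||x].
      exact: L2Z.
    by rewrite (le_trans (fle' x)) //= ler_norm.
  rewrite L2normE // lte_fin (le_lt_trans _ nB) //.
  have fD := nrm_leZ (mu := mu) a0 mf LD fle'.
  apply: le_trans fD _.
  rewrite -[leLHS]mulrA ler_wpM2l //.
    by rewrite !mulr_ge0 ?invr_ge0 ?(ltW K0) ?(ltW n0) // (le_trans ler01).
  by rewrite ler_pM2l // lerDl.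
have ec := elementary_cutoff n.
have ecd := elementary_derive1n 2 ec.
have ni1 : n^-1 <= 1 by rewrite invf_le1 // ltW.
have ni0 : 0 <= n^-1 by rewrite invr_ge0 ltW.
exists (cutoff n, fun x => V x * cutoff n x - derive1n 2 (cutoff n) x).
  by apply: HH; exact: smooth_compact_cutoff.
have bumpx x : `|1 - bump (x / n)| <= K * n^-1 * (1 + x ^+ 2).
  have [_ _] := HK (x / n); move=> /le_trans; apply.
  rewrite normrM normfV (gtr0_norm n0) -mulrA [n^-1 * _]mulrC.
  by rewrite ler_wpM2l ?(ltW K0) // ler_wpM2r.
split => /=.
  apply: small.
    apply: elementary_measurable.
    by apply: elementaryB; [exact: elementary_gaussian|exact: ec].
  move=> x; rewrite -/u /= /cutoff.
  rewrite (_ : u x - _ = (1 - bump (x / n)) * u x); last by ring.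
  rewrite normrM (ger0_norm (u0 x)) mulrA ler_wpM2r //.
  apply: le_trans (bumpx x) _.
  have h1 : K * n^-1 * (1 + x ^+ 2) <= K * n^-1 * (1 + x ^+ 2) ^+ 2.
    by apply: ler_wpM2l; [rewrite mulr_ge0 // ltW|exact: yy].
  apply: le_trans h1 _; rewrite ler_wpM2r ?sqr_ge0 // ler_wpM2r //.
  by rewrite ler_peMr // ltW.
apply: small.
  apply: elementary_measurable; apply: elementaryB => //.
  apply: elementaryB => //; apply: elementaryM => //.
  have -> : V = fun x => v0 + v1 * x + v2 * x ^+ 2 by exact/funext.
  apply: elementaryD; last by apply/elementaryZ/elementary_sqr/elementary_id.
  by apply: elementaryD; [exact: elementary_cst|exact/elementaryZ/elementary_id].
move=> x; have /= dcE := derive1n_cutoff n x; rewrite /= dcE.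
(* By Leibniz' rule the error is the tail of w plus the terms in which the cut-off is
   differentiated. *)
rewrite (_ : _ - _ = (1 - bump (x / n)) * w x + ddbump (x / n) * n^-1 ^+ 2 * u x
   + 2 * (dbump (x / n) * n^-1) * du x); last first.
  by rewrite /w /ddu /du /cutoff -/u; ring.
have [b1 b2 _] := HK (x / n).
set y := 1 + x ^+ 2.
have {}yy : y <= y ^+ 2 by exact: (yy x).
have h1 : `|(1 - bump (x / n)) * w x| <= K * n^-1 * (c1 * (y ^+ 2 * u x)).
  rewrite normrM; apply: le_trans (ler_pM _ _ (bumpx x) (wle x)) _ => //.
  by rewrite le_eqVlt; apply/orP; left; apply/eqP; rewrite /y; ring.
have h2 : `|ddbump (x / n) * n^-1 ^+ 2 * u x| <= K * n^-1 * (y ^+ 2 * u x).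
  rewrite normrM (normrM (ddbump _)) normrX (ger0_norm (u0 x)) (ger0_norm ni0).
  rewrite [leRHS]mulrA ler_wpM2r //.
  apply: (@le_trans _ _ (K * n^-1)).
    by apply: ler_pM => //; [rewrite exprn_ge0|rewrite expr2 ger_pMr // invr_gt0].
  rewrite ler_peMr ?mulr_ge0 ?(ltW K0) //.
  exact: le_trans (y1 x) yy.
have h3 : `|2 * (dbump (x / n) * n^-1) * du x| <= K * n^-1 * (2 * c2 * (y ^+ 2 * u x)).
  rewrite normrM (normrM 2) (normrM (dbump _)) (ger0_norm ni0) (@ger0_norm _ 2) //.
  rewrite (_ : _ * _ * `|du x| = 2 * n^-1 * (`|dbump (x / n)| * `|du x|)); last by ring.
  rewrite (_ : K * n^-1 * _ = 2 * n^-1 * (K * (c2 * y ^+ 2 * u x))); last by ring.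
  rewrite ler_wpM2l ?mulr_ge0 //; apply: ler_pM => //.
  apply: le_trans (dule x) _; rewrite -/y ler_wpM2r // ler_wpM2l //.
apply: le_trans (ler_normD _ _) _.
apply: le_trans (lerD (ler_normD _ _) (lexx _)) _.
rewrite (_ : K * c * n^-1 * _ = K * n^-1 * (c1 * (y ^+ 2 * u x)) +
  K * n^-1 * (y ^+ 2 * u x) + K * n^-1 * (2 * c2 * (y ^+ 2 * u x))); last first.
  by rewrite /c; ring.
by rewrite !lerD.
Qed.

End Cutoff.

(** * Mehler's kernel *)

Section Hyperbolic.
Context {R : realType}.
Implicit Types x : R.

Definition cosh x : R := (expR x + expR (- x)) / 2.

Lemma cosh2_sinh2 x : cosh x ^+ 2 = 1 + sinh x ^+ 2.
Proof.
have e1 : expR x * expR (- x) = 1 by rewrite -expRD subrr expR0.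
apply/eqP; rewrite -subr_eq0 /cosh /sinh; apply/eqP.
transitivity (expR x * expR (- x) - 1); last by rewrite e1 subrr.
by field.
Qed.

Lemma sinh_gt0 x : 0 < x -> 0 < sinh x.
Proof.
by move=> x0; rewrite /sinh divr_gt0 // subr_gt0 ltr_expR; lra.
Qed.

Lemma sinhN x : sinh (- x) = - sinh x.
Proof. by rewrite /sinh opprK -opprB mulNr. Qed.

Lemma mul_sinh_gt0 (b x : R) : b != 0 -> 0 < x -> 0 < b * sinh (b * x).
Proof.
move=> b0 x0; have [b_lt|b_gt|/eqP] := ltgtP b 0; last by rewrite (negbTE b0).
  have := sinh_gt0 (x := - b * x); rewrite mulNr sinhN => h.
  by rewrite -mulrNN mulr_gt0 ?oppr_gt0 // -oppr_gt0 h // -mulNr mulr_gt0 ?oppr_gt0.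
by rewrite mulr_gt0 // sinh_gt0 // mulr_gt0.
Qed.

Lemma sinh_neq0 (b x : R) : b != 0 -> 0 < x -> sinh (b * x) != 0.
Proof.
move=> b0 x0; have := mul_sinh_gt0 b0 x0; apply: contraTneq => ->.
by rewrite mulr0 ltxx.
Qed.

Let is_derive_mul (c x : R) : is_derive x 1 (fun z => c * z) c.
Proof.
have := is_derive_affine c 0 x.
by congr is_derive; apply/funext => z; rewrite addr0.
Qed.

Let is_derive_expRM (c x : R) :
  is_derive x 1 (fun z => expR (c * z)) (expR (c * x) * c).
Proof. exact: (@is_derive1_comp _ expR _ _ _ _ (is_derive_expR _)). Qed.

Lemma is_derive_cosh (c x : R) :
  is_derive x 1 (fun z => cosh (c * z)) (c * sinh (c * x)).
Proof.
have h := is_deriveZ 2^-1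
  (is_deriveD (is_derive_expRM c x) (is_derive_expRM (- c) x)).
have -> : (fun z => cosh (c * z)) =
    2^-1 \*: ((fun z => expR (c * z)) + (fun z => expR (- c * z))).
  by apply/funext => z; rewrite /cosh [LHS]mulrC /= !fctE mulNr.
by apply: is_derive1_eq h _; rewrite /GRing.scale /= /sinh !mulNr; field.
Qed.

Lemma is_derive_sinh (c x : R) :
  is_derive x 1 (fun z => sinh (c * z)) (c * cosh (c * x)).
Proof.
have h := is_deriveZ 2^-1
  (is_deriveB (is_derive_expRM c x) (is_derive_expRM (- c) x)).
have -> : (fun z => sinh (c * z)) =
    2^-1 \*: ((fun z => expR (c * z)) - (fun z => expR (- c * z))).
  by apply/funext => z; rewrite /sinh [LHS]mulrC /= !fctE mulNr.
by apply: is_derive1_eq h _; rewrite /GRing.scale /= /cosh !mulNr; field.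
Qed.

End Hyperbolic.

(* The heat kernel of [- d^2/dx^2 + a^2 + (b + beta x)^2] with source at 0 is the
   Gaussian whose exponent solves the Riccati system
   [P' = beta^2 - 4 P^2], [Q' = - 4 P Q - 2 b beta],
   [S' = Q^2 - 2 P - a^2 - b^2]. *)
Section Mehler.
Context {R : realType}.
Local Notation mu := (@lebesgue_measure R).
Context (a b beta : R) (beta_neq0 : beta != 0).

Let c (r : R) := cosh (2 * beta * r).
Let s (r : R) := sinh (2 * beta * r).

(** Among the solutions of the Riccati system these have the singularity of the Euclidean heat
    kernel at r = 0: P ~ 1 / (4 r), exp S ~ (4 pi r)^(-1/2) and Q -> 0. The quotient
    [(c r - 1) / s r] is tanh (beta r). [beta] may be negative, but [beta / s r] is positive for r >
    0. *)
Definition mehlerP (r : R) : R := beta / 2 * (c r / s r).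
Definition mehlerQ (r : R) : R := - b * ((c r - 1) / s r).
Definition mehlerS (r : R) : R :=
  ln (beta / (2 * pi * s r)) / 2 - a ^+ 2 * r - b ^+ 2 / beta * ((c r - 1) / s r).

Definition mehler (r : R) : R -> R :=
  gaussian (mehlerP r) (mehlerQ r) (mehlerS r).

Let beta2 : 2 * beta != 0. Proof. by rewrite mulf_neq0. Qed.

Section positive_time.
Context (r : R) (r_gt0 : 0 < r).

Lemma mehler_sinh_neq0 : s r != 0.
Proof. exact: sinh_neq0. Qed.

Lemma mehler_sinh_gt0 : 0 < beta / s r.
Proof.
have := mul_sinh_gt0 beta2 r_gt0; rewrite -mulrA pmulr_rgt0 // -/(s r) => h.
rewrite (_ : beta / s r = beta * s r / s r ^+ 2); last first.
  by field; exact: mehler_sinh_neq0.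
by rewrite divr_gt0 // exprn_even_gt0 // mehler_sinh_neq0.
Qed.

Lemma mehler_cosh_gt0 : 0 < c r.
Proof. by rewrite divr_gt0 // addr_gt0 ?expR_gt0. Qed.

Lemma mehlerP_gt0 : 0 < mehlerP r.
Proof.
rewrite /mehlerP (_ : _ * _ = beta / s r * (c r / 2)); last first.
  by field; exact: mehler_sinh_neq0.
by rewrite mulr_gt0 ?mehler_sinh_gt0 // divr_gt0 // mehler_cosh_gt0.
Qed.

Let s0 := mehler_sinh_neq0.

Let cs : c r ^+ 2 = 1 + s r ^+ 2. Proof. exact: cosh2_sinh2. Qed.

Let dV : is_derive r 1 (fun z => (s z)^-1) (- (2 * beta * c r) / s r ^+ 2).
Proof.
apply: is_derive1_eq (is_deriveV s0 (is_derive_sinh (2 * beta) r)) _.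
by rewrite /GRing.scale /= -/(c r); ring.
Qed.

Let d_coth : is_derive r 1 (fun z => c z / s z) (- (2 * beta) / s r ^+ 2).
Proof.
apply: is_derive1_eq (is_deriveM (is_derive_cosh (2 * beta) r) dV) _.
rewrite /GRing.scale /= -/(c r) -/(s r).
(* The intermediate form isolates the use of cosh^2 = 1 + sinh^2; the same device recurs below. *)
transitivity (2 * beta * (s r ^+ 2 - c r ^+ 2) / s r ^+ 2).
  by field.
by rewrite cs; field.
Qed.

Let d_tanh : is_derive r 1 (fun z => (c z - 1) / s z)
  (2 * beta * (c r - 1) / s r ^+ 2).
Proof.
have dc1 := is_deriveB (is_derive_cosh (2 * beta) r) (is_derive_cst (1 : R) r 1).
apply: is_derive1_eq (is_deriveM dc1 dV) _.
rewrite /GRing.scale /= !fctE /= -/(c r) -/(s r).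
transitivity (2 * beta * (s r ^+ 2 - c r ^+ 2 + c r) / s r ^+ 2).
  by field.
by rewrite cs; field.
Qed.

Let d_ln : is_derive r 1 (fun z => ln (beta / (2 * pi * s z)))
  (- (2 * beta * c r) / s r).
Proof.
have pi0 : pi != 0 :> R by rewrite gt_eqF // pi_gt0.
have arg : 0 < beta / (2 * pi) * (s r)^-1.
  rewrite mulrAC divr_gt0 ?mehler_sinh_gt0 //.
  by rewrite mulr_gt0 // pi_gt0.
have h := @is_derive1_comp _ (@ln R)
  ((beta / (2 * pi)) \*: (fun z : R => (s z)^-1)) r _ _ (is_derive1_ln arg)
  (is_deriveZ (beta / (2 * pi)) dV).
rewrite (_ : (fun z => ln _) =
  (@ln R) \o ((beta / (2 * pi)) \*: (fun z : R => (s z)^-1))); last first.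
  by apply/funext => z /=; rewrite /GRing.scale /= invfM mulrA.
apply: is_derive1_eq h _; rewrite /GRing.scale /=.
by move: (pi : R) pi0 => q q0; field; rewrite s0 q0 beta_neq0.
Qed.

Lemma is_derive_mehlerP :
  is_derive r 1 mehlerP (beta ^+ 2 - 4 * mehlerP r ^+ 2).
Proof.
apply: is_derive1_eq (is_deriveZ (beta / 2) d_coth) _.
rewrite /GRing.scale /= /mehlerP.
transitivity (beta ^+ 2 * (s r ^+ 2 - c r ^+ 2) / s r ^+ 2).
  by rewrite cs; field.
by field.
Qed.

Lemma is_derive_mehlerQ :
  is_derive r 1 mehlerQ (- (4 * mehlerP r * mehlerQ r) - 2 * b * beta).
Proof.
apply: is_derive1_eq (is_deriveZ (- b) d_tanh) _.
rewrite /GRing.scale /= /mehlerP /mehlerQ.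
transitivity (2 * b * beta * (c r ^+ 2 - c r - s r ^+ 2) / s r ^+ 2).
  by rewrite cs; field.
by field.
Qed.

Lemma is_derive_mehlerS : is_derive r 1 mehlerS
  (mehlerQ r ^+ 2 - 2 * mehlerP r - a ^+ 2 - b ^+ 2).
Proof.
have h := is_deriveB (is_deriveB (is_deriveZ 2^-1 d_ln)
  (is_deriveZ (a ^+ 2) (is_derive_id r 1))) (is_deriveZ (b ^+ 2 / beta) d_tanh).
rewrite (_ : mehlerS = (2^-1 \*: (fun z => ln (beta / (2 * pi * s z))) -
   a ^+ 2 \*: id) - (b ^+ 2 / beta) \*: (fun z => (c z - 1) / s z)); last first.
  by apply/funext => z; rewrite /mehlerS mulrC.
apply: is_derive1_eq h _; rewrite /GRing.scale /= /mehlerP /mehlerQ.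
transitivity (b ^+ 2 * ((c r - 1) ^+ 2 - (c r ^+ 2 - 1)) / s r ^+ 2
  - beta * c r / s r - a ^+ 2).
  by field; rewrite s0 beta_neq0.
by rewrite cs; field.
Qed.

End positive_time.

Lemma mehler_orbit (H : set ((R -> R) * (R -> R))) (V : R -> R)
    (E : R -> (R -> R) -> (R -> R)) (tau t : R) :
  (forall x, V x = a ^+ 2 + (b + beta * x) ^+ 2) ->
  (forall f, smooth_compact f -> H (f, fun x => V x * f x - derive1n 2 f x)) ->
  heat_semigroup mu H E -> 0 < tau -> 0 <= t ->
  {ae mu, forall x, E t (mehler tau) x = mehler (t + tau) x}.
Proof.
move=> VE HH [HE HG] tau0 t0.
(* The time derivative of [mehler r], with the derivatives of the coefficients taken from the
   Riccati system. *)
pose g r x := (mehlerQ r ^+ 2 - 2 * mehlerP r - a ^+ 2 - b ^+ 2 +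
  (- (4 * mehlerP r * mehlerQ r) - 2 * b * beta) * x +
  - (beta ^+ 2 - 4 * mehlerP r ^+ 2) * x ^+ 2) * mehler r x.
apply: (semigroup_orbit HE (g := g)) => // r r0.
  apply/HG.
  (* By the Riccati system, [- g r] is the symbol applied to [mehler r], that is V u - u''. *)
  rewrite (_ : \- g r = fun x => (V x - (- (2 * mehlerP r) * x + mehlerQ r) ^+ 2
    + 2 * mehlerP r) * gaussian (mehlerP r) (mehlerQ r) (mehlerS r) x).
    apply: (@gaussian_graph_closure _ _ _ _ (mehlerP_gt0 r0) _ _
      (a ^+ 2 + b ^+ 2) (2 * b * beta) (beta ^+ 2)) => // x.
    by rewrite VE; ring.
  apply/funext => x; rewrite /g /mehler VE /=; ring.
exact: (gaussian_family_derive (is_derive_mehlerP r0) (is_derive_mehlerQ r0)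
  (is_derive_mehlerS r0) (mehlerP_gt0 r0)).
Qed.

End Mehler.

(** * Approximate identities against an unbounded continuous function *)

Section ApproximateIdentity.
Context {R : realType}.
Local Notation mu := (@lebesgue_measure R).

(** If the positive or the negative part had infinite integral, so would the difference, oo - oo
    being -oo. The kernel identity provides a real value for an integral, and integrability of the
    kernel against a Gaussian is recovered from it. *)
Lemma fin_num_integrable (d : measure_display) (T : measurableType d)
    (nu : {measure set T -> \bar R}) (f : T -> \bar R) :
  measurable_fun [set: T] f -> (\int[nu]_x f x)%E \is a fin_num ->
  nu.-integrable [set: T] f.
Proof.
move=> mf; rewrite integralE => fin.
have p0 : (0 <= \int[nu]_x f^\+ x)%E by apply: integral_ge0.
have n0 : (0 <= \int[nu]_x f^\- x)%E by apply: integral_ge0.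
have [pfin nfin] : (\int[nu]_x f^\+ x)%E \is a fin_num /\
    (\int[nu]_x f^\- x)%E \is a fin_num.
  move: p0 n0 fin.
  by case: (\int[nu]_x f^\+ x)%E => //; case: (\int[nu]_x f^\- x)%E.
apply/integrableP; split => //.
have -> : (\int[nu]_x `|f x| = \int[nu]_x (f^\+ x + f^\- x))%E.
  by apply: eq_integral => x _; rewrite -[RHS]/((f^\+ \+ f^\-)%E x) -fune_abse.
rewrite ge0_integralD //; last 2 first.
- exact: measurable_funepos.
- exact: measurable_funeneg.
by rewrite lte_add_pinfty // ltey_eq ?pfin ?nfin.
Qed.

(** K is continuous but possibly unbounded, so it would not suffice that the mass of [u n] off 0 is
    small. The tail is compared with the fixed function [u 0], against which K is integrable. *)
Lemma approximate_identity (u : nat -> R -> R) (K : R -> R) :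
  continuous K -> (forall n x, 0 <= u n x) ->
  (forall n, mu.-integrable [set: R] (EFin \o u n)) ->
  (forall n, mu.-integrable [set: R] (EFin \o (fun x => K x * u n x))) ->
  \int[mu]_x u n x @[n --> \oo] --> (1 : R) ->
  (forall del e, 0 < del -> 0 < e -> \forall n \near \oo,
     forall x, del <= `|x| -> u n x <= e * u 0%N x) ->
  \int[mu]_x (K x * u n x) @[n --> \oo] --> K 0.
Proof.
move=> cK u0 iu iKu u1 utail.
pose g x := K x - K 0.
have ig n : mu.-integrable [set: R] (EFin \o (fun x => g x * u n x)).
  rewrite (_ : EFin \o _ = (EFin \o (fun x => K x * u n x)%R) \-
      (fun x => (K 0)%:E * (EFin \o u n) x))%E; last first.
    by apply/funext => x /=; rewrite -EFinB mulrBl.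
  by apply: integrableB => //; exact: integrableZl.
have iag n : mu.-integrable [set: R] (EFin \o (fun x => `|g x| * u n x)).
  have := integrable_abse (ig n); apply: eq_integrable => // x _ /=.
  by rewrite normrM (ger0_norm (u0 _ _)).
pose J := \int[mu]_x (`|g x| * u 0%N x).
have J0 : 0 <= J by apply: Rintegral_ge0 => x _; rewrite mulr_ge0.
apply/cvgrPdist_le => /= e e0.
(* The final error is at most eta (|K 0| + 2 + J): the mass defect, the part near 0 with mass at
   most 2, and the tail. *)
pose eta := Num.min 1 (e / (3 + J + `|K 0|)).
have D0 : 0 < 3 + J + `|K 0| by have := normr_ge0 (K 0); lra.
have eta0 : 0 < eta by rewrite lt_min ltr01 divr_gt0.
have eta1 : eta <= 1 by rewrite ge_min lexx.
have etaD : eta * (3 + J + `|K 0|) <= e.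
  by rewrite -ler_pdivlMr // ge_min lexx orbT.
have := cK 0; move=> /cvgrPdist_le /(_ eta eta0) [del /= del0 Hdel].
have := utail _ _ del0 eta0 => Htail.
have H1 : \forall n \near \oo, `|1 - \int[mu]_x u n x| <= eta.
  by move/cvgrPdist_le: u1 => /(_ _ eta0).
near=> n.
have It : forall x, del <= `|x| -> u n x <= eta * u 0%N x by near: n.
have I1 : `|1 - \int[mu]_x u n x| <= eta by near: n.
have ble : \int[mu]_x (`|g x| * u n x) <= eta * \int[mu]_x u n x + eta * J.
  rewrite /J -!RintegralZl // -RintegralD //; last 2 first.
  - exact: (integrableZl _ eta (iu n)).
  - exact: (integrableZl _ eta (iag 0%N)).
  apply: le_Rintegral => //.
    rewrite (_ : EFin \o _ = (fun x => eta%:E * (EFin \o u n) x) \+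
        (fun x => eta%:E * (EFin \o (fun x => `|g x| * u 0%N x)%R) x))%E //.
    by apply: integrableD => //; exact: integrableZl.
  move=> x _; have [xdel|xdel] := leP del `|x|.
    have h1 := It x xdel.
    have h2 : `|g x| * u n x <= `|g x| * (eta * u 0%N x) by rewrite ler_wpM2l.
    have h3 : 0 <= eta * u n x by rewrite mulr_ge0 // ltW.
    lra.
  have h1 : `|g x| <= eta.
    by rewrite distrC; apply: Hdel; rewrite /= sub0r normrN.
  have h2 : `|g x| * u n x <= eta * u n x by rewrite ler_wpM2r.
  have h3 : 0 <= eta * (`|g x| * u 0%N x) by rewrite !mulr_ge0 // ltW.
  lra.
have gE : \int[mu]_x (g x * u n x) =
    \int[mu]_x (K x * u n x) - K 0 * \int[mu]_x u n x.
  rewrite -RintegralZl // -RintegralB //; last exact: (integrableZl _ (K 0) (iu n)).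
  by apply: eq_Rintegral => x _; rewrite /g mulrBl.
have gle : `|\int[mu]_x (g x * u n x)| <= \int[mu]_x (`|g x| * u n x).
  apply: le_trans (le_normr_Rintegral _ _) _ => //.
  rewrite le_eqVlt; apply/orP; left; apply/eqP; apply: eq_Rintegral => x _.
  by rewrite normrM (ger0_norm (u0 _ _)).
set I := \int[mu]_x u n x in I1 ble gE *.
set G := \int[mu]_x (g x * u n x) in gE gle *.
set A := \int[mu]_x (K x * u n x) in gE *.
rewrite (_ : K 0 - A = K 0 * (1 - I) - G); last by rewrite gE; ring.
apply: le_trans (ler_normB _ _) _; rewrite normrM.
have k1 : `|K 0| * `|1 - I| <= `|K 0| * eta by rewrite ler_wpM2l.
have I2 : I <= 2 by move: I1; rewrite ler_norml => /andP[]; lra.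
have k2 : eta * I <= eta * 2 by rewrite ler_pM2l.
have := le_trans gle ble; lra.
Unshelve. all: by end_near. Qed.

End ApproximateIdentity.

(** * Mehler's kernel for small times *)

Section MehlerDirac.
Context {R : realType}.
Local Notation mu := (@lebesgue_measure R).
Context (a b beta : R) (beta_neq0 : beta != 0).
Local Notation mehler := (mehler a b beta).
Local Notation P := (mehlerP beta).
Local Notation Q := (mehlerQ b beta).
Local Notation S := (mehlerS a b beta).

Let c (r : R) := cosh (2 * beta * r).
Let s (r : R) := sinh (2 * beta * r).
Let W (r : R) := beta / (2 * s r).

(** Half-angle formula: on the right the denominator is at least 1, so the limit r -> 0 can be taken
    factor by factor. *)
Lemma mehler_tanhE (r : R) : 0 < r -> (c r - 1) / s r = s r / (c r + 1).
Proof.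
move=> r0; have s0 := mehler_sinh_neq0 beta_neq0 r0.
have c0 := mehler_cosh_gt0 beta r.
have c1 : c r + 1 != 0 by rewrite gt_eqF // addr_gt0.
apply/eqP; rewrite -subr_eq0; apply/eqP.
transitivity ((c r ^+ 2 - 1 - s r ^+ 2) / (s r * (c r + 1))).
  by field; rewrite c1 s0.
by rewrite [c r ^+ 2]cosh2_sinh2 -/(s r) [1 + _]addrC addrK subrr mul0r.
Qed.

Let pi_neq0 : pi != 0 :> R. Proof. by rewrite gt_eqF // pi_gt0. Qed.

Lemma expR_mehlerS (r : R) : 0 < r -> expR (S r) =
  Num.sqrt (W r / pi) * expR (- (a ^+ 2 * r) - b ^+ 2 / beta * ((c r - 1) / s r)).
Proof.
move=> r0; have s0 := mehler_sinh_neq0 beta_neq0 r0.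
have bs := mehler_sinh_gt0 beta_neq0 r0.
have Wpi : 0 < W r / pi.
  rewrite (_ : W r / pi = beta / s r * (2 * pi)^-1); last first.
    by move: (pi : R) pi_neq0 => q q0; rewrite /W; field; rewrite s0 q0.
  by rewrite mulr_gt0 // invr_gt0 mulr_gt0 // pi_gt0.
rewrite /mehlerS -!addrA expRD -opprD -powR12_sqrt ?(ltW Wpi) // /powR gt_eqF //.
congr (expR _ * expR _).
rewrite mulrC; congr (_ * ln _).
by move: (pi : R) pi_neq0 => q q0; rewrite /W -/(s r); field; rewrite s0 q0.
Qed.

Lemma integral_mehler (r : R) : 0 < r ->
  \int[mu]_x mehler r x = Num.sqrt (c r)^-1 *
    expR (b ^+ 2 * (s r / (c r + 1)) ^+ 2 * s r / (2 * beta * c r)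
      - a ^+ 2 * r - b ^+ 2 / beta * (s r / (c r + 1))).
Proof.
move=> r0; have s0 := mehler_sinh_neq0 beta_neq0 r0.
have c0 := mehler_cosh_gt0 beta r; have cn0 : c r != 0 by rewrite gt_eqF.
have bs := mehler_sinh_gt0 beta_neq0 r0.
have P0 := mehlerP_gt0 beta_neq0 r0.
rewrite /Rintegral integral_gaussian //= expRD expR_mehlerS //.
set x1 := Num.sqrt _; set x2 := expR _; set x3 := Num.sqrt _; set x4 := expR _.
have -> : x1 * (x2 * (x3 * x4)) = (x1 * x3) * (x2 * x4) by ring.
rewrite /x1 /x2 /x3 /x4 -expRD -sqrtrM; last first.
  by rewrite divr_ge0 ?pi_ge0 // ltW.
have W0 : W r / P r = (c r)^-1.
  by rewrite /W /mehlerP -/(c r) -/(s r); field; rewrite s0 cn0 beta_neq0.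
congr (Num.sqrt _ * expR _).
  rewrite -W0; move: (pi : R) pi_neq0 => q q0; field.
  by rewrite q0 gt_eqF.
have -> : Q r ^+ 2 / (4 * P r) = b ^+ 2 * ((c r - 1) / s r) ^+ 2 * s r / (2 * beta * c r).
  rewrite /mehlerQ /mehlerP -/(c r) -/(s r); field.
  by rewrite s0 cn0 beta_neq0.
by rewrite mehler_tanhE // addrA.
Qed.

Let d0 (f : R -> R) (df l : R) : is_derive (0 : R) 1 f df -> f 0 = l ->
  f (harmonic n) @[n --> \oo] --> l.
Proof.
move=> [fd _] <-; apply: continuous_cvg; last exact: cvg_harmonic.
exact/differentiable_continuous/derivable1_diffP.
Qed.

Lemma cvg_mehler_cosh : c (harmonic n) @[n --> \oo] --> (1 : R).
Proof.
apply: (d0 (f := c) (is_derive_cosh (2 * beta) 0)).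
by rewrite /c mulr0 /cosh oppr0 expR0; field.
Qed.

Lemma cvg_mehler_sinh : s (harmonic n) @[n --> \oo] --> (0 : R).
Proof.
apply: (d0 (f := s) (is_derive_sinh (2 * beta) 0)).
by rewrite /s mulr0 /sinh oppr0 subrr mul0r.
Qed.

Lemma cvg_integral_mehler :
  \int[mu]_x mehler (harmonic n) x @[n --> \oo] --> (1 : R).
Proof.
under eq_fun do rewrite integral_mehler ?harmonic_gt0 //.
have cc := cvg_mehler_cosh; have cs := cvg_mehler_sinh.
have ch : harmonic n @[n --> \oo] --> (0 : R) by exact: cvg_harmonic.
have cT : s (harmonic n) / (c (harmonic n) + 1) @[n --> \oo] --> (0 : R).
  rewrite -(mul0r ((1 + 1 : R)^-1)); apply: cvgM => //; apply: cvgV => //.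
  by apply: cvgD => //; exact: cvg_cst.
have cI : (c (harmonic n))^-1 @[n --> \oo] --> (1 : R).
  by rewrite -invr1; apply: cvgV.
have A1 : Num.sqrt (c (harmonic n))^-1 @[n --> \oo] --> Num.sqrt (1 : R).
  by apply: continuous_cvg => //; exact: sqrt_continuous.
pose f r := b ^+ 2 * (s r / (c r + 1)) ^+ 2 * s r / (2 * beta * c r)
  - a ^+ 2 * r - b ^+ 2 / beta * (s r / (c r + 1)).
have A2 : f (harmonic n) @[n --> \oo] -->
    b ^+ 2 * (0 * 0) * 0 * ((2 * beta)^-1 * 1) - a ^+ 2 * 0 - b ^+ 2 / beta * 0.
  apply: cvgB; last by apply: cvgMr.
  apply: cvgB; last by apply: cvgMr.
  apply: cvgM.
    apply: cvgM => //; apply: cvgMr.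
    by under eq_fun do rewrite expr2; exact: cvgM.
  by under eq_fun do rewrite invfM; apply: cvgMr.
have A3 : expR (f (harmonic n)) @[n --> \oo] --> expR (0 : R).
  apply: continuous_cvg; first exact: continuous_expR.
  by move: A2; rewrite !mulr0 mul0r !subr0.
have h := cvgM A1 A3.
have e1 : Num.sqrt 1 * expR 0 = 1 :> R by rewrite sqrtr1 expR0 mulr1.
by rewrite e1 in h; exact: h.
Qed.

Lemma mehlerQ_le (r : R) : 0 < r -> `|Q r| <= `|b|.
Proof.
move=> r0; have s0 := mehler_sinh_neq0 beta_neq0 r0.
have c0 := mehler_cosh_gt0 beta r.
rewrite /mehlerQ normrM normrN ler_piMr // mehler_tanhE // normrM normfV.
rewrite [`|c r + 1|]gtr0_norm ?addr_gt0 // ler_pdivrMr ?addr_gt0 // mul1r.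
rewrite -ler_sqr ?nnegrE ?(ltW (addr_gt0 c0 ltr01)) // real_normK ?num_real //.
have := cosh2_sinh2 (2 * beta * r); rewrite -/(c r) -/(s r) => cs2.
rewrite sqrrD cs2 expr1n mulr1; move: c0; rewrite -/(c r); lra.
Qed.

Lemma mehler_cosh_ge1 (r : R) : 1 <= c r.
Proof.
have c0 : 0 <= c r by exact/ltW/mehler_cosh_gt0.
rewrite -ler_sqr ?nnegrE // expr1n [leRHS]cosh2_sinh2 lerDl; exact: sqr_ge0.
Qed.

Lemma mehlerW_gt0 (r : R) : 0 < r -> 0 < W r.
Proof.
move=> r0; have s0 := mehler_sinh_neq0 beta_neq0 r0.
rewrite /W invfM mulrCA mulr_gt0 // ?invr_gt0 //.
exact: mehler_sinh_gt0.
Qed.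

Lemma mehlerP_ge (r : R) : 0 < r -> W r <= P r.
Proof.
move=> r0; have s0 := mehler_sinh_neq0 beta_neq0 r0.
have -> : P r = c r * W r.
  by rewrite /W /mehlerP -/(c r) -/(s r); field; exact: s0.
by rewrite ler_peMl ?mehler_cosh_ge1 // ltW // mehlerW_gt0.
Qed.

(** The square root is traded for the crude bound sqrt (W / pi) <= 1 + W, because the exponential
    gain in the tail beats any power of W. *)
Lemma expR_mehlerS_le (r : R) : 0 < r -> expR (S r) <= 1 + W r.
Proof.
move=> r0; rewrite expR_mehlerS //; have W0 := mehlerW_gt0 r0.
have s0 := mehler_sinh_neq0 beta_neq0 r0.
have pi1 : 1 <= pi :> R by have := pi_ge2 R; lra.
have h1 : Num.sqrt (W r / pi) <= 1 + W r.
  apply: (@le_trans _ _ (Num.sqrt ((1 + W r) ^+ 2))); last first.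
    by rewrite sqrtr_sqr ger0_norm // addr_ge0 // ltW.
  rewrite ler_wsqrtr //; apply: (@le_trans _ _ (W r)).
    by rewrite ler_pdivrMr ?pi_gt0 // ler_peMr // ltW.
  nra.
apply: le_trans h1; rewrite ler_piMr ?sqrtr_ge0 // -[leRHS]expR0 ler_expR.
have : 0 <= b ^+ 2 / beta * ((c r - 1) / s r).
  rewrite (_ : _ * _ = b ^+ 2 * ((c r - 1) * (2 * W r) / beta ^+ 2)); last first.
    by rewrite /W; field; rewrite beta_neq0 s0.
  rewrite mulr_ge0 ?sqr_ge0 // divr_ge0 ?sqr_ge0 // mulr_ge0 ?subr_ge0 ?mehler_cosh_ge1 //.
  by rewrite mulr_ge0 // ltW.
have : 0 <= a ^+ 2 * r by rewrite mulr_ge0 ?sqr_ge0 // ltW.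
lra.
Qed.

Lemma mehlerW_large (M : R) : 0 < M -> \forall n \near \oo, M <= W (harmonic n).
Proof.
move=> M0; have e0 : 0 < `|beta| / (2 * M).
  by rewrite divr_gt0 ?normr_gt0 // mulr_gt0.
have /cvgrPdist_le /(_ _ e0) := cvg_mehler_sinh.
apply: filterS => n; rewrite sub0r normrN => h.
have h0 := @harmonic_gt0 R n; have W0 := mehlerW_gt0 h0.
have s0 := mehler_sinh_neq0 beta_neq0 h0.
rewrite -(ger0_norm (ltW W0)) /W normrM normfV normrM [`|2|]ger0_norm //.
rewrite ler_pdivlMr ?mulr_gt0 ?normr_gt0 //.
move: h; rewrite ler_pdivlMr ?mulr_gt0 //; lra.
Qed.

(** For |x| >= del the linear terms satisfy |Q x| <= (|b| / del) x^2 and are absorbed in the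
    quadratic ones. As W tends to infinity the gain exp (- (W - A) del^2) beats the prefactor 1 +
    W. *)
Lemma mehler_tail (del e : R) : 0 < del -> 0 < e ->
  \forall n \near \oo, forall x, del <= `|x| ->
    mehler (harmonic n) x <= e * mehler (harmonic 0%N) x.
Proof.
move=> del0 e0; set r0 : R := harmonic 0%N.
have r0_gt0 : 0 < r0 by exact: harmonic_gt0.
have P0 := mehlerP_gt0 beta_neq0 r0_gt0.
pose A := P r0 + 2 * `|b| / del.
have A0 : 0 < A by rewrite ltr_wpDr // divr_ge0 ?mulr_ge0 // ltW.
pose B := 16 / (del ^+ 4 * (e * expR (S r0))).
have B0 : 0 < B by rewrite divr_gt0 // !mulr_gt0 ?exprn_gt0 ?expR_gt0.
(* [2 * A] gives W - A >= W / 2, [1] gives 1 + W <= 2 W, and [B] settles the last comparison, 16 /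
   (del^4 W) <= e exp (S r0). *)
have M0 : 0 < 2 * A + 1 + B by lra.
apply: filterS (mehlerW_large M0) => n WM x xdel.
set r : R := harmonic n in WM *.
have r_gt0 : 0 < r by exact: harmonic_gt0.
have W0 := mehlerW_gt0 r_gt0.
have S1 := expR_mehlerS_le r_gt0.
have xx : `|b| * `|x| <= `|b| / del * x ^+ 2.
  rewrite -mulrA ler_wpM2l // [leRHS]mulrC ler_pdivlMr //.
  by rewrite -[x ^+ 2]real_normK ?num_real // expr2 ler_wpM2l.
have Qx (z : R) : 0 < z -> `|Q z * x| <= `|b| / del * x ^+ 2.
  move=> z0; rewrite normrM; apply: le_trans xx.
  by rewrite ler_wpM2r // mehlerQ_le.
have Q1 := Qx r r_gt0; have Q2 := Qx r0 r0_gt0.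
have PW := mehlerP_ge r_gt0.
pose y := (W r - A) * del ^+ 2.
have WA : W r / 2 <= W r - A by lra.
have y0 : 0 < y by rewrite mulr_gt0 ?exprn_gt0 //; lra.
have x2 : del ^+ 2 <= x ^+ 2.
  by rewrite -[x ^+ 2]real_normK ?num_real // ler_sqr ?nnegrE // ltW.
have expy : expR (- (P r * x ^+ 2) + Q r * x) <=
    expR (- y) * expR (- (P r0 * x ^+ 2) + Q r0 * x).
  rewrite -expRD ler_expR.
  have h1 : W r * x ^+ 2 <= P r * x ^+ 2 by rewrite ler_wpM2r // sqr_ge0.
  have h2 : y <= (W r - A) * x ^+ 2 by rewrite ler_wpM2l //; lra.
  have h3 : A * x ^+ 2 = P r0 * x ^+ 2 + 2 * (`|b| / del * x ^+ 2).
    by rewrite /A; ring.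
  move: Q1 Q2; rewrite !ler_norml => /andP[_ Q1] /andP[Q2 _].
  lra.
have main : (1 + W r) * expR (- y) <= e * expR (S r0).
  have yle : expR (- y) <= 2 / y ^+ 2.
    rewrite ler_pdivlMr ?exprn_gt0 // mulrC.
    by apply: le_trans (exprn_expRN_le 2 (ltW y0)) _.
  apply: (@le_trans _ _ ((2 * W r) * (2 / y ^+ 2))).
    by apply: ler_pM => //; lra.
  have ylow : (W r / 2 * del ^+ 2) ^+ 2 <= y ^+ 2.
    have l0 : 0 <= W r / 2 * del ^+ 2.
      by apply: mulr_ge0; [apply: divr_ge0 => //; exact: ltW|exact: sqr_ge0].
    rewrite ler_sqr ?nnegrE ?(ltW y0) //.
    by apply: ler_wpM2r => //; exact: sqr_ge0.
  apply: (@le_trans _ _ ((2 * W r) * (2 / (W r / 2 * del ^+ 2) ^+ 2))).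
    apply: ler_wpM2l; first by apply: mulr_ge0 => //; exact: ltW.
    apply: ler_wpM2l => //; rewrite lef_pV2 //.
      by rewrite posrE exprn_gt0.
    by rewrite posrE exprn_gt0 // mulr_gt0 ?exprn_gt0 // divr_gt0.
  rewrite [leLHS](_ : _ = 16 / (del ^+ 4 * W r)); last first.
    by field; rewrite !gt_eqF.
  have dW : 0 < del ^+ 4 * W r by apply: mulr_gt0 => //; exact: exprn_gt0.
  rewrite ler_pdivrMr //.
  have BW : B <= W r by lra.
  move: BW; rewrite ler_pdivrMr; last by rewrite !mulr_gt0 ?exprn_gt0 ?expR_gt0.
  lra.
have mE z : mehler z x = expR (- (P z * x ^+ 2) + Q z * x) * expR (S z).
  by rewrite -expRD.
rewrite !mE.
apply: le_trans (ler_pM _ _ expy S1) _; rewrite ?expR_ge0 //.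
set G := expR (- (P r0 * x ^+ 2) + Q r0 * x).
have -> : expR (- y) * G * (1 + W r) = (1 + W r) * expR (- y) * G by ring.
have -> : e * (G * expR (S r0)) = e * expR (S r0) * G by ring.
by rewrite ler_wpM2r // expR_ge0.
Qed.

Lemma mehler_cvg_dirac (K : R -> R) (l : nat -> R) : continuous K ->
  (forall n, (\int[mu]_x (K x * mehler (harmonic n) x)%:E = (l n)%:E)%E) ->
  l n @[n --> \oo] --> K 0.
Proof.
move=> cK Kl.
have mK n : measurable_fun [set: R] (fun x => K x * mehler (harmonic n) x).
  apply: measurable_funM; first exact: continuous_measurable_fun.
  by apply: elementary_measurable; exact: (elementary_gaussian (P _) (Q _) (S _)).
have -> : l = fun n => \int[mu]_x (K x * mehler (harmonic n) x).
  by apply/funext => n; rewrite /Rintegral Kl.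
apply: (@approximate_identity _ (fun n => mehler (harmonic n))) => //.
- by move=> n x; exact: gaussian_ge0.
- move=> n; apply: integrable_gaussian; apply: mehlerP_gt0 => //.
  exact: harmonic_gt0.
- move=> n; apply: fin_num_integrable; first by apply/measurable_EFinP; exact: mK.
  by rewrite Kl.
- exact: cvg_integral_mehler.
- exact: mehler_tail.
Qed.

Lemma mehler_continuous_time (t x : R) : 0 < t ->
  mehler (t + harmonic n) x @[n --> \oo] --> mehler t x.
Proof.
move=> t0; have ct : t + harmonic n @[n --> \oo] --> t.
  suff : t + harmonic n @[n --> \oo] --> t + (0 : R) by rewrite addr0.
  by apply: cvgD; [exact: cvg_cst|exact: cvg_harmonic].
have cf (f : R -> R) (df : R) : is_derive t 1 f df ->
    f (t + harmonic n) @[n --> \oo] --> f t.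
  move=> [fd _]; apply: continuous_cvg => //.
  exact/differentiable_continuous/derivable1_diffP.
apply: continuous_cvg; first exact: continuous_expR.
apply: cvgD; last exact: cf (is_derive_mehlerS a b beta_neq0 t0).
apply: cvgD.
  by apply: cvgN; apply: cvgMl; exact: cf (is_derive_mehlerP beta_neq0 t0).
by apply: cvgMl; exact: cf (is_derive_mehlerQ b beta_neq0 t0).
Qed.

End MehlerDirac.

(** * Identification of a continuous kernel with Mehler's *)

Section MehlerKernel.
Context {R : realType}.
Local Notation mu := (@lebesgue_measure R).

(** An open interval on which the functions differ would have positive measure. *)
Lemma ae_eq_continuous (f g : R -> R) (x : R) : continuous f -> continuous g ->
  {ae mu, forall y, f y = g y} -> f x = g x.
Proof.
move=> cf cg [N [mN N0 fgN]]; apply/eqP; apply: contraT => fgx; exfalso.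
have : \forall y \near x, f y - g y != 0.
  have : f y - g y @[y --> x] --> f x - g x by apply: cvgB; [exact: cf|exact: cg].
  by move=> /cvgr_neq0; apply; rewrite subr_eq0.
case=> e /= e0 He.
pose I : set R := `]x - e, x + e[%classic.
have sub : I `<=` N.
  move=> y; rewrite /I /= in_itv /= => xye; apply: fgN => /= fgy.
  have := He y; rewrite /= fgy subrr eqxx => /(_ _)/notF; apply.
  by rewrite distrC ltr_distl.
have : (mu I <= mu N)%E.
  apply: (le_measure mu); rewrite ?inE //; exact: measurable_itv.
rewrite N0 /I lebesgue_measure_itv /= lte_fin ifT; last by lra.
by rewrite -EFinB lee_fin leNgt => /negP; apply; lra.
Qed.

Context (a b beta : R) (beta_neq0 : beta != 0).

(** For almost every s, [E t (mehler (harmonic n)) s] has two limits: the kernel at (s, 0), by the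
    approximate identity, and [mehler t s], by the orbit. Both are continuous in s, so they agree
    also at s = 0. *)
Lemma mehler_kernel (H : set ((R -> R) * (R -> R))) (V : R -> R)
    (E : R -> (R -> R) -> (R -> R)) (t : R) (kap : R -> R -> R) :
  (forall x, V x = a ^+ 2 + (b + beta * x) ^+ 2) ->
  (forall f, smooth_compact f -> H (f, fun x => V x * f x - derive1n 2 f x)) ->
  heat_semigroup mu H E -> 0 < t ->
  (forall s, continuous (kap s)) -> continuous (kap ^~ 0) ->
  (forall f, L2 mu f -> {ae mu, forall s,
     (E t f s)%:E = (\int[mu]_s1 (kap s s1 * f s1)%:E)%E}) ->
  kap 0 0 = mehler a b beta t 0.
Proof.
move=> VE HH HE t0 ck ck0 kE.
apply: (@ae_eq_continuous (kap ^~ 0) (mehler a b beta t)) => //.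
  by apply: elementary_continuous; exact: elementary_gaussian.
have Lm n : L2 mu (mehler a b beta (harmonic n)).
  by apply: L2_gaussian; apply: mehlerP_gt0 => //; exact: harmonic_gt0.
(* There are countably many test functions, so a single null set serves for all n. *)
have A1 : {ae mu, forall s, forall n, (E t (mehler a b beta (harmonic n)) s)%:E =
    (\int[mu]_s1 (kap s s1 * mehler a b beta (harmonic n) s1)%:E)%E}.
  by apply: ae_foralln => n; exact: kE.
have A2 : {ae mu, forall s, forall n, E t (mehler a b beta (harmonic n)) s =
    mehler a b beta (t + harmonic n) s}.
  apply: ae_foralln => n.
  by apply: (mehler_orbit beta_neq0 VE HH HE); [exact: harmonic_gt0|exact: ltW].
have A12 := @filterI _ _ (ae_filter_ringOfSetsType mu) _ _ A1 A2.
move: A12; apply: filterS => s [h1 h2].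
have c1 := mehler_cvg_dirac beta_neq0 (ck s) (fun n => esym (h1 n)).
have c2 := @mehler_continuous_time _ a b beta beta_neq0 t s t0.
have c3 : (fun n => E t (mehler a b beta (harmonic n)) s) =
  (fun n => mehler a b beta (t + harmonic n) s) by apply/funext.
rewrite c3 in c1.
exact: (cvg_unique _ c1 c2).
Qed.

End MehlerKernel.

(** * The symbol on a leaf *)

Section Jacobian.
Context {R : realType}.

Lemma is_diff_coord m n (M : 'M[R]_(m, n)) i j :
  is_diff M (fun N : 'M[R]_(m, n) => N i j : R) (fun N => N i j).
Proof.
have @f : {linear 'M[R]_(m, n) -> R}.
  by exists (fun N : 'M[R]_(_, _) => N i j); do 2![eexists]; do ?[constructor];
     rewrite ?mxE// => ? *; rewrite ?mxE//; move=> ?; rewrite !mxE.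
apply: DiffDef; first exact: differentiable_coord.
rewrite (_ : (fun _ => _) = f) //; apply: diff_lin; exact: coord_continuous.
Qed.

Lemma is_diff_expR (V : normedModType R) (f df : V -> R) (x : V) :
  is_diff x f df -> is_diff x (fun y => expR (f y)) (fun h => df h * expR (f x)).
Proof.
move=> dfx; have dE : is_diff (f x) (@expR R) (fun h => h * expR (f x)).
  have de := is_derive_expR (f x).
  apply: DiffDef; first by apply/derivable1_diffP; case: de.
  rewrite diff1E; last by apply/derivable1_diffP; case: de.
  by apply/funext => h; rewrite derive1E derive_val.
exact: is_diff_comp.
Qed.

Lemma jacobian_mul m n (f : 'rV[R]_m -> 'rV[R]_n) (df : 'I_n -> 'rV[R]_m -> R)
    (p : 'rV[R]_m) (xi : 'cV[R]_n) (i : 'I_m) :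
  (forall j, is_diff p (fun q => f q 0 j : R) (df j)) ->
  ('J f p *m xi) i 0 = \sum_j df j (delta_mx 0 i) * xi j 0.
Proof.
move=> fd; have dfp : differentiable f p.
  rewrite (_ : f = \sum_j (fun q => f q 0 j *: delta_mx 0 j)); last first.
    by apply/funext => q; rewrite fct_sumE [LHS]row_sum_delta.
  apply: differentiable_sum => j; apply: differentiableZl.
  by have [] := fd j.
rewrite mxE; apply: eq_bigr => j _; congr (_ * _).
have := deriveEjacobian (delta_mx 0 i) dfp.
rewrite derive_mx; last exact: diff_derivable.
move=> /matrixP /(_ 0 j); rewrite mxE -rowE mxE => <-.
by have dj := fd j; rewrite deriveE ?diff_val //; case: dj.
Qed.

End Jacobian.

(** * Linear holonomy on conormal covectors *)

Section Geometry.
Context {R : realType}.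
Context (alpha : R).
Local Notation N := (Num.sqrt (1 + alpha ^+ 2)).

Let N_gt0 : 0 < N. Proof. by rewrite sqrtr_gt0 sqr1_gt0. Qed.
Let N2 : N ^+ 2 = 1 + alpha ^+ 2. Proof. by rewrite sqr_sqrtr // ltW // sqr1_gt0. Qed.

(** The flow translates u and v by multiples of exp (w) and exp (- w), so its Jacobian differs from
    the identity only in the derivatives along w. *)
Lemma jacobian_flow_mul s (q : 'rV[R]_3) (xi : 'cV[R]_3) :
  let k := s / N in
  'J (flow alpha s) q *m xi = xi + (k * (expR (wcoord q) * xi 0 0 -
    alpha * expR (- wcoord q) * xi 1 0)) *: delta_mx 2 0.
Proof.
move=> k.
pose d0 (h : 'rV[R]_3) := h 0 0 + k * (h 0 2 * expR (wcoord q)).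
pose d1 (h : 'rV[R]_3) := h 0 1 + k * (alpha * (- h 0 2 * expR (- wcoord q))).
pose d2 (h : 'rV[R]_3) := h 0 2.
pose df (j : 'I_3) := nth (fun=> 0) [:: d0; d1; d2] j.
have fd j : is_diff q (fun q => flow alpha s q 0 j : R) (df j).
  case: j => -[|[|[|//]]] i.
  - rewrite (_ : Ordinal i = 0); last exact/val_inj.
    rewrite (_ : (fun _ => _) = (fun q : 'rV[R]_3 => q 0 0) +
        k \*: (fun q : 'rV[R]_3 => expR (q 0 2))); last first.
      by apply/funext => z; rewrite [LHS]ucoord_flow.
    apply: is_diffD; first exact: is_diff_coord.
    by apply: is_diffZ; apply: is_diff_expR; exact: is_diff_coord.
  - rewrite (_ : Ordinal i = 1); last exact/val_inj.
    rewrite (_ : (fun _ => _) = (fun q : 'rV[R]_3 => q 0 1) +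
        k \*: (alpha \*: (fun q : 'rV[R]_3 => expR (- (q 0 2))))); last first.
      by apply/funext => z; rewrite [LHS]vcoord_flow.
    apply: is_diffD; first exact: is_diff_coord.
    apply: is_diffZ; apply: is_diffZ; apply: is_diff_expR.
    by apply: is_diffN; exact: is_diff_coord.
  - rewrite (_ : Ordinal i = 2); last exact/val_inj.
    rewrite (_ : (fun _ => _) = (fun q : 'rV[R]_3 => q 0 2)); last first.
      by apply/funext => z; rewrite [LHS]wcoord_flow.
    exact: is_diff_coord.
apply/colP => i; rewrite (jacobian_mul _ _ fd) sum_I3 /df /= /d0 /d1 /d2 !mxE /=.
case: i => -[|[|[|//]]] i; rewrite /= ?mulr1n ?mulr0n.
- by rewrite (_ : Ordinal i = 0); [ring|exact/val_inj].
- by rewrite (_ : Ordinal i = 1); [ring|exact/val_inj].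
- by rewrite (_ : Ordinal i = 2); [ring|exact/val_inj].
Qed.

(** On conormal covectors the U and V components are tied by [conormalE], and their squares add up
    to the square of [symbol_a]; with the W component [symbol_b] this gives orthonormal coordinates
    of the conormal fibre. *)
Definition symbol_a (nu : covector) : R := N * expR (- wcoord nu.1) * nu.2 1 0.
Definition symbol_b (nu : covector) : R := nu.2 2 0.
(** Up to sign, the component of the bracket of W with the unit leaf field (U + alpha V) / N along
    the unit normal (V - alpha U) / N, since [W, U] = U and [W, V] = - V. *)
Definition omega : R := 2 * alpha / (1 + alpha ^+ 2).

Lemma conormalE (p : 'rV[R]_3) (xi : 'cV[R]_3) : conormal alpha (p, xi) <->
  expR (wcoord p) * xi 0 0 = - (alpha * expR (- wcoord p) * xi 1 0).
Proof.
have E : (Xfield alpha p *m xi) 0 0 =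
    expR (wcoord p) * xi 0 0 + alpha * expR (- wcoord p) * xi 1 0.
  by rewrite mxE sum_I3 !mxE /=; ring.
split=> [h|h].
  by apply/eqP; rewrite -addr_eq0 -E /= h mxE.
rewrite /conormal /=; apply/matrixP => i j; rewrite !ord1 E h addNr mxE //.
Qed.

(** The conormal relation makes the two terms of the Jacobian equal, hence the factor 2 in
    [omega]. *)
Lemma dholE s (p : 'rV[R]_3) (xi : 'cV[R]_3) : conormal alpha (p, xi) ->
  dhol alpha s (p, xi) =
  (flow alpha s p, xi + (s * (omega * symbol_a (p, xi))) *: delta_mx 2 0).
Proof.
move=> /conormalE pxi; rewrite /dhol; congr pair.
rewrite jacobian_flow_mul wcoord_flow pxi; congr (_ + _ *: _).
rewrite /symbol_a /omega /=; have n0 := N_gt0; move: N2.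
move: N n0 => n n0 <-; field.
by rewrite gt_eqF.
Qed.

Lemma conorm2E (p : 'rV[R]_3) (xi : 'cV[R]_3) : conorm2 (p, xi) =
  (expR (wcoord p) * xi 0 0) ^+ 2 + (expR (- wcoord p) * xi 1 0) ^+ 2
  + xi 2 0 ^+ 2.
Proof.
rewrite /conorm2 /=.
have M1 : metric p *m diag_mx (vec3 (expR (2 * wcoord p))
    (expR (- (2 * wcoord p))) 1) = 1%:M.
  rewrite /metric mulmx_diag -diag_const_mx; congr diag_mx.
  apply/rowP => -[[|[|[|//]]] i]; rewrite !mxE /= -?expRD ?addNr ?subrr ?expR0 //.
  by rewrite mulr1.
have [Mu _] := mulmx1_unit M1.
have -> : invmx (metric p) = diag_mx (vec3 (expR (2 * wcoord p))
    (expR (- (2 * wcoord p))) 1) by rewrite -[RHS](mulKmx Mu) M1 mulmx1.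
rewrite mul_mx_diag mxE sum_I3 !mxE /=.
rewrite !exprMn -!expRM_natl mulrN.
ring.
Qed.

Lemma conorm2_dhol s (p : 'rV[R]_3) (xi : 'cV[R]_3) : conormal alpha (p, xi) ->
  conorm2 (dhol alpha s (p, xi)) = symbol_a (p, xi) ^+ 2 +
    (symbol_b (p, xi) + omega * symbol_a (p, xi) * s) ^+ 2.
Proof.
move=> pxi; rewrite (dholE _ pxi) conorm2E wcoord_flow !mxE /= ?mulr1n ?mulr0n.
rewrite !mulr0 !addr0 (conormalE _ _).1 // /symbol_a /symbol_b /= !exprMn N2.
ring.
Qed.

Lemma conormal_dhol s nu : conormal alpha nu -> conormal alpha (dhol alpha s nu).
Proof.
case: nu => p xi pxi; rewrite (dholE _ pxi); apply/conormalE.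
rewrite wcoord_flow !mxE /= ?mulr0n !mulr0 !addr0; exact/conormalE.
Qed.

Lemma dhol0 nu : conormal alpha nu -> dhol alpha 0 nu = nu.
Proof.
case: nu => p xi pxi; rewrite (dholE _ pxi) mul0r scale0r addr0; congr pair.
by rewrite /flow mul0r scale0r addr0.
Qed.

End Geometry.

(** * The groupoid kernel at a unit *)

Section KernelUnit.
Context {R : realType}.
Local Notation mu := (@lebesgue_measure R).

Lemma continuous_comp_within (X : topologicalType) (A : set X) (k : X -> R)
    (g : R -> X) :
  {within A, continuous k} -> continuous g -> (forall s, A (g s)) ->
  continuous (k \o g).
Proof.
move=> /subspace_continuousP kA cg Ag s.
move=> P /(kA _ (Ag s)) wP.
have : nbhs s (fun z => A (g z) -> P (k (g z))) by exact: cg s _ wP.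
by apply: filterS => z; apply.
Qed.

Lemma continuous_pair (X U V : topologicalType) (f : X -> U) (g : X -> V) :
  continuous f -> continuous g -> continuous (fun x => (f x, g x)).
Proof.
move=> cf cg x.
exact: (@cvg_pair _ _ _ (nbhs x) (nbhs (f x)) (nbhs (g x)) _ _ _ f g (cf x) (cg x)).
Qed.

Lemma continuous_dhol alpha (nu : covector) : conormal alpha nu ->
  continuous (fun s : R => dhol alpha s nu).
Proof.
case: nu => p xi pxi s.
have -> : (fun s => dhol alpha s (p, xi)) = fun s => (flow alpha s p,
    xi + (s * (omega alpha * symbol_a alpha (p, xi))) *: delta_mx 2 0).
  by apply/funext => z; exact: dholE.
have cZ (n m : nat) (u v : 'M[R]_(n, m)) (e : R) :
    continuous (fun s : R => u + (s * e) *: v).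
  move=> z; apply: cvgD; first exact: cvg_cst.
  by apply: cvgZr_tmp; apply: cvgMl; exact: cvg_id.
exact: (continuous_pair (cZ _ _ p (Xfield alpha p) (Num.sqrt (1 + alpha ^+ 2))^-1)
  (cZ _ _ xi _ _)).
Qed.

(** [kap s s1] is the kernel on the arrow with range [dhol alpha s nu] and displacement s1 - s.
    Continuity of k is known only over conormal covectors, which linear holonomy preserves. *)
Lemma kernel_unit (Gam : set 'rV[R]_3) (alpha eps t : R)
    (E : covector -> R -> (R -> R) -> (R -> R)) (k : arrow -> R)
    (nu : covector) :
  symbol_semigroup eps alpha E -> symbol_kernel Gam alpha t E k ->
  alpha != 0 -> 0 < t -> conormal alpha nu -> symbol_a alpha nu != 0 ->
  k (unitN nu) = mehler (symbol_a alpha nu) (symbol_b nu)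
    (omega alpha * symbol_a alpha nu) t 0.
Proof.
move=> HE Hk alpha0 t0 cnu a0.
have om0 : omega alpha != 0.
  by rewrite /omega !mulf_neq0 // invr_eq0 gt_eqF // sqr1_gt0.
pose kap s s1 := k (mulN (invN alpha (nu, s)) (nu, s1)).
have kapE : k (unitN nu) = kap 0 0.
  by rewrite /kap /mulN /invN /rN /sN /= dhol0 // oppr0 addr0.
rewrite kapE.
apply: (@mehler_kernel _ _ _ _ (mulf_neq0 om0 a0) (symbol_graph eps alpha nu)
  (fun s => conorm2 (sN alpha (nu, s))) (E nu)) => //.
- move=> x; case: nu cnu {a0 kap kapE} => p xi pxi.
  exact: conorm2_dhol.
- by move=> f sf; exists f.
- exact: HE.
- move=> s; apply: (continuous_comp_within (kernel_continuous Hk)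
    (g := fun s1 => mulN (invN alpha (nu, s)) (nu, s1))) => [s1|s1].
    apply: continuous_pair => z; first exact: cvg_cst.
    by apply: cvgD; [exact: cvg_cst|exact: cvg_id].
  exact: conormal_dhol.
- apply: (continuous_comp_within (kernel_continuous Hk)
    (g := fun s => mulN (invN alpha (nu, s)) (nu, 0))) => [s|s].
    apply: continuous_pair => [|z]; first exact: continuous_dhol.
    by apply: cvgD; [apply: cvgN; exact: cvg_id|exact: cvg_cst].
  exact: conormal_dhol.
- by move=> f Lf; exact: (kernelE Hk cnu Lf).
Qed.

End KernelUnit.

(** * Integration over the conormal bundle *)

Section AffineSubstitution.
Context {R : realType}.
Local Notation mu := (@lebesgue_measure R).
Context (c e : R) (c_gt0 : 0 < c).

Let phi : R -> measurableTypeR R := fun x => c * x + e.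

Let mphi : measurable_fun [set: R] phi.
Proof.
by apply: measurable_funD => //; apply: measurable_funM.
Qed.

(** Both sides are measures that agree on half-open intervals. *)
Lemma lebesgue_measure_affine (A : set R) : measurable A ->
  mu A = (c%:E * mu (phi @^-1` A))%E.
Proof.
move=> mA.
pose nu : {measure set (measurableTypeR R) -> \bar R} :=
  mscale (NngNum (ltW c_gt0)) (pushforward mu phi).
rewrite (@lebesgue_measure_unique _ (nu mphi)) // => _ [[x y]] _ <-.
pose I : set R := `](x - e) / c, (y - e) / c]%classic.
transitivity (c%:E * mu I)%E; last first.
  congr (_ * mu _)%E; rewrite /I.
  apply/seteqP; split => z /=; rewrite !in_itv /= ltr_pdivrMr // ler_pdivlMr //;
    by rewrite /phi ltrBlDr lerBrDr mulrC.
rewrite !lebesgue_measure_itv /= !lte_fin ltr_pM2r ?invr_gt0 // ltrD2r.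
case: ifPn => [xy|_]; last by rewrite mule0.
by rewrite -!EFinB -EFinM; congr EFin; field; rewrite gt_eqF.
Qed.

Lemma ge0_integral_affine (f : R -> \bar R) : measurable_fun [set: R] f ->
  (forall x, (0 <= f x)%E) ->
  (\int[mu]_x f x = c%:E * \int[mu]_x f (c * x + e)%R)%E.
Proof.
move=> mf f0.
pose P : {measure set (measurableTypeR R) -> \bar R} := pushforward mu phi.
have -> : (\int[mu]_x f (c * x + e)%R = \int[P mphi]_y f y)%E.
  by rewrite ge0_integral_pushforward.
pose k : {nonneg R} := NngNum (ltW c_gt0).
rewrite -[c]/(k%:num) -ge0_integral_mscale //.
apply: eq_measure_integral => A mA _.
exact: lebesgue_measure_affine.
Qed.

End AffineSubstitution.

(* The library declares [m1 \x m2] sigma-finite only for subprobabilities. *)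
Section ProductLebesgue.
Context {R : realType}.
Local Notation mu := (@lebesgue_measure R).

Let sigma_finite_mumu : sigma_finite setT (mu \x mu)%E.
Proof.
have /sigma_finiteP[F [TF ndF Foo]] := sigma_finiteT mu.
exists (fun n => F n `*` F n).
  rewrite -setXTT TF predeqE => -[x y]; split.
    move=> [/= [n _ Fnx] [k _ Gky]]; exists (maxn n k) => //; split.
    - by move: x Fnx; exact/subsetPset/ndF/leq_maxl.
    - by move: y Gky; exact/subsetPset/ndF/leq_maxr.
  by move=> [n _ []/= ? ?]; split; exists n.
move=> n; have [? ?] := Foo n.
split; first exact: measurableX.
by rewrite product_measure1E// lte_mul_pinfty// ge0_fin_numE.
Qed.

Definition lebesgue_plane :
    {sigma_finite_measure set (measurableTypeR R * measurableTypeR R)%type -> \bar R} :=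
  HB.pack (mu \x mu)%E
    (Measure_isSigmaFinite.Build _ _ _ (mu \x mu)%E sigma_finite_mumu).

End ProductLebesgue.

Section ShearSubstitution.
Context {R : realType}.
Local Notation mu := (@lebesgue_measure R).
Context (gam del : R -> R) (gam_gt0 : forall w, 0 < gam w)
  (mgam : measurable_fun [set: R] gam) (mdel : measurable_fun [set: R] del).

(** For suitable [gam] and [del] this takes the foliated coordinates (x, y) to (u, v, w). It is
    triangular for fixed w, with Jacobian [gam]. *)
Definition shear (z : R * R * R) : R * R * R :=
  ((gam z.2 * z.1.1, z.1.2 + del z.2 * z.1.1), z.2).

Lemma measurable_shear : measurable_fun [set: R * R * R] shear.
Proof.
have m2 : measurable_fun [set: R * R * R] (fun z => z.2) by exact: measurable_snd.
have m11 : measurable_fun [set: R * R * R] (fun z => z.1.1).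
  by apply: measurableT_comp; [exact: measurable_fst|exact: measurable_fst].
have m12 : measurable_fun [set: R * R * R] (fun z => z.1.2).
  by apply: measurableT_comp; [exact: measurable_snd|exact: measurable_fst].
apply: measurable_fun_pair => //; apply: measurable_fun_pair => /=.
  by apply: measurable_funM => //; exact: measurableT_comp.
apply: measurable_funD => //; apply: measurable_funM => //.
exact: measurableT_comp.
Qed.

(** Tonelli with w outermost and then u makes the substitutions in u and v affine in one
    variable. *)
Lemma ge0_integral_shear (f : R * R * R -> \bar R) :
  measurable_fun [set: R * R * R] f -> (forall z, (0 <= f z)%E) ->
  (\int[(mu \x mu) \x mu]_z f z =
   \int[(mu \x mu) \x mu]_z ((gam z.2)%:E * f (shear z)))%E.
Proof.
move=> mf f0.
have mgf : measurable_fun [set: R * R * R] (fun z => (gam z.2)%:E * f (shear z))%E.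
  apply: emeasurable_funM; last exact: measurableT_comp mf measurable_shear.
  apply/measurable_EFinP; apply: measurableT_comp => //.
have gf0 z : (0 <= (gam z.2)%:E * f (shear z))%E.
  by rewrite mule_ge0 // lee_fin ltW.
have E1 := fubini_tonelli2 (m1 := lebesgue_plane) (m2 := mu) f mf f0.
have E2 := fubini_tonelli2 (m1 := lebesgue_plane) (m2 := mu) _ mgf gf0.
apply: etrans E1 _; apply: etrans (esym E2).
apply: eq_integral => w _.
rewrite /fubini_G.
have mfw : measurable_fun [set: R * R] (fun z => f (z, w)).
  by apply: measurableT_comp => //; exact: measurable_pair2.
have mgfw : measurable_fun [set: R * R] (fun z => (gam w)%:E * f (shear (z, w)))%E.
  by apply: (measurableT_comp mgf); exact: measurable_pair2.
rewrite (@fubini_tonelli1 _ _ _ _ _ mu mu (fun z => f (z, w))) //.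
rewrite (@fubini_tonelli1 _ _ _ _ _ mu mu
  (fun z => (gam w)%:E * f (shear (z, w)))%E) //; last first.
  by move=> z; exact: (gf0 (z, w)).
rewrite /fubini_F.
have mF := measurable_fun_fubini_tonelli_F (m2 := mu) _ mfw (fun z => f0 (z, w)).
rewrite (ge0_integral_affine 0 (gam_gt0 w) mF); last first.
  by move=> x; apply: integral_ge0.
rewrite -ge0_integralZl //; last 3 first.
- apply: (measurableT_comp mF).
  by apply: measurable_funD => //; exact: measurable_funM.
- by move=> x _; apply: integral_ge0.
- by rewrite lee_fin ltW.
apply: eq_integral => x _; rewrite addr0 /fubini_F.
have mfwx : measurable_fun [set: R] (fun y => f ((gam w * x, y), w)).
  apply: (measurableT_comp mfw); exact: measurable_pair1.
rewrite (ge0_integral_affine (del w * x) ltr01 mfwx) // mul1e.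
rewrite -ge0_integralZl //.
- by apply: eq_integral => y _; rewrite mul1r.
- apply: (measurableT_comp mfwx).
  by apply: measurable_funD => //; exact: measurable_funM.
- by rewrite lee_fin ltW.
Qed.

End ShearSubstitution.

(** * The integral over b at a unit *)

Section FiberIntegral.
Context {R : realType}.
Local Notation mu := (@lebesgue_measure R).

Lemma measurable_inv : measurable_fun [set: R] (fun x : R => x^-1).
Proof.
have -> : [set: R] = [set 0] `|` [set x : R | x != 0].
  by apply/seteqP; split => // x _ /=; have [->|] := eqVneq x 0; [left|right].
have mo : measurable [set x : R | x != 0].
  by apply: open_measurable; exact: open_neq.
apply/measurable_funU => //; split; first exact: measurable_fun_set1.
apply: open_continuous_measurable_fun; first exact: open_neq.
by move=> x; rewrite inE => x0; exact: inv_continuous.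
Qed.

Section measurable_mehler.
Context (d : measure_display) (T : measurableType d).
Context (f : T -> R) (mf : measurable_fun [set: T] f).

Lemma measurable_funV : measurable_fun [set: T] (fun z => (f z)^-1).
Proof. exact: (measurableT_comp measurable_inv). Qed.

Lemma measurable_sinh : measurable_fun [set: T] (fun z => sinh (f z)).
Proof.
apply: measurable_funM => //; apply: measurable_funB; first exact: measurableT_comp.
by apply: measurableT_comp => //; exact: measurableT_comp.
Qed.

Lemma measurable_cosh : measurable_fun [set: T] (fun z => cosh (f z)).
Proof.
apply: measurable_funM => //; apply: measurable_funD; first exact: measurableT_comp.
by apply: measurableT_comp => //; exact: measurableT_comp.
Qed.

End measurable_mehler.

Lemma mehler0E (a b beta t : R) : mehler a b beta t 0 = expR (mehlerS a b beta t).
Proof. by rewrite /mehler /gaussian expr0n mulr0 oppr0 mulr0 !add0r. Qed.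

Lemma measurable_mehler (d : measure_display) (T : measurableType d)
    (f g : T -> R) (om t : R) :
  measurable_fun [set: T] f -> measurable_fun [set: T] g ->
  measurable_fun [set: T] (fun z => mehler (f z) (g z) (om * f z) t 0).
Proof.
move=> mf mg; under eq_fun do rewrite mehler0E /mehlerS.
have mb : measurable_fun [set: T] (fun z => om * f z) by exact: measurable_funM.
have marg : measurable_fun [set: T] (fun z => 2 * (om * f z) * t).
  by apply: measurable_funM => //; exact: measurable_funM.
have ms := measurable_sinh marg; have mc := measurable_cosh marg.
apply: measurableT_comp => //; apply: measurable_funB.
  apply: measurable_funB.
    apply: measurable_funM => //; apply: measurableT_comp => //.
    apply: measurable_funM => //; apply: measurable_funV.
    by apply: measurable_funM.
  by apply: measurable_funM => //; exact: measurable_funX.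
apply: measurable_funM.
  apply: measurable_funM; first exact: measurable_funX.
  exact: measurable_funV.
apply: measurable_funM; last exact: measurable_funV.
by apply: measurable_funB.
Qed.

(** Here 0 / 0 = 0, so the value at a = 0 is 0 and not the limit 1 / t; a single point does not
    affect the integrals. *)
Definition trace_density (om t a : R) : R :=
  om * a / sinh (om * t * a) * expR (- (t * a ^+ 2)).

Lemma measurable_trace_density om t : measurable_fun [set: R] (trace_density om t).
Proof.
apply: measurable_funM.
  apply: measurable_funM; first exact: measurable_funM.
  by apply/measurable_funV/measurable_sinh; exact: measurable_funM.
apply: measurableT_comp => //; apply: measurableT_comp => //.
by apply: measurable_funM => //; exact: measurable_funX.
Qed.

Lemma trace_density_ge0 om t a : 0 < t -> 0 <= trace_density om t a.
Proof.
move=> t0; rewrite /trace_density mulr_ge0 ?expR_ge0 //.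
have [->|oma] := eqVneq (om * a) 0; first by rewrite mul0r.
have := mul_sinh_gt0 oma t0; rewrite [om * t * a]mulrAC.
have := sinh_neq0 oma t0; set s := sinh _ => s0 h.
rewrite (_ : _ / s = om * a * s / s ^+ 2); last by field.
by rewrite divr_ge0 ?sqr_ge0 // ltW.
Qed.

Lemma cosh2xB1 (x : R) : cosh (2 * x) - 1 = 2 * sinh x ^+ 2.
Proof.
have e1 : expR x * expR (- x) = 1 by rewrite -expRD subrr expR0.
rewrite /cosh /sinh -mulrN !expRM_natl.
apply/eqP; rewrite -subr_eq0; apply/eqP.
transitivity (expR x * expR (- x) - 1); last by rewrite e1 subrr.
by field.
Qed.

(** At x = 0 Mehler's kernel is Gaussian in b, with coefficient p = tanh (beta t) / beta. By cosh (2
    y) - 1 = 2 sinh (y)^2 the two square roots combine into that of (beta / (2 sinh (beta t)))^2. *)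
Lemma integral_mehler_unit (a om t : R) : 0 < t -> om != 0 -> a != 0 ->
  (\int[mu]_b (mehler a b (om * a) t 0)%:E = (2^-1 * trace_density om t a)%:E)%E.
Proof.
move=> t0 om0 a0; set beta := om * a.
have beta0 : beta != 0 by rewrite mulf_neq0.
set c := cosh (2 * beta * t); set s := sinh (2 * beta * t).
have s0 : s != 0 by exact: mehler_sinh_neq0.
have st0 : sinh (beta * t) != 0 by exact: sinh_neq0.
have bs : 0 < beta / s by exact: mehler_sinh_gt0.
have bst := mul_sinh_gt0 beta0 t0.
have c1 : c - 1 = 2 * sinh (beta * t) ^+ 2 by rewrite /c -mulrA cosh2xB1.
have c10 : 0 < c - 1 by rewrite c1 mulr_gt0 // exprn_even_gt0.
pose p := (c - 1) / s / beta.
have p0 : 0 < p.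
  rewrite (_ : p = (c - 1) * (beta / s) / beta ^+ 2); last first.
    by rewrite /p; field; rewrite s0 beta0.
  by apply: divr_gt0; [exact: mulr_gt0|rewrite exprn_even_gt0].
have mE b : mehler a b beta t 0 = Num.sqrt (beta / (2 * s) / pi) *
    gaussian p 0 (- (a ^+ 2 * t)) b.
  rewrite mehler0E expR_mehlerS // /gaussian -/c -/s; congr (_ * expR _).
  by rewrite /p; field; rewrite s0 beta0.
under eq_integral do rewrite mE EFinM.
rewrite integralZl //; last exact: integrable_gaussian.
rewrite integral_gaussian // -EFinM; congr EFin.
rewrite expr0n mul0r add0r mulrA -sqrtrM; last first.
  rewrite divr_ge0 ?pi_ge0 //; have -> : beta / (2 * s) = beta / s / 2.
    by field.
  by rewrite divr_ge0 // ltW.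
rewrite /trace_density [om * t * a]mulrAC -/beta [t * _]mulrC.
rewrite [RHS]mulrA; congr (_ * _).
have -> : beta / (2 * s) / pi * (pi / p) = (beta / sinh (beta * t) / 2) ^+ 2.
  have pi0 : pi != 0 :> R by rewrite gt_eqF // pi_gt0.
  move: (pi : R) pi0 => q q0.
  rewrite /p c1; field; rewrite s0 q0 st0 beta0 //.
rewrite sqrtr_sqr ger0_norm; first by rewrite mulrC.
rewrite divr_ge0 // (_ : _ / _ = beta * sinh (beta * t) / sinh (beta * t) ^+ 2).
  by rewrite divr_ge0 ?sqr_ge0 // ltW.
by field.
Qed.

End FiberIntegral.

(** * The trace in foliated coordinates *)

Section TraceFormula.
Context {R : realType}.
Local Notation mu := (@lebesgue_measure R).
Context (alpha : R).
Local Notation N := (Num.sqrt (1 + alpha ^+ 2)).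

Let N_gt0 : 0 < N. Proof. by rewrite sqrtr_gt0 sqr1_gt0. Qed.

Lemma jacobian_ycoord_mul (p : 'rV[R]_3) (y : 'cV[R]_2) :
  'J (ycoord alpha) p *m y =
  \col_i [:: - (alpha * expR (- (2 * wcoord p)) * y 0 0); y 0 0;
    2 * alpha * expR (- (2 * wcoord p)) * ucoord p * y 0 0 + y 1 0]`_i.
Proof.
pose d0 (h : 'rV[R]_3) := h 0 1 - (alpha * expR (- (2 * p 0 2)) * h 0 0 +
  p 0 0 * (alpha * (- (2 * h 0 2) * expR (- (2 * p 0 2))))).
pose d1 (h : 'rV[R]_3) := h 0 2.
pose df (j : 'I_2) := nth (fun=> 0) [:: d0; d1] j.
have fd j : is_diff p (fun q => ycoord alpha q 0 j : R) (df j).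
  case: j => -[|[|//]] i.
  - rewrite (_ : Ordinal i = 0); last exact/val_inj.
    rewrite (_ : (fun _ => _) = (fun q : 'rV[R]_3 => q 0 1) -
        (alpha \*: (fun q : 'rV[R]_3 => expR (- (2 * q 0 2)))) *
        (fun q : 'rV[R]_3 => q 0 0)); last first.
      by apply/funext => z; rewrite mxE.
    apply: is_diffB; first exact: is_diff_coord.
    apply: is_diffM; last exact: is_diff_coord.
    apply: is_diffZ; apply: is_diff_expR.
    by apply: is_diffN; apply: is_diffZ; exact: is_diff_coord.
  - rewrite (_ : Ordinal i = 1); last exact/val_inj.
    rewrite (_ : (fun _ => _) = (fun q : 'rV[R]_3 => q 0 2)); last first.
      by apply/funext => z; rewrite mxE.
    exact: is_diff_coord.
apply/colP => i; rewrite (jacobian_mul _ _ fd) !big_ord_recl big_ord0 /df /= /d0 /d1 !mxE /=.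
rewrite (_ : lift ord0 ord0 = 1); last exact/val_inj.
rewrite /wcoord /ucoord.
by case: i => -[|[|[|//]]] i; rewrite /= ?mulr1n ?mulr0n; ring.
Qed.

(** The passage from (eta_1, eta_2) to (a, b) is triangular with determinant [scale p]. [drift p],
    the dw component of dy_1, only translates b. *)
Let drift (p : 'rV[R]_3) : R := 2 * alpha * expR (- (2 * wcoord p)) * ucoord p.
Let scale (p : 'rV[R]_3) : R := N * expR (- wcoord p).

Let scale_gt0 p : 0 < scale p. Proof. by rewrite mulr_gt0 // expR_gt0. Qed.

Lemma conormal_conormal_coord p eta : conormal alpha (conormal_coord alpha p eta).
Proof.
rewrite /conormal_coord; apply/conormalE.
rewrite jacobian_ycoord_mul !mxE /=.
have -> : expR (- (2 * wcoord p)) = expR (- wcoord p) * expR (- wcoord p).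
  by rewrite -expRD; congr expR; ring.
have e1 : expR (wcoord p) * expR (- wcoord p) = 1 by rewrite -expRD subrr expR0.
transitivity (- (alpha * (expR (wcoord p) * expR (- wcoord p)) *
  expR (- wcoord p) * eta.1)); first by ring.
by rewrite e1 mulr1.
Qed.

Lemma symbol_a_conormal_coord p eta :
  symbol_a alpha (conormal_coord alpha p eta) = scale p * eta.1.
Proof. by rewrite /symbol_a /= jacobian_ycoord_mul !mxE. Qed.

Lemma symbol_b_conormal_coord p eta :
  symbol_b (conormal_coord alpha p eta) = 1 * eta.2 + drift p * eta.1.
Proof. by rewrite /symbol_b /= jacobian_ycoord_mul !mxE /= mul1r addrC. Qed.

Lemma continuous_conormal_coord p (e1 : R) :
  continuous (fun e2 : R => unitN (conormal_coord alpha p (e1, e2))).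
Proof.
apply: continuous_pair => z; last exact: cvg_cst.
apply: continuous_pair => {}z; first exact: cvg_cst.
have -> : (fun e2 => 'J (ycoord alpha) p *m \col_j [:: (e1, e2).1; (e1, e2).2]`_j) =
  (fun e2 : R => 'J (ycoord alpha) p *m (e1 *: delta_mx 0 0) +
    e2 *: ('J (ycoord alpha) p *m delta_mx 1 0)).
  apply/funext => e2; rewrite scalemxAr -mulmxDr; congr (_ *m _).
  by apply/colP => -[[|[|//]] i]; rewrite !mxE /= ?mulr1 ?mulr0 ?addr0 ?add0r.
apply: cvgD; first exact: cvg_cst.
by apply: cvgZr_tmp; exact: cvg_id.
Qed.

Context (Gam : set 'rV[R]_3) (eps t : R)
  (E : @covector R -> R -> (R -> R) -> (R -> R)) (k : @arrow R -> R).
Context (HE : symbol_semigroup eps alpha E) (Hk : symbol_kernel Gam alpha t E k).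
Context (alpha_neq0 : alpha != 0) (t_gt0 : 0 < t).

Let om_neq0 : omega alpha != 0.
Proof. by rewrite /omega !mulf_neq0 // invr_eq0 gt_eqF // sqr1_gt0. Qed.

Let trace_int : \bar R := (\int[mu]_a (trace_density (omega alpha) t a)%:E)%E.

Lemma integral_fiber (p : 'rV[R]_3) :
  (\int[mu \x mu]_eta (k (unitN (conormal_coord alpha p eta)))%:E =
   (expR (wcoord p) / N)%:E * ((2^-1)%:E * trace_int))%E.
Proof.
pose F1 (eta : R * R) := k (unitN (conormal_coord alpha p eta)).
pose F2 (eta : R * R) := mehler (scale p * eta.1) (1 * eta.2 + drift p * eta.1)
  (omega alpha * (scale p * eta.1)) t 0.
have m1 : measurable_fun [set: R * R] (fun z => z.1) by exact: measurable_fst.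
have m2 : measurable_fun [set: R * R] (fun z => z.2) by exact: measurable_snd.
have mF2 : measurable_fun [set: R * R] F2.
  apply: (@measurable_mehler _ _ _ (fun eta : R * R => scale p * eta.1)).
    exact: measurable_funM.
  by apply: measurable_funD; exact: measurable_funM.
have F20 eta : 0 <= F2 eta by exact: gaussian_ge0.
have F12 eta : eta.1 != 0 -> F1 eta = F2 eta.
  move=> eta0; rewrite /F1 (kernel_unit HE Hk) //.
  - by rewrite symbol_a_conormal_coord symbol_b_conormal_coord.
  - exact: conormal_conormal_coord.
  - by rewrite symbol_a_conormal_coord mulf_neq0 // gt_eqF.
have mF1 : measurable_fun [set: R * R] F1.
  (* On the line eta_1 = 0 measurability comes from the continuity of k; elsewhere it comes from
     Mehler's formula. *)
  have -> : F1 = fun eta => if eta.1 == 0 then F1 (0, eta.2) else F2 eta.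
    apply/funext => eta; case: eqP => [e0|/eqP e0]; last exact: F12.
    by rewrite /F1 -e0; case: (eta).
  apply: measurable_fun_ifT => //.
    by apply: measurable_fun_eqr => //; exact: measurable_cst.
  apply: (measurableT_comp (f := fun e2 => F1 (0, e2))) => //.
  apply: continuous_measurable_fun.
  apply: (continuous_comp_within (kernel_continuous Hk)) => [|s].
    exact: continuous_conormal_coord.
  exact: conormal_conormal_coord.
transitivity (\int[mu \x mu]_eta (F2 eta)%:E)%E.
  apply: ae_eq_integral => //; [exact/measurable_EFinP|exact/measurable_EFinP|].
  exists ([set 0] `*` [set: R]); split.
  - exact: measurableX.
  - apply: etrans (product_measure1E mu mu (measurable_set1 (0 : R)) measurableT) _.
    by rewrite [X in (X * _)%E](lebesgue_measure_set1 (0 : R)) mul0e.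
  move=> eta /= H; split => //; apply/eqP; apply: contraT => e0.
  by exfalso; apply: H => _; rewrite -/(F1 eta) F12.
have mF2E : measurable_fun [set: R * R] (fun z => (F2 z)%:E).
  exact/measurable_EFinP.
have F2E0 z : (0 <= (F2 z)%:E)%E by rewrite lee_fin.
rewrite (@fubini_tonelli1 _ _ _ _ _ mu mu (fun z => (F2 z)%:E) mF2E F2E0).
pose G (a : R) : \bar R := (2^-1 * trace_density (omega alpha) t a)%:E.
have mG : measurable_fun [set: R] G.
  by apply/measurable_EFinP; apply: measurable_funM => //; exact: measurable_trace_density.
have G0 a : (0 <= G a)%E by rewrite lee_fin mulr_ge0 // trace_density_ge0.
have mFF := measurable_fun_fubini_tonelli_F (m2 := mu) _ mF2E F2E0.
have mGs : measurable_fun [set: R] (fun x => G (scale p * x + 0)).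
  have msc : measurable_fun [set: R] (fun x : R => scale p * x + 0).
    by apply: measurable_funD => //; exact: measurable_funM.
  exact: (measurableT_comp mG msc).
transitivity (\int[mu]_x G (scale p * x + 0)%R)%E.
  apply: (@ge0_ae_eq_integral _ _ _ mu setT) => //.
    by move=> x _; apply: integral_ge0 => y _; rewrite lee_fin.
  (* The point x = 0 is set aside once more, since the integral over b is computed for a nonzero
     a. *)
  exists [set 0]; split => //; first exact: lebesgue_measure_set1.
  move=> x /= H; apply/eqP; apply: contraT => x0; exfalso; apply: H => _.
  rewrite /fubini_F addr0 /F2 /=.
  have sx0 : scale p * x != 0 by rewrite mulf_neq0 // gt_eqF.
  rewrite /G -(integral_mehler_unit t_gt0 om_neq0 sx0).
  rewrite [RHS](ge0_integral_affine (drift p * x) ltr01) ?mul1e //.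
  - by apply/measurable_EFinP; apply: (@measurable_mehler _ _ _ (cst (scale p * x)) id).
  - by move=> y; rewrite lee_fin; exact: gaussian_ge0.
have := ge0_integral_affine 0 (scale_gt0 p) mG G0.
have -> : (\int[mu]_x G x = (2^-1)%:E * trace_int)%E.
  rewrite /G; under eq_integral do rewrite EFinM.
  rewrite ge0_integralZl //.
  - by apply/measurable_EFinP; exact: measurable_trace_density.
  - by move=> x _; rewrite lee_fin trace_density_ge0.
move=> ->; rewrite muleA -EFinM (_ : _ * scale p = 1) ?mul1e //.
by rewrite /scale expRN; field; rewrite !gt_eqF // expR_gt0.
Qed.

Lemma trace_formula (D : set 'rV[R]_3) : measurable (pt @^-1` D) ->
  (traceFN alpha D k = volume D * ((2^-1)%:E * trace_int))%E.
Proof.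
move=> mD; set I0 := (_ * trace_int)%E.
have I00 : (0 <= I0)%E.
  apply: mule_ge0; first by rewrite lee_fin.
  by apply: integral_ge0 => x _; rewrite lee_fin trace_density_ge0.
pose gam (w : R) := expR w / N.
pose del (w : R) := alpha * expR (- w) / N.
have gam0 w : 0 < gam w by rewrite divr_gt0 // expR_gt0.
have mgam : measurable_fun [set: R] gam by exact: measurable_funM.
have mdel : measurable_fun [set: R] del.
  apply: measurable_funM => //; apply: measurable_funM => //.
  by apply: measurableT_comp => //; exact: measurableT_comp.
have folE z : foliated alpha z = pt (shear gam del z).
  rewrite /foliated /pt /shear /=; apply: vec3P;
    rewrite ?(ucoord_flow, vcoord_flow, wcoord_flow, vec3E) //.
  - by rewrite /gam; ring.
  - by rewrite /del; ring.
pose f : R * R * R -> \bar R := (cst I0) \_ (pt @^-1` D).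
have f0 z : (0 <= f z)%E by apply: erestrict_ge0.
have mf : measurable_fun [set: R * R * R] f.
  by apply/(measurable_restrictT _ mD).
transitivity (\int[(mu \x mu) \x mu]_z f z)%E.
  (* The factor expR w / N of the fibre integral is exactly the Jacobian [gam] of the shear, so the
     integrand becomes the constant [I0] in the coordinates (u, v, w). *)
  rewrite (ge0_integral_shear gam0 mgam mdel mf f0) /traceFN integral_mkcond.
  apply: eq_integral => z _; rewrite /f !patchE /=.
  rewrite (_ : (z \in _) = (shear gam del z \in pt @^-1` D)); last first.
    by apply/idP/idP; rewrite !inE /= folE.
  case: ifPn => _; last by rewrite mule0.
  by rewrite integral_fiber /foliated wcoord_flow vec3E.
rewrite /f -integral_mkcond integral_cst // muleC; congr (_ * _)%E.
rewrite /volume.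
(* The exponentials in the metric cancel in the determinant, so the Riemannian volume is Lebesgue
   measure in (u, v, w). *)
under [RHS]eq_integral => z _.
  rewrite /metric det_diag big_ord_recl !big_ord_recl big_ord0 !mxE /=.
  rewrite !mulr1 -expRD addNr expR0 sqrtr1.
  over.
by rewrite integral_cst // mul1e.
Qed.

End TraceFormula.

Theorem theorem2p5 (R : realType)
  (A : 'M[int]_2) (lambda : R) (eu ev : 'cV[R]_2)
  (alpha eps t : R)
  (D : set 'rV[R]_3)
  (E : covector -> R -> (R -> R) -> (R -> R))
  (k : arrow -> R)
  (detA : \det A = 1) (trA : 2 < `|\tr A|)
  (lambda_gt1 : 1 < lambda)
  (eigen_u : map_mx intr A *m eu = lambda *: eu)
  (eigen_v : map_mx intr A *m ev = lambda^-1 *: ev)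
  (oriented : 0 < \det (row_mx eu ev : 'M[R]_2))
  (alpha_neq0 : alpha != 0) (eps_gt0 : 0 < eps) (t_gt0 : 0 < t)
  (D_fundamental : fundamental_domain (GA (Cmat eu ev) lambda) D)
  (E_semigroup : symbol_semigroup eps alpha E)
  (k_kernel : symbol_kernel (GA (Cmat eu ev) lambda) alpha t E k) :
  let omega := 2 * alpha / (1 + alpha ^+ 2) in
  (traceFN alpha D k =
   volume D *
   ((2^-1)%:E * \int[lebesgue_measure]_(eta in setT)
      (omega * eta / sinh (omega * t * eta) * expR (- (t * eta ^+ 2)))%:E))%E.
Proof.
exact: (trace_formula E_semigroup k_kernel alpha_neq0 t_gt0 D_fundamental.1).
Qed.
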